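(* Let $n,l\ge1$ be integers, let $X_1(\cdot),\dots,X_n(\cdot)$ be i.i.d. realizations of the process $X(\cdot)$ described in the context, and let $t>0$. Let $$\hat A^{(l)}\in\operatorname{argmin}_{A\in\mathcal S_l,\,A\ge 0}\left(\|R_n^{(l)}-A-\sigma^2I^{(l)}\|_2^2+\mu\|A\|_1\right),\qquad \mu=c(\lambda_{\max}+\sigma^2)\,\delta_n(l,t),$$ for some sufficiently large absolute constant $c>0$. Then $$\sup_{K\in\mathcal K_{r,l}(\lambda_{\max})}\mathbb E\left[\|\hat A^{(l)}-K\|_2^2\right]\le C(\lambda_{\max}+\sigma^2)^2\,\frac{(r\wedge l)\,l}{n}$$ for some absolute constant $C>0$.
   Context: Model: $X(t)$, $t\in[0,1]$, satisfies $dX(t)=S(t)\,dt+\sigma\,dW(t)$, where $W$ is standard Brownian motion, $\sigma>0$ is a known noise level, and $S(t)=\sum_{k=1}^r\sqrt{\lambda_k}\,\xi_k\varphi_k(t)$, possibly with $r=\infty$, with $\xi_k$ i.i.d. standard Gaussian variables independent of $W$, $\{\varphi_k\}_{k=1}^r$ orthonormal in $L_2[0,1]$, $\lambda_k>0$, $\sum_{k=1}^r\lambda_k<\infty$. The covariance function of $S$ is $K(t,u)=\sum_{k=1}^r\lambda_k\varphi_k(t)\varphi_k(u)$ (for $r=\infty$ the sum converges in $L_2([0,1]^2)$). The expectation is taken under the law of the data for the given $K$. Fix an orthonormal basis $e_1,e_2,\dots$ of $L_2[0,1]$. For $l\ge1$, set $\dot X_i^{(l)}=\sum_{k=1}^l\left(\int_0^1e_k(t)\,dX_i(t)\right)e_k$,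 $R_n^{(l)}(t,u)=\frac1n\sum_{i=1}^n\dot X_i^{(l)}(t)\dot X_i^{(l)}(u)$, $I^{(l)}(t,u)=\sum_{k=1}^le_k(t)e_k(u)$. $\mathcal S_l=\{\sum_{j,k=1}^ls_{jk}\,e_j\otimes e_k:\ s_{jk}=s_{kj},\ j,k=1,\dots,l\}$, where $(e_j\otimes e_k)(t,u)=e_j(t)e_k(u)$. An element $A\in\mathcal S_l$ is identified with the symmetric $l\times l$ matrix of its coefficients; $A\ge0$ means this matrix is non-negative definite, $\|A\|_1$ is its nuclear norm and $\|A\|_\infty$ its spectral norm. $\|\cdot\|_2$ is the norm of $L_2([0,1]^2)$. $\delta_n(l,t)=\max\left\{\sqrt{\frac{l+t}{n}},\frac{l+t}{n}\right\}$, and $r\wedge l=\min(r,l)$. $\lambda_{\max}$ is a finite positive constant, and $\mathcal K_{r,l}(\lambda_{\max})$ is the class of all covariance functions of the form $K=\sum_{k=1}^r\lambda_k\varphi_k\otimes\varphi_k$ as in the model such that $K\in\mathcal S_l$ and $\|K\|_\infty\le\lambda_{\max}$; the system $\{\varphi_k\}$ is not fixed and varies among all orthonormal systems in $L_2[0,1]$.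
   Formalization: With C absolute and t > 0 arbitrary the claim fails (t = Mn, l fixed, n → ∞ makes the estimator 0). Proved instead: for every c ≥ c₀ (c₀ absolute) and every τ > 0, the bound holds for all 0 < t ≤ τl with C depending only on c and τ. *)

(* Defs.v *)
From HB Require Import structures.
From mathcomp Require Export all_boot all_order all_algebra.
From mathcomp Require Export polyrcf.
From mathcomp Require Export all_classical all_reals all_analysis.
From mathcomp Require Export measurable_realfun.
Export Order.TTheory GRing.Theory Num.Theory.
Export numFieldNormedType.Exports.

#[export] Set Implicit Arguments.
#[export] Unset Strict Implicit.
#[export] Unset Printing Implicit Defensive.

Global Open Scope classical_set_scope.
Global Open Scope ring_scope.

Section L2.
Context {R : realType}.

Definition L2sq d (T : measurableType d) (mu : set T -> \bar R) (D : set T)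
    (f : T -> R) : \bar R :=
  (\int[mu]_(x in D) ((f x) ^+ 2)%:E)%E.

Definition unit_itv : set R := `[0, 1]%classic.
Definition unit_sq : set (R * R) := unit_itv `*` unit_itv.

Definition leb : {measure set _ -> \bar R} := @lebesgue_measure R.
Definition leb2 := (@lebesgue_measure R \x @lebesgue_measure R)%E.

Definition in_L2 (f : R -> R) : Prop :=
  measurable_fun unit_itv f /\ (L2sq leb unit_itv f < +oo)%E.

Definition inner (f g : R -> R) : R := \int[leb]_(t in unit_itv) (f t * g t).

Definition orthonormal_sys (J : pred nat) (f : nat -> R -> R) : Prop :=
  (forall k, J k -> in_L2 (f k)) /\
  (forall j k, J j -> J k -> inner (f j) (f k) = (j == k)%:R).

(* e 0, e 1, ... stand for e_1, e_2, ... *)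
Definition orthonormal_basis (e : nat -> R -> R) : Prop :=
  orthonormal_sys xpredT e /\
  forall f, in_L2 f ->
    (fun N : nat => L2sq leb unit_itv
       (fun t => f t - \sum_(k < N) inner f (e k) * e k t)) @ \oo --> 0%E.

End L2.

Section matrices.
Context {R : realType} (l : nat).
Implicit Types A B : 'M[R]_l.

(* Square roots of the eigenvalues of A^T A, repeated with multiplicity. *)
Definition singular_values A : seq R :=
  let p := char_poly (A^T *m A) in
  flatten [seq nseq (mup x p) (Num.sqrt x) | x <- rootsR p].

Definition nuclear_norm A : R := \sum_(s <- singular_values A) s.
Definition spectral_norm A : R := \big[Num.max/0]_(s <- singular_values A) s.

Definition symmetric_mx A : Prop := A^T = A.
Definition nonneg_definite A : Prop :=
  forall x : 'rV[R]_l, 0 <= (x *m A *m x^T) 0 0.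

(* The element of S_l with coefficient matrix A (for symmetric A). *)
Definition kernel_of (e : nat -> R -> R) A (z : R * R) : R :=
  \sum_(j < l) \sum_(k < l) A j k * (e j z.1 * e k z.2).

End matrices.

Section covariance.
Context {R : realType}.

(* The rank r ranges over {1, 2, ..., oo}; None encodes r = oo, and lam k,
   phi k, xi k with [idx r k] are the items of index k + 1 <= r. *)
Definition idx (r : option nat) (k : nat) : bool :=
  if r is Some m then (k < m)%N else true.

Definition rank_min (r : option nat) (l : nat) : nat :=
  if r is Some m then minn m l else l.

(* K is an element of L_2([0,1]^2): only its class modulo a.e. equality on
   [0,1]^2 matters. *)
Definition cov_expansion (r : option nat) (lam : nat -> R)
    (phi : nat -> R -> R) (K : R * R -> R) : Prop :=
  [/\ orthonormal_sys (idx r) phi,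
      forall k, idx r k -> 0 < lam k,
      (\sum_(0 <= k <oo | idx r k) (lam k)%:E < +oo)%E,
      measurable_fun unit_sq K
    & (fun N : nat => L2sq leb2 unit_sq (fun z => K z -
         \sum_(0 <= k < N | idx r k) lam k * (phi k z.1 * phi k z.2)))
      @ \oo --> 0%E].

(* The class K_{r,l}(lmax) relative to the basis e. *)
Definition cov_class (e : nat -> R -> R) (r : option nat) (l : nat) (lmax : R)
    (K : R * R -> R) : Prop :=
  (exists lam phi, cov_expansion r lam phi K) /\
  exists A : 'M[R]_l,
    [/\ symmetric_mx A,
        L2sq leb2 unit_sq (fun z => K z - kernel_of e A z) = 0%E
      & spectral_norm A <= lmax].

End covariance.

Section probability_notions.
Context {R : realType} d (T : measurableType d) (P : probability T R).

Definition mutually_indep (I : eqType) (D : set I) (F : I -> set (set T))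
    : Prop :=
  forall (J : seq I) (A : I -> set T), uniq J ->
    (forall i, i \in J -> D i /\ F i (A i)) ->
    P (\big[setI/setT]_(i <- J) A i) = (\prod_(i <- J) P (A i))%E.

Definition sigma_of (I : Type) (D : set I) (X : I -> T -> R) : set (set T) :=
  <<s \bigcup_(i in D) preimage_set_system setT (X i) measurable >>.

Definition sigma_of1 (X : T -> R) : set (set T) :=
  preimage_set_system setT X measurable.

Definition has_law (X : T -> R) (nu : set R -> \bar R) : Prop :=
  forall B : set R, measurable B -> P (X @^-1` B) = nu B.

(* The second parameter of normal_prob is the standard deviation. *)
Definition brownian_motion (W : R -> {RV P >-> R}) : Prop :=
  [/\ {ae P, forall w, W 0 w = 0},
      forall s t : R, 0 <= s -> s < t -> t <= 1 ->
        has_law (fun w => W t w - W s w) (normal_prob 0 (Num.sqrt (t - s))),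
      forall (m : nat) (s : nat -> R), 0 <= s 0%N ->
        (forall j, s j <= s j.+1) -> s m <= 1 ->
        mutually_indep [set: 'I_m]
          (fun j => sigma_of1 (fun w => W (s j.+1) w - W (s j) w))
    & {ae P, forall w, {within unit_itv, continuous (fun t => W t w)}}].

(* X is a process on [0,1] with dX = S dt + sigma dW. The signal
   S = \sum_k sqrt (lam k) xi k phi k is a jointly measurable process, the
   (possibly infinite) sum being taken in L_2(P x dt). The starting point X 0,
   which the equation does not constrain, is left free. *)
Definition signal_noise_process (sigma : R) (r : option nat) (K : R * R -> R)
    (X : R -> {RV P >-> R}) : Prop :=
  exists (lam : nat -> R) (phi : nat -> R -> R) (xi : nat -> {RV P >-> R})
         (W : R -> {RV P >-> R}) (S : T * R -> R),
    cov_expansion r lam phi K /\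
    (forall k, idx r k -> has_law (xi k) (normal_prob 0 1)) /\
    mutually_indep [set k | idx r k] (fun k => sigma_of1 (xi k)) /\
    brownian_motion W /\
    mutually_indep [set: bool]
      (fun b => if b then sigma_of [set k | idx r k] xi
                else sigma_of unit_itv W) /\
    measurable_fun ([set: T] `*` unit_itv) S /\
    ((fun N : nat => L2sq (P \x @lebesgue_measure R)%E ([set: T] `*` unit_itv)
       (fun z => S z - \sum_(0 <= k < N | idx r k)
                         Num.sqrt (lam k) * xi k z.1 * phi k z.2))
      @ \oo --> 0%E) /\
    {ae P, forall w, forall t, unit_itv t ->
       X t w - X 0 w =
         (\int[leb]_(u in `[0, t]%classic) S (w, u)) + sigma * W t w}.

Definition indep_processes (n : nat) (X : 'I_n -> R -> {RV P >-> R}) : Prop :=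
  mutually_indep [set: 'I_n] (fun i => sigma_of unit_itv (X i)).

(* A list of triples (a, (s, u)) encodes the step function
   \sum a 1_{]s, u]}. *)
Definition step_list := seq (R * (R * R)).

Definition step_in_unit (q : step_list) : Prop :=
  forall x, x \in q -> [/\ 0 <= x.2.1, x.2.1 <= x.2.2 & x.2.2 <= 1].

Definition step_fun (q : step_list) (t : R) : R :=
  \sum_(x <- q) x.1 * (x.2.1 < t <= x.2.2)%R%:R.

Definition step_int (q : step_list) (X : R -> {RV P >-> R}) (w : T) : R :=
  \sum_(x <- q) x.1 * (X x.2.2 w - X x.2.1 w).

(* Y is (a version of) \int_0^1 f(t) dX(t): the L_2(P) limit of the integrals
   of step functions approximating f in L_2[0,1]. *)
Definition stoch_integral (X : R -> {RV P >-> R}) (f : R -> R)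
    (Y : {RV P >-> R}) : Prop :=
  exists q : nat -> step_list,
    [/\ forall m, step_in_unit (q m),
        (fun m => L2sq leb unit_itv (fun t => step_fun (q m) t - f t))
          @ \oo --> 0%E
      & (fun m => L2sq P setT (fun w => step_int (q m) X w - Y w))
          @ \oo --> 0%E].

End probability_notions.

Section estimator.
Context {R : realType}.

Definition Xdot (e : nat -> R -> R) (l : nat) (y : 'I_l -> R) (t : R) : R :=
  \sum_(k < l) y k * e k t.

(* y i k is the observed value of \int_0^1 e_k dX_i. *)
Definition Rn (e : nat -> R -> R) (n l : nat) (y : 'I_n -> 'I_l -> R)
    (z : R * R) : R :=
  n%:R^-1 * \sum_(i < n) Xdot e (y i) z.1 * Xdot e (y i) z.2.

Definition Iker (e : nat -> R -> R) (l : nat) (z : R * R) : R :=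
  \sum_(k < l) e k z.1 * e k z.2.

Definition objective (e : nat -> R -> R) (l : nat) (sigma mu : R)
    (F : R * R -> R) (A : 'M[R]_l) : \bar R :=
  (L2sq leb2 unit_sq
     (fun z => F z - kernel_of e A z - sigma ^+ 2 * Iker e l z)%R
   + (mu * nuclear_norm A)%:E)%E.

Definition is_estimate (e : nat -> R -> R) (l : nat) (sigma mu : R)
    (F : R * R -> R) (A : 'M[R]_l) : Prop :=
  [/\ symmetric_mx A, nonneg_definite A
    & forall B : 'M[R]_l, symmetric_mx B -> nonneg_definite B ->
        (objective e sigma mu F A <= objective e sigma mu F B)%E].

Definition delta (n l : nat) (t : R) : R :=
  Num.max (Num.sqrt ((l%:R + t) / n%:R)) ((l%:R + t) / n%:R).

End estimator.

(* Main.v *)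
Require Import Defs.
From mathcomp Require Import complex.
From mathcomp Require Import ring lra zify.

(** Identify [K] with its coefficient matrix [A] in the observation basis, and
    let [N] be the empirical matrix of the observed coordinates minus
    [sigma^2 + A], the centred noise. On nonnegative definite matrices the
    nuclear norm is the trace ([nuclear_norm_psd]), so the estimator minimises a
    quadratic function plus a linear one over a convex cone that contains [A].

    The deterministic part compares the minimiser with [A] by first-order
    optimality on the segment between them ([first_order_optimality]), in the
    eigenbasis of [A] ([oracle_inequality]). If the quadratic form of [N] is at
    most [mu / 2] on unit vectors, the loss is at most both [2 rank mu^2] and
    [rank mu lmax]. The first is the right order when [delta <= 1], the second
    when [delta > 1], and as [t <= tau l] both are then at most a constant times
    [(lmax + sigma^2)^2 rank l / n] ([penalty_rate]). For arbitrary [N] the loss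
    exceeds such a bound by at most twice the squared Hilbert-Schmidt norm of
    [N], that is by at most [2 l] times its squared spectral norm.

    This excess has to be small in expectation. The spectral norm of [N] is at
    most three times the absolute value of its quadratic form at some point of a
    lattice net of at most [(3 e^25)^l] points ([net_control], [card_net]). So
    the excess is at most [18 l] times the sum over the net of the squares of
    those values of the form that are above [mu / 6] ([oracle_net]), and a
    union bound with exponential moments makes the expectation of that sum at
    most a constant times [(lmax + sigma^2)^2 / n] ([sum_excess]).

    The exponential moments are obtained as follows. For fixed [x] the form of
    [N] at [x] is the centred mean over the [n] independent observations of the
    squares of [\sum_k x_k Y_k]. Each such linear form is an [L2] limit of
    integrals of step functions against the observed process
    ([observed_form_approx]). Such an integral is itself an [L2] limit, over the
    truncations of the signal, of sums of independent Gaussian variables, so its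
    moment generating function is at most that of a Gaussian variable with the
    same variance ([step_int_gaussian_like]). A Bernstein bound for its centred
    square ([gaussian_like_bernstein]) follows, which independence turns into a
    bound for the sum over the observations and Fatou's lemma transfers to the
    limit ([sum_squares_mgf]). *)

(** * The real spectral theorem *)

Section spectral.
Context {R : realType}.

Lemma dotmx_rowE n (x y : 'rV[R]_n) : (x *m y^T) 0 0 = \sum_i x 0 i * y 0 i.
Proof. by rewrite mxE; apply: eq_bigr => i _; rewrite mxE. Qed.

Lemma dot_ge0 n (x : 'rV[R]_n) : 0 <= (x *m x^T) 0 0.
Proof. by rewrite dotmx_rowE sumr_ge0// => i _; rewrite -expr2 sqr_ge0. Qed.

Lemma dot_eq0 n (x : 'rV[R]_n) : ((x *m x^T) 0 0 == 0) = (x == 0).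
Proof.
apply/eqP/eqP => [|->]; last by rewrite mul0mx mxE.
rewrite dotmx_rowE => /eqP; rewrite psumr_eq0; last first.
  by move=> i _; rewrite -expr2 sqr_ge0.
move=> /allP h; apply/rowP => i; rewrite mxE.
by have := h i (mem_index_enum i); rewrite -expr2 sqrf_eq0 => /eqP.
Qed.

Lemma dot_gt0 n (x : 'rV[R]_n) : x != 0 -> 0 < (x *m x^T) 0 0.
Proof. by move=> x0; rewrite lt_def dot_eq0 x0 dot_ge0. Qed.

(** The characteristic polynomial has a complex root. Pairing the real and the
    imaginary part of a complex eigenvector through the symmetric matrix shows
    that the eigenvalue is real, so that each nonzero part is an eigenvector. *)
Lemma symmetric_eigenvector n (A : 'M[R]_n.+1) : symmetric_mx A ->
  exists a, exists2 v : 'rV[R]_n.+1, v != 0 & v *m A = a *: v.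
Proof.
move=> As.
pose f := real_complex R.
have [z rz] : exists z, root (char_poly (map_mx f A)) z.
  by apply/closed_rootP; rewrite size_char_poly.
move: rz; rewrite -eigenvalue_root_char => /eigenvalueP[w wA w0].
pose a := Re z; pose b := Im z.
pose x := map_mx (@Re R) w; pose y := map_mx (@Im R) w.
have Re_sum (I : finType) (F : I -> complex R) :
    Re (\sum_i F i) = \sum_i Re (F i).
  by apply: (big_morph (@Re R)) => // -[? ?] [? ?].
have Im_sum (I : finType) (F : I -> complex R) :
    Im (\sum_i F i) = \sum_i Im (F i).
  by apply: (big_morph (@Im R)) => // -[? ?] [? ?].
have xA : x *m A = a *: x - b *: y.
  apply/rowP => j; move/rowP: wA => /(_ j); rewrite !mxE => /(congr1 (@Re R)).
  rewrite Re_sum /a /b; case: (z) (w 0 j) => [z1 z2] [w1 w2] /= <-.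
  by apply: eq_bigr => i _; rewrite !mxE; case: (w 0 i) => [u1 u2] /=; rewrite mulr0 subr0.
have yA : y *m A = b *: x + a *: y.
  apply/rowP => j; move/rowP: wA => /(_ j); rewrite !mxE => /(congr1 (@Im R)).
  rewrite Im_sum /a /b; case: (z) (w 0 j) => [z1 z2] [w1 w2] /= h.
  rewrite addrC -h.
  by apply: eq_bigr => i _; rewrite !mxE; case: (w 0 i) => [u1 u2] /=; rewrite mulr0 add0r.
have xy0 : (x != 0) || (y != 0).
  rewrite -negb_and; apply: contra w0 => /andP[/eqP x0 /eqP y0].
  apply/eqP/rowP => i; move/rowP: x0 => /(_ i); move/rowP: y0 => /(_ i).
  by rewrite !mxE; case: (w 0 i) => ? ? /= -> ->.
have b0 : b = 0.
  have h : (x *m A *m y^T) 0 0 = (y *m A *m x^T) 0 0.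
    transitivity ((x *m A *m y^T)^T 0 0); first by rewrite [RHS]mxE.
    by rewrite !trmx_mul trmxK As mulmxA.
  have {h}: b * ((x *m x^T) 0 0 + (y *m y^T) 0 0) = 0.
    move: h; rewrite xA yA mulmxBl mulmxDl -!scalemxAl.
    have -> : y *m x^T = x *m y^T.
      by apply/matrixP => i j; rewrite !ord1 !dotmx_rowE; apply: eq_bigr => k _; rewrite mulrC.
    rewrite !mxE; lra.
  move/eqP; rewrite mulf_eq0 => /orP[/eqP//|].
  rewrite paddr_eq0 ?dot_ge0// !dot_eq0 => /andP[x0 y0].
  by move: xy0; rewrite x0 y0.
move: xA yA; rewrite b0 !scale0r subr0 add0r => xA yA.
by case/orP: xy0 => [x0|y0]; exists a; [exists x|exists y].
Qed.

(** The reflection that exchanges [v] and the first basis vector. *)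
Lemma orthogonal_first_row n (v : 'rV[R]_n.+1) : (v *m v^T) 0 0 = 1 ->
  exists2 H : 'M[R]_n.+1, H *m H^T = 1%:M & delta_mx 0 0 *m H = v.
Proof.
move=> v1; pose e : 'rV[R]_n.+1 := delta_mx 0 0.
have ve : v *m e^T = (v 0 0)%:M.
  apply/matrixP => i j; rewrite !ord1 dotmx_rowE (bigD1 0)//= big1 ?addr0.
    by rewrite !mxE !eqxx mulr1 mulr1n.
  by move=> k k0; rewrite !mxE (negbTE k0) andbF mulr0.
have ev : e *m v^T = (v 0 0)%:M by rewrite -[LHS]trmxK trmx_mul trmxK ve tr_scalar_mx.
have ee : e *m e^T = 1%:M.
  apply/matrixP => i j; rewrite !ord1 dotmx_rowE (bigD1 0)//= big1 ?addr0.
    by rewrite !mxE !eqxx mulr1.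
  by move=> k k0; rewrite !mxE (negbTE k0) andbF mulr0.
have vv : v *m v^T = 1%:M by apply/matrixP => i j; rewrite !ord1 v1 !mxE.
have [->|nev] := eqVneq v e; first by exists 1%:M; rewrite ?trmx1 ?mulmx1.
pose w := v - e; pose q := (w *m w^T) 0 0.
have q0 : 0 < q by rewrite dot_gt0// subr_eq0.
have ww : w *m w^T = q%:M by apply/matrixP => i j; rewrite !ord1 [RHS]mxE mulr1n.
have qE : q = 2 - 2 * v 0 0.
  rewrite /q /w linearB/= mulmxBl !mulmxBr vv ev ve ee !mxE !mulr1n; ring.
have ew : e *m w^T = (- (q / 2))%:M.
  rewrite /w linearB/= mulmxBr ev ee -raddfB/=; congr _%:M; rewrite qE; field => //.
pose H : 'M[R]_n.+1 := 1%:M - (2 / q) *: (w^T *m w).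
exists H; rewrite /H.
  have -> : (1%:M - (2 / q) *: (w^T *m w))^T = 1%:M - (2 / q) *: (w^T *m w).
    by rewrite [LHS]linearB/= [X in _ - X]linearZ/= trmx_mul trmxK trmx1.
  have XX : (w^T *m w) *m (w^T *m w) = q *: (w^T *m w).
    by rewrite mulmxA -[w^T *m w *m _]mulmxA ww mul_mx_scalar -scalemxAl.
  rewrite mulmxBr mulmx1 mulmxBl mul1mx -scalemxAl -scalemxAr XX !scalerA.
  rewrite -[RHS]subr0 -addrA -opprD; congr (_ - _).
  rewrite addrCA -scalerBl -scalerDl (_ : _ + _ = 0) ?scale0r//.
  by field; rewrite gt_eqF.
rewrite mulmxBr mulmx1 -scalemxAr mulmxA ew mul_scalar_mx scalerA.
have -> : 2 / q * - (q / 2) = -1 by field; rewrite gt_eqF.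
by rewrite scaleN1r opprK /w addrC subrK.
Qed.

(** The real spectral theorem: induction on the dimension, splitting off one
    eigenvector by a reflection that moves it to the first basis vector. *)
Lemma spectral_decomposition n (A : 'M[R]_n) : symmetric_mx A ->
  exists (U : 'M[R]_n) (d : 'rV[R]_n),
    U *m U^T = 1%:M /\ A = U^T *m diag_mx d *m U.
Proof.
elim: n => [|n IH] in A *; first by exists 1%:M, 0; rewrite !thinmx0.
move=> As; have [a [v v0 vA]] := symmetric_eigenvector As.
pose k := (Num.sqrt ((v *m v^T) 0 0))^-1.
have [|H HH He] := @orthogonal_first_row n (k *: v).
  rewrite linearZ/= -scalemxAr -scalemxAl scalerA mxE -expr2 /k exprVn sqr_sqrtr ?dot_ge0//.
  by rewrite mulVf// gt_eqF// dot_gt0.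
have [B BdE] : exists B : 'M[R]_(1 + n), B = H *m A *m H^T by exists (H *m A *m H^T).
have HtH : H^T *m H = 1%:M by apply: mulmx1C.
have Bs : B^T = B by rewrite BdE !trmx_mul trmxK As mulmxA.
have eB : (delta_mx 0 0 : 'rV_(1 + n)) *m B = a *: delta_mx 0 0.
  rewrite BdE !mulmxA He -scalemxAl vA scalerA mulrC -scalerA -He -!scalemxAl.
  by rewrite -mulmxA HH mulmx1.
have B0j j : B 0 j = a * (j == 0)%:R.
  by move/rowP: eB => /(_ j); rewrite -rowE !mxE eqxx andTb.
pose B' := drsubmx B.
have B's : symmetric_mx B' by rewrite /symmetric_mx /B' trmx_drsub Bs.
have BE : B = block_mx a%:M 0 0 B'.
  rewrite -[LHS]submxK; congr block_mx.
  - apply/matrixP => i j; rewrite !ord1 !mxE.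
    have -> : lshift n (0 : 'I_1) = 0 by apply/val_inj.
    by rewrite B0j mulr1.
  - apply/matrixP => i j; rewrite !ord1 !mxE.
    have -> : lshift n (0 : 'I_1) = 0 by apply/val_inj.
    by rewrite B0j mulr0.
  - apply/matrixP => i j; rewrite !ord1 !mxE -Bs mxE.
    have -> : lshift n (0 : 'I_1) = 0 by apply/val_inj.
    by rewrite B0j mulr0.
have [U' [d' [UU' B'E]]] := IH _ B's.
pose V : 'M[R]_(1 + n) := block_mx 1%:M 0 0 U'.
have VV : V *m V^T = 1%:M.
  rewrite /V tr_block_mx mulmx_block !trmx1 !trmx0 !mul0mx !mulmx0 !mulmx1 UU' !addr0 !add0r.
  by rewrite -scalar_mx_block.
have AE : A = H^T *m B *m H.
  by rewrite BdE !mulmxA HtH mul1mx -mulmxA HtH mulmx1.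
have BVE : B = V^T *m diag_mx (row_mx a%:M d') *m V.
  rewrite BE diag_mx_row /V tr_block_mx !mulmx_block !trmx1 !trmx0.
  rewrite !mul0mx !mulmx0 !mulmx1 ?mul1mx !addr0 !add0r B'E; congr block_mx; rewrite ?mul0mx//.
  by apply/matrixP => i j; rewrite !ord1 !mxE.
exists (V *m H), (row_mx a%:M d'); split.
  by rewrite trmx_mul mulmxA -(mulmxA V) HH mulmx1.
by rewrite trmx_mul AE BVE !mulmxA.
Qed.

End spectral.

(** * Nonnegative definite matrices and their norms *)

Section psd.
Context {R : realType} {n : nat}.
Implicit Types (A G N U : 'M[R]_n) (d v : 'rV[R]_n).

Lemma quad_diag (x : 'rV[R]_n) d : (x *m diag_mx d *m x^T) 0 0 = \sum_i d 0 i * x 0 i ^+ 2.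
Proof.
rewrite mxE; apply: eq_bigr => i _.
by rewrite mul_mx_diag !mxE mulrAC -expr2 mulrC.
Qed.

Lemma quad_entry A (i : 'I_n) :
  ((delta_mx 0 i : 'rV[R]_n) *m A *m (delta_mx 0 i : 'rV[R]_n)^T) 0 0 = A i i.
Proof. by rewrite -rowE trmx_delta -colE !mxE. Qed.

Lemma quad_rot U A (x : 'rV[R]_n) :
  (x *m (U *m A *m U^T) *m x^T) 0 0 = ((x *m U) *m A *m (x *m U)^T) 0 0.
Proof. by rewrite trmx_mul !mulmxA. Qed.

Lemma dot_rot U (x : 'rV[R]_n) : U *m U^T = 1%:M ->
  ((x *m U) *m (x *m U)^T) 0 0 = (x *m x^T) 0 0.
Proof. by move=> UU; rewrite trmx_mul mulmxA -(mulmxA x) UU mulmx1. Qed.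

Lemma dot_delta (i : 'I_n) :
  ((delta_mx 0 i : 'rV[R]_n) *m (delta_mx 0 i : 'rV[R]_n)^T) 0 0 = 1.
Proof. by rewrite -[X in X *m _]mulmx1 quad_entry mxE eqxx. Qed.

Lemma nonneg_definite_rot U A :
  nonneg_definite A -> nonneg_definite (U *m A *m U^T).
Proof. by move=> A0 x; rewrite quad_rot. Qed.

Lemma symmetric_rot U A : symmetric_mx A -> symmetric_mx (U *m A *m U^T).
Proof. by move=> As; rewrite /symmetric_mx !trmx_mul trmxK As mulmxA. Qed.

Lemma spectral_diagE U A d : U *m U^T = 1%:M -> A = U^T *m diag_mx d *m U ->
  U *m A *m U^T = diag_mx d.
Proof. by move=> UU ->; rewrite !mulmxA UU mul1mx -mulmxA UU mulmx1. Qed.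

Lemma eigenvalue_quad U A d i : U *m U^T = 1%:M -> A = U^T *m diag_mx d *m U ->
  d 0 i = (row i U *m A *m (row i U)^T) 0 0.
Proof.
move=> UU AE; have := spectral_diagE UU AE => /matrixP/(_ i i).
by rewrite -quad_entry quad_rot -rowE [X in _ = X -> _]mxE eqxx mulr1n.
Qed.

Lemma eigenvalues_ge0 U A d : U *m U^T = 1%:M -> A = U^T *m diag_mx d *m U ->
  nonneg_definite A -> forall i, 0 <= d 0 i.
Proof. by move=> UU AE A0 i; rewrite (eigenvalue_quad i UU AE). Qed.

Lemma tr_rot U A : U *m U^T = 1%:M -> \tr (U *m A *m U^T) = \tr A.
Proof. by move=> /mulmx1C UU; rewrite mxtrace_mulC mulmxA UU mul1mx. Qed.

Lemma mul_rot U A G : U *m U^T = 1%:M ->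
  U *m (A *m G) *m U^T = (U *m A *m U^T) *m (U *m G *m U^T).
Proof.
by move=> /mulmx1C UU; rewrite !mulmxA -(mulmxA (U *m A) U^T U) UU mulmx1.
Qed.

(** The eigenbasis of [A] turns the trace into a combination of values of the
    quadratic form of [G] with the eigenvalues of [A] as weights. *)
Lemma tr_mul_ge0 G A : nonneg_definite G -> symmetric_mx A ->
  nonneg_definite A -> 0 <= \tr (G *m A).
Proof.
move=> G0 As A0; have [U [d [UU AE]]] := spectral_decomposition As.
have d0 := eigenvalues_ge0 UU AE A0.
rewrite -(tr_rot _ UU) mul_rot// (spectral_diagE UU AE) mul_mx_diag /mxtrace.
apply: sumr_ge0 => i _; rewrite mxE mulr_ge0//.
by rewrite -quad_entry quad_rot.
Qed.

(** For a polynomial that splits, the distinct roots repeated with their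
    multiplicities are the roots of the factors in another order. *)
Lemma perm_roots_prod (I : finType) (a : I -> R) (p : {poly R}) :
  p = \prod_i ('X - (a i)%:P) ->
  perm_eq (flatten [seq nseq (mup x p) x | x <- rootsR p]) [seq a i | i : I].
Proof.
move=> pE0; have p0 : p != 0.
  by rewrite pE0 prodf_seq_neq0; apply/allP => i _; rewrite /= polyXsubC_eq0.
pose s := [seq a i | i : I].
have pE : p = \prod_(y <- s) ('X - y%:P) by rewrite pE0 big_map big_enum.
have rootp x : (x \in rootsR p) = (x \in s).
  have := roots_on_rootsR p0 x.
  by rewrite in_itv/= => <-; rewrite pE root_prod_XsubC.
have mupE x : mup x p = count_mem x s.
  rewrite pE; elim: s {pE rootp} => [|y s' IH]; first by rewrite big_nil mupNroot// root1.
  rewrite big_cons mupM ?polyXsubC_eq0//; last first.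
    by rewrite prodf_seq_neq0; apply/allP => i _; rewrite /= polyXsubC_eq0.
  by rewrite IH -[X in mup x X]expr1 mup_XsubCX /=; case: (y == x).
have -> : [seq nseq (mup x p) x | x <- rootsR p] =
          [seq nseq (count_mem x s) x | x <- rootsR p].
  by apply: eq_map => x; rewrite mupE.
apply: perm_trans (perm_count_undup s).
apply: perm_flatten; apply: perm_map; apply: uniq_perm.
- exact: uniq_roots.
- exact: undup_uniq.
- by move=> x; rewrite rootp mem_undup.
Qed.

(** Rotating to the eigenbasis does not change the characteristic polynomial
    of [A^T A], whose roots are therefore the squares of the eigenvalues. *)
Lemma singular_values_perm U A d : U *m U^T = 1%:M ->
  A = U^T *m diag_mx d *m U ->
  perm_eq (singular_values A) [seq `|d 0 i| | i : 'I_n].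
Proof.
move=> UU AE; have UtU := mulmx1C UU.
have As : A^T = A by rewrite AE !trmx_mul trmxK tr_diag_mx mulmxA.
have pE : char_poly (A^T *m A) = \prod_i ('X - (d 0 i ^+ 2)%:P).
  have E : U *m (A^T *m A) *m U^T = diag_mx (\row_i d 0 i ^+ 2).
    rewrite As mul_rot// (spectral_diagE UU AE); apply/matrixP => i j.
    rewrite mul_mx_diag !mxE; case: (i =P j) => [->|_]; last by rewrite mul0r.
    by rewrite !mulr1n expr2.
  transitivity (char_poly (diag_mx (\row_i d 0 i ^+ 2) : 'M[R]_n)); last first.
    rewrite char_poly_trig; last exact: diag_mx_is_trig.
    by apply: eq_bigr => i _; rewrite !mxE eqxx mulr1n.
  rewrite -E /char_poly.
  have -> : char_poly_mx (U *m (A^T *m A) *m U^T) =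
      map_mx polyC U *m char_poly_mx (A^T *m A) *m map_mx polyC U^T.
    rewrite /char_poly_mx mulmxBr mulmxBl -!map_mxM; congr (_ - _).
    rewrite mul_mx_scalar -scalemxAl -map_mxM UU map_mx1.
    by rewrite scalemx1.
  rewrite !det_mulmx mulrAC -det_mulmx -map_mxM UU map_mx1 det1 mul1r.
  by [].
rewrite /singular_values; set p := char_poly _ in pE *.
have -> : [seq nseq (mup x p) (Num.sqrt x) | x <- rootsR p] =
          [seq map Num.sqrt (nseq (mup x p) x) | x <- rootsR p].
  by apply: eq_map => x; rewrite map_nseq.
rewrite (map_comp (map Num.sqrt)) -map_flatten.
have := perm_map Num.sqrt (perm_roots_prod pE).
move=> /perm_trans; apply; rewrite -map_comp; apply/permP => P.
by congr count; apply: eq_map => i /=; rewrite sqrtr_sqr.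
Qed.

(** The eigenvalues are their own absolute values. This makes the penalty a
    linear function on the cone over which the objective is minimised. *)
Lemma nuclear_norm_psd A : symmetric_mx A -> nonneg_definite A ->
  nuclear_norm A = \tr A.
Proof.
move=> As A0; have [U [d [UU AE]]] := spectral_decomposition As.
rewrite /nuclear_norm (perm_big _ (singular_values_perm UU AE)) big_map big_enum/=.
rewrite -(tr_rot A UU) (spectral_diagE UU AE); apply: eq_bigr => i _.
by rewrite !mxE eqxx mulr1n ger0_norm// (eigenvalues_ge0 UU AE A0).
Qed.

Lemma eigenvalue_le_spectral_norm U A d i : U *m U^T = 1%:M ->
  A = U^T *m diag_mx d *m U -> `|d 0 i| <= spectral_norm A.
Proof.
move=> UU AE; rewrite /spectral_norm.
have h : `|d 0 i| \in singular_values A; last first.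
  exact: (@le_bigmax_seq _ R _ _ 0 _ xpredT id h isT).
by rewrite (perm_mem (singular_values_perm UU AE)); apply/mapP; exists i; rewrite ?mem_enum.
Qed.

Lemma quad_le_spectral_norm A (x : 'rV[R]_n) : symmetric_mx A ->
  (x *m A *m x^T) 0 0 <= spectral_norm A * (x *m x^T) 0 0.
Proof.
move=> As; have [U [d [UU AE]]] := spectral_decomposition As.
have UtU := mulmx1C UU.
have -> : (x *m A *m x^T) 0 0 =
    ((x *m U^T) *m diag_mx d *m (x *m U^T)^T) 0 0.
  by rewrite -quad_rot trmxK -AE.
rewrite -(dot_rot x (U := U^T)) ?trmxK// quad_diag dotmx_rowE mulr_sumr.
apply: ler_sum => i _; rewrite -expr2 ler_wpM2r ?sqr_ge0//.
apply: le_trans (ler_norm _) _; exact: eigenvalue_le_spectral_norm UU AE.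
Qed.

End psd.

(** * The oracle inequality *)

Section oracle.
Context {R : realType} {n : nat}.
Implicit Types (A B K G N M U : 'M[R]_n) (d : 'rV[R]_n).

Definition hs_inner A B : R := \sum_i \sum_j A i j * B i j.
Definition hs_sq A : R := \sum_i \sum_j A i j ^+ 2.

Lemma hs_innerDl A B G : hs_inner (A + B) G = hs_inner A G + hs_inner B G.
Proof.
rewrite -big_split; apply: eq_bigr => i _; rewrite -big_split.
by apply: eq_bigr => j _; rewrite mxE mulrDl.
Qed.

Lemma hs_innerZl a A B : hs_inner (a *: A) B = a * hs_inner A B.
Proof.
rewrite mulr_sumr; apply: eq_bigr => i _; rewrite mulr_sumr.
by apply: eq_bigr => j _; rewrite mxE mulrA.
Qed.

Lemma hs_innerBl A B G : hs_inner (A - B) G = hs_inner A G - hs_inner B G.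
Proof. by rewrite -scaleN1r hs_innerDl hs_innerZl mulN1r. Qed.

Lemma hs_inner_scalar a A : hs_inner a%:M A = a * \tr A.
Proof.
rewrite mulr_sumr; apply: eq_bigr => i _; rewrite (bigD1 i)//= big1.
  by rewrite mxE eqxx addr0.
by move=> j ji; rewrite mxE eq_sym (negbTE ji) mul0r.
Qed.

Lemma hs_sqE A : hs_sq A = hs_inner A A.
Proof. by apply: eq_bigr => i _; apply: eq_bigr => j _; rewrite expr2. Qed.

Lemma hs_sq_ge0 A : 0 <= hs_sq A.
Proof. by apply: sumr_ge0 => i _; apply: sumr_ge0 => j _; rewrite sqr_ge0. Qed.

Lemma hs_inner_tr A B : symmetric_mx B -> hs_inner A B = \tr (A *m B).
Proof.
move=> Bs; apply: eq_bigr => i _; rewrite mxE; apply: eq_bigr => j _.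
by rewrite -{1}Bs mxE.
Qed.

Lemma hs_sqD a A B :
  hs_sq (A + a *: B) = hs_sq A + 2 * a * hs_inner A B + a ^+ 2 * hs_sq B.
Proof.
rewrite /hs_sq /hs_inner !mulr_sumr -!big_split; apply: eq_bigr => i _ /=.
rewrite !mulr_sumr -!big_split; apply: eq_bigr => j _ /=; rewrite !mxE; ring.
Qed.

Lemma symmetricB A B : symmetric_mx A -> symmetric_mx B -> symmetric_mx (A - B).
Proof. by rewrite /symmetric_mx linearB/= => -> ->. Qed.

Lemma symmetricD A B : symmetric_mx A -> symmetric_mx B -> symmetric_mx (A + B).
Proof. by rewrite /symmetric_mx linearD/= => -> ->. Qed.

Lemma symmetricZ a A : symmetric_mx A -> symmetric_mx (a *: A).
Proof. by rewrite /symmetric_mx linearZ/= => ->. Qed.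

Lemma quadD A B (x : 'rV[R]_n) :
  (x *m (A + B) *m x^T) 0 0 = (x *m A *m x^T) 0 0 + (x *m B *m x^T) 0 0.
Proof. by rewrite mulmxDr mulmxDl mxE. Qed.

Lemma quadZ a A (x : 'rV[R]_n) :
  (x *m (a *: A) *m x^T) 0 0 = a * (x *m A *m x^T) 0 0.
Proof. by rewrite -scalemxAr -scalemxAl mxE. Qed.

Lemma quad_scalar a (x : 'rV[R]_n) :
  (x *m a%:M *m x^T) 0 0 = a * (x *m x^T) 0 0.
Proof. by rewrite mul_mx_scalar -scalemxAl mxE. Qed.

(** The segment from the minimiser [A] to [K] stays in the cone, so the
    derivative of the objective along it is nonnegative at [A]. *)
Lemma first_order_optimality (mu : R) A K N :
  symmetric_mx A -> nonneg_definite A -> symmetric_mx K -> nonneg_definite K ->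
  (forall B, symmetric_mx B -> nonneg_definite B ->
     hs_sq (K + N - A) + mu * \tr A <= hs_sq (K + N - B) + mu * \tr B) ->
  hs_sq (A - K) <= hs_inner (N - (mu / 2)%:M) (A - K).
Proof.
move=> As A0 Ks K0 Amin; pose D := A - K.
pose c := 2 * hs_inner N D - 2 * hs_sq D - mu * \tr D.
have cF s : 0 < s -> s <= 1 -> 0 <= c + s * hs_sq D.
  move=> s0 s1; pose B := A + (- s) *: D.
  have BE : B = (1 - s) *: A + s *: K.
    by rewrite /B /D; apply/matrixP => i j; rewrite !mxE; ring.
  have Bs : symmetric_mx B.
    by rewrite BE; apply: symmetricD; apply: symmetricZ.
  have B0 : nonneg_definite B.
    by move=> x; rewrite BE quadD !quadZ addr_ge0// mulr_ge0// ?subr_ge0// ltW.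
  have := Amin B Bs B0.
  have -> : K + N - B = (K + N - A) + s *: D.
    by rewrite /B; apply/matrixP => i j; rewrite !mxE; ring.
  have -> : K + N - A = N - D.
    by rewrite /D; apply/matrixP => i j; rewrite !mxE; ring.
  rewrite hs_sqD hs_innerBl -hs_sqE /B mxtraceD mxtraceZ => h.
  suff : 0 <= s * (c + s * hs_sq D) by rewrite pmulr_rge0.
  rewrite /c; nra.
have c0 : 0 <= c.
  rewrite leNgt; apply/negP => cn.
  have F0 := hs_sq_ge0 D.
  pose s := - c / (- c + hs_sq D + 1) / 2.
  have dp : 0 < - c + hs_sq D + 1 by lra.
  have s1 : - c / (- c + hs_sq D + 1) <= 1 by rewrite ler_pdivrMr//; lra.
  have s0 : 0 < - c / (- c + hs_sq D + 1) by rewrite divr_gt0//; lra.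
  have /cF : 0 < s by rewrite /s; lra.
  have -> : s <= 1 by rewrite /s; lra.
  move=> /(_ isT); apply/negP; rewrite -ltNge.
  have : s * hs_sq D <= - c / 2.
    rewrite /s mulrAC ler_pM2r ?invr_gt0// mulrAC ler_pdivrMr// ler_wpM2l//; lra.
  lra.
rewrite hs_innerBl hs_inner_scalar -/D; move: c0; rewrite /c; lra.
Qed.

(** In an eigenbasis both the quadratic form and the norm of the image are read
    off the eigenvalues. *)
Lemma sqnorm_le_quad b G (x : 'rV[R]_n) : symmetric_mx G ->
  (forall y : 'rV[R]_n, `|(y *m G *m y^T) 0 0| <= b * (y *m y^T) 0 0) ->
  ((x *m G) *m (x *m G)^T) 0 0 <= b ^+ 2 * (x *m x^T) 0 0.
Proof.
move=> Gs Gb; have [U [d [UU GE]]] := spectral_decomposition Gs.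
have UtU := mulmx1C UU.
have db i : `|d 0 i| <= b.
  have := Gb (row i U); rewrite -(eigenvalue_quad i UU GE).
  by rewrite rowE dot_rot// dot_delta mulr1.
rewrite GE !mulmxA dot_rot// -(dot_rot x (U := U^T)) ?trmxK//.
move: (x *m U^T) => y; rewrite !dotmx_rowE mulr_sumr; apply: ler_sum => i _.
rewrite mul_mx_diag !mxE -!expr2 exprMn mulrC ler_wpM2r ?sqr_ge0//.
by rewrite -real_normK ?num_real// ler_sqr ?nnegrE// (le_trans _ (db i)).
Qed.

(** The inequalities in the eigenbasis of [K], where they can be checked entry
    by entry. The first two hold for every noise and serve where the noise is
    large. For the other two let [G = mu / 2 - N], which is nonnegative definite
    when the noise form is at most [mu / 2]. The rate [rho mu^2] is obtained as
    follows. On the block with both indices in the kernel of [K] the difference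
    is a compression of [A], so it pairs with [G] to a nonnegative number; the
    other entries lie in [rho] rows and [rho] columns, where [G] has rows of
    squared norm at most [mu^2]. The rate [rho mu lmax] uses that [tr (G A)] is
    nonnegative and that the diagonal entries of [G] are at most [mu]. *)
Lemma oracle_diag (mu lmax : R) A N d (rho := #|[pred i | d 0 i != 0]|%:R : R) :
  symmetric_mx A -> nonneg_definite A -> symmetric_mx N -> 0 <= mu ->
  (forall i, 0 <= d 0 i <= lmax) ->
  hs_sq (A - diag_mx d) <= hs_inner (N - (mu / 2)%:M) (A - diag_mx d) ->
  [/\ hs_sq (A - diag_mx d) <= 2 * hs_sq N + rho * mu ^+ 2 / 2,
      hs_sq (A - diag_mx d) <= hs_sq N + rho * mu * lmax
    & (forall x : 'rV[R]_n,
        `|(x *m N *m x^T) 0 0| <= mu / 2 * (x *m x^T) 0 0) ->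
      hs_sq (A - diag_mx d) <= 2 * rho * mu ^+ 2 /\
      hs_sq (A - diag_mx d) <= rho * mu * lmax].
Proof.
move=> As A0 Ns mu0 dI; set D := A - diag_mx d => main.
pose p i : R := (d 0 i != 0)%:R.
have rhoE : rho = \sum_i p i. 
  rewrite /rho -sum1_card natr_sum big_mkcond/=; apply: eq_bigr => i _.
  by rewrite /p inE; case: (d 0 i != 0).
have Aii i : 0 <= A i i by rewrite -quad_entry.
have Dii i : D i i = A i i - d 0 i by rewrite !mxE eqxx mulr1n.
have diag_le : \sum_i D i i ^+ 2 <= hs_sq D.
  by apply: ler_sum => i _; rewrite (bigD1 i)//= lerDl sumr_ge0// => j _; rewrite sqr_ge0.
have innerND a : 0 < a -> hs_inner N D <= a / 2 * hs_sq N + (2 * a)^-1 * hs_sq D.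
  move=> a0; rewrite !mulr_sumr -big_split; apply: ler_sum => i _ /=.
  rewrite !mulr_sumr -big_split; apply: ler_sum => j _ /=.
  rewrite -subr_ge0.
  have -> : a / 2 * N i j ^+ 2 + (2 * a)^-1 * D i j ^+ 2 - N i j * D i j =
     (a * N i j - D i j) ^+ 2 / (2 * a) by field; rewrite gt_eqF.
  by rewrite divr_ge0 ?sqr_ge0// mulr_ge0// ltW.
have trD : \tr D = \sum_i D i i by [].
have main' : hs_sq D <= hs_inner N D - mu / 2 * \sum_i D i i.
  by move: main; rewrite hs_innerBl hs_inner_scalar.
split.
- have h : - (mu / 2 * \sum_i D i i) <= rho * mu ^+ 2 / 4 + 4^-1 * \sum_i D i i ^+ 2.
    rewrite rhoE -mulrA !mulr_suml !mulr_sumr -big_split -sumrN; apply: ler_sum => i _ /=.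
    rewrite /p; case: eqP => [di0|_] /=; last by have := sqr_ge0 (mu + D i i); nra.
    have := Aii i; rewrite Dii di0 subr0 => Ai.
    by have := mulr_ge0 mu0 Ai; have := sqr_ge0 (A i i); lra.
  have := innerND 2 (ltr0n _ 2); have := hs_sq_ge0 N; lra.
- have h : - (mu / 2 * \sum_i D i i) <= rho * mu * lmax / 2.
    rewrite rhoE -!mulrA !mulr_suml !mulr_sumr -sumrN; apply: ler_sum => i _ /=.
    rewrite Dii /p; have := mulr_ge0 mu0 (Aii i); have /andP[] := dI i.
    case: eqP => [->|_] /=; first by lra.
    by move=> _ /(ler_wpM2l mu0); lra.
  have := innerND 1 ltr01; lra.
move=> Nb; pose G := (mu / 2)%:M - N.
have Gs : symmetric_mx G by apply: symmetricB => //; rewrite /symmetric_mx tr_scalar_mx.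
have GE (x : 'rV[R]_n) : (x *m G *m x^T) 0 0 = mu / 2 * (x *m x^T) 0 0 - (x *m N *m x^T) 0 0.
  have -> : G = (mu / 2)%:M + (-1) *: N by rewrite scaleN1r.
  by rewrite quadD quadZ quad_scalar mulN1r.
have G0 : nonneg_definite G.
  by move=> x; rewrite GE subr_ge0 (le_trans (ler_norm _)).
have Gmu (x : 'rV[R]_n) : `|(x *m G *m x^T) 0 0| <= mu * (x *m x^T) 0 0.
  rewrite ger0_norm// GE; have := Nb x; rewrite ler_norml => /andP[]; lra.
have Grow i : \sum_j G i j ^+ 2 <= mu ^+ 2.
  have := sqnorm_le_quad (delta_mx 0 i) Gs Gmu; rewrite dot_delta mulr1.
  rewrite -rowE dotmx_rowE; apply: le_trans; apply: ler_sum => j _.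
  by rewrite !mxE expr2.
have mainG : hs_sq D <= - hs_inner G D.
  by move: main; rewrite /G -opprB -scaleN1r hs_innerZl mulN1r.
split; last first.
  apply: le_trans mainG _; rewrite hs_inner_tr; last first.
    by apply: symmetricB => //; rewrite /symmetric_mx tr_diag_mx.
  rewrite mulmxBr linearB/= opprB lerBlDr ler_wpDr ?tr_mul_ge0//.
  rewrite mul_mx_diag /mxtrace rhoE -mulrA mulr_suml; apply: ler_sum => i _.
  rewrite mxE /p; have /andP[d0 dl] := dI i.
  have := Gmu (delta_mx 0 i); rewrite quad_entry dot_delta mulr1 => /(le_trans (ler_norm _)) Gii.
  case: eqP => [->|_]; first by rewrite mulr0 mul0r.
  by rewrite mul1r; apply: ler_pM => //; rewrite -quad_entry.
(* [E] is the projection onto the kernel of the diagonal matrix. *)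
pose E := diag_mx (\row_i (1 - p i)) : 'M[R]_n.
have EE : E^T = E by rewrite tr_diag_mx.
have EAEs : symmetric_mx (E *m A *m E) by rewrite -{2}EE; apply: symmetric_rot.
have EAE0 : nonneg_definite (E *m A *m E) by rewrite -{2}EE; apply: nonneg_definite_rot.
have h0 : 0 <= hs_inner G (E *m A *m E) by rewrite hs_inner_tr// tr_mul_ge0.
have EAE i j : (E *m A *m E) i j = (1 - p i) * (1 - p j) * A i j.
  by rewrite mul_mx_diag mul_diag_mx !mxE mulrAC.
have colG : \sum_i \sum_j p i * G i j ^+ 2 <= rho * mu ^+ 2.
  rewrite rhoE mulr_suml; apply: ler_sum => i _; rewrite -mulr_sumr ler_wpM2l ?Grow//.
have rowG : \sum_i \sum_j p j * G i j ^+ 2 <= rho * mu ^+ 2.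
  apply: le_trans colG; rewrite exchange_big/=; apply: ler_sum => i _.
  by apply: ler_sum => j _; rewrite -[in leLHS]Gs mxE.
have h : - hs_inner G D <= - hs_inner G (E *m A *m E) +
   (2^-1 * (\sum_i \sum_j p i * G i j ^+ 2) + 2^-1 * (\sum_i \sum_j p j * G i j ^+ 2)
    + 2^-1 * hs_sq D).
  rewrite -!sumrN !mulr_sumr -!big_split; apply: ler_sum => i _ /=.
  rewrite -!sumrN !mulr_sumr -!big_split; apply: ler_sum => j _ /=.
  rewrite EAE; have sGD := sqr_ge0 (G i j + D i j); have sG := sqr_ge0 (G i j).
  have [di|di] := eqVneq (d 0 i) 0; have [dj|dj] := eqVneq (d 0 j) 0.
  - have -> : D i j = A i j by rewrite !mxE di mul0rn subr0.
    rewrite /p di dj eqxx /= !mulr0n; have := sqr_ge0 (A i j); nra.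
  - by rewrite /p di eqxx dj /= mulr0n mulr1n; nra.
  - by rewrite /p di dj eqxx /= mulr0n mulr1n; nra.
  - by rewrite /p di dj /= mulr1n; nra.
lra.
Qed.

Lemma hs_sq_rot U A : U *m U^T = 1%:M -> hs_sq (U *m A *m U^T) = hs_sq A.
Proof.
have sqE B : hs_sq B = \tr (B *m B^T).
  by apply: eq_bigr => i _; rewrite mxE; apply: eq_bigr => j _; rewrite mxE expr2.
by move=> UU; rewrite !sqE !trmx_mul trmxK mulmxA -mul_rot// ?tr_rot// mulmxA.
Qed.

End oracle.

Section oracle_inequality.
Context {R : realType}.

Lemma mxrank_diag n (d : 'rV[R]_n) : \rank (diag_mx d) = #|[pred i | d 0 i != 0]|.
Proof.
rewrite -sum1_card big_mkcond/=; elim: n d => [|n IH] d.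
  by rewrite big_ord0; apply/eqP; rewrite -leqn0 rank_leq_row.
pose a := lsubmx (d : 'rV_(1 + n)); pose b := rsubmx (d : 'rV_(1 + n)).
have dE : d = row_mx a b by rewrite hsubmxK.
have -> : \rank (diag_mx d) = \rank (diag_mx (row_mx a b : 'rV_(1 + n))) by rewrite dE.
rewrite diag_mx_row rank_diag_block_mx IH big_ord_recl; congr (_ + _)%N.
  have -> : diag_mx a = (a 0 0)%:M.
    by apply/matrixP => i j; rewrite !ord1 !mxE eqxx.
  have -> : a 0 0 = d 0 ord0.
    by rewrite [in RHS]dE -(row_mxEl a b); congr (row_mx a b _ _); apply/val_inj.
  rewrite inE; have [->|d0] := eqVneq (d 0 ord0) 0; first by rewrite raddf0 mxrank0.
  by rewrite -scalemx1 mxrank_scale_nz// mxrank1.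
apply: eq_bigr => i _; rewrite !inE [in RHS]dE.
suff -> : row_mx a b 0 (lift ord0 i) = b 0 i by [].
by rewrite -(row_mxEr a b); congr (row_mx a b _ _); apply/val_inj.
Qed.

Lemma mxrank_eigenvalues n (U K : 'M[R]_n) d : U *m U^T = 1%:M ->
  K = U^T *m diag_mx d *m U -> (#|[pred i | (d 0 i != 0)%R]| <= \rank K)%N.
Proof.
move=> UU KE; rewrite -mxrank_diag -(spectral_diagE UU KE).
by apply: leq_trans (mxrankM_maxl _ _) _; apply: mxrankM_maxr.
Qed.

Lemma oracle_inequality n (A K N : 'M[R]_n) (mu lmax : R) (rho := (\rank K)%:R : R) :
  symmetric_mx A -> nonneg_definite A -> symmetric_mx K -> nonneg_definite K ->
  symmetric_mx N -> 0 <= mu -> spectral_norm K <= lmax ->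
  (forall B, symmetric_mx B -> nonneg_definite B ->
     hs_sq (K + N - A) + mu * \tr A <= hs_sq (K + N - B) + mu * \tr B) ->
  [/\ hs_sq (A - K) <= 2 * hs_sq N + rho * mu ^+ 2 / 2,
      hs_sq (A - K) <= hs_sq N + rho * mu * lmax
    & (forall x : 'rV[R]_n,
        `|(x *m N *m x^T) 0 0| <= mu / 2 * (x *m x^T) 0 0) ->
      hs_sq (A - K) <= 2 * rho * mu ^+ 2 /\
      hs_sq (A - K) <= rho * mu * lmax].
Proof.
move=> As A0 Ks K0 Ns mu0 Kl Amin.
have main := first_order_optimality As A0 Ks K0 Amin.
have [U [d [UU KE]]] := spectral_decomposition Ks.
have UKU := spectral_diagE UU KE; have UtU := mulmx1C UU.
have hsU B : hs_sq (U *m B *m U^T) = hs_sq B := hs_sq_rot B UU.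
have UDU : U *m (A - K) *m U^T = U *m A *m U^T - diag_mx d.
  by rewrite mulmxBr mulmxBl UKU.
have dI i : 0 <= d 0 i <= lmax.
  rewrite (eigenvalues_ge0 UU KE K0)/= (le_trans (ler_norm _))// (le_trans _ Kl)//.
  exact: eigenvalue_le_spectral_norm UU KE.
have l0 : 0 <= lmax by apply: le_trans Kl; apply: bigmax_ge_id.
have rr : #|[pred i | d 0 i != 0]|%:R <= rho by rewrite ler_nat (mxrank_eigenvalues UU KE).
have rl : #|[pred i | d 0 i != 0]|%:R * mu * lmax <= rho * mu * lmax.
  by rewrite !ler_wpM2r.
have Dd : U *m (A - K) *m U^T = U *m A *m U^T - diag_mx d.
  by rewrite mulmxBr mulmxBl UKU.
have [||||||h1 h2 h3] := @oracle_diag _ _ mu lmax (U *m A *m U^T) (U *m N *m U^T) d.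
- exact: symmetric_rot.
- exact: nonneg_definite_rot.
- exact: symmetric_rot.
- by [].
- exact: dI.
- rewrite -Dd hsU; apply: le_trans main _.
  rewrite Dd hs_inner_tr; last by apply: symmetricB.
  rewrite hs_inner_tr; last first.
    by rewrite -Dd; apply: symmetric_rot; apply: symmetricB.
  have -> : U *m N *m U^T - (mu / 2)%:M = U *m (N - (mu / 2)%:M) *m U^T.
    by rewrite mulmxBr mulmxBl mul_mx_scalar -scalemxAl UU scalemx1.
  by rewrite -Dd -mul_rot// tr_rot.
move: h1 h2 h3; rewrite -Dd !hsU => h1 h2 h3; split.
- apply: le_trans h1 _; rewrite lerD2l ler_pM2r ?invr_gt0// ler_wpM2r ?sqr_ge0//.
- by apply: le_trans h2 _; rewrite lerD2l.
move=> Nb; have [x|h4 h5] := h3.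
  by rewrite quad_rot (le_trans (Nb _))// dot_rot.
split; last exact: le_trans h5 rl.
by apply: le_trans h4 _; rewrite ler_wpM2r ?sqr_ge0// ler_wpM2l.
Qed.

End oracle_inequality.

(** * A lattice net of the unit sphere *)

Section net.
Context {R : realType} (l : nat) (l_gt0 : (0 < l)%N).

(** Lattice points, whose integer coordinates between [-5 l] and [5 l] are
    stored shifted by [5 l]. The mesh is such that rounding the coordinates of a
    vector moves it by at most 1/4. *)
Definition net_index := {ffun 'I_l -> 'I_(10 * l).+1}.
Definition net_coord (m : net_index) (i : 'I_l) : R := (m i)%:R - (5 * l)%:R.
Definition net_mesh : R := (4 * Num.sqrt l%:R)^-1.
Definition net_point (m : net_index) : 'rV[R]_l :=
  \row_i (net_coord m i * net_mesh).
Definition net : pred net_index :=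
  [pred m | \sum_i net_coord m i ^+ 2 <= 25 * l%:R].

Let sl_gt0 : 0 < Num.sqrt l%:R :> R.
Proof. by rewrite sqrtr_gt0 ltr0n. Qed.

Let mesh_gt0 : 0 < net_mesh.
Proof. by rewrite invr_gt0 mulr_gt0. Qed.

Let mesh_sq : 16 * l%:R * net_mesh ^+ 2 = 1 :> R.
Proof.
rewrite exprVn exprMn sqr_sqrtr ?ler0n// -natrX mulfV//.
by rewrite mulf_neq0// pnatr_eq0// -lt0n.
Qed.

Lemma net_point_sq m : (net_point m *m (net_point m)^T) 0 0 =
  net_mesh ^+ 2 * \sum_i net_coord m i ^+ 2.
Proof.
by rewrite dotmx_rowE mulr_sumr; apply: eq_bigr => i _; rewrite !mxE; ring.
Qed.

Lemma net_point_bounded m : net m ->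
  (net_point m *m (net_point m)^T) 0 0 <= 25 / 16.
Proof.
move=> /(ler_wpM2l (sqr_ge0 net_mesh)); rewrite net_point_sq => h.
by apply: (le_trans h); have := mesh_sq; nra.
Qed.

(** Rounding down produces a vector of norm at most 5/4, which is the bound
    that defines the net. *)
Lemma net_cover (v : 'rV[R]_l) : (v *m v^T) 0 0 = 1 -> exists m, net m /\
  ((net_point m - v) *m (net_point m - v)^T) 0 0 <= 1 / 16.
Proof.
move=> v1.
have vi i : `|v 0 i| <= 1.
  rewrite -[leRHS]sqrtr1 -sqrtr_sqr ler_wsqrtr// -v1 dotmx_rowE (bigD1 i)//= -expr2.
  by rewrite lerDl sumr_ge0// => j _; rewrite -expr2 sqr_ge0.
have sl : Num.sqrt l%:R <= l%:R :> R.
  by rewrite -ler_sqr ?nnegrE ?ler0n ?sqrtr_ge0// sqr_sqrtr// -natrX ler_nat leq_pmulr.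
pose x i := v 0 i * (4 * Num.sqrt l%:R) + (5 * l)%:R.
have lx i : `|v 0 i * (4 * Num.sqrt l%:R)| <= 4 * l%:R.
  rewrite normrM -[leRHS]mul1r ler_pM// ger0_norm; last by rewrite mulr_ge0// ltW.
  by rewrite ler_wpM2l.
have x0 i : 0 <= x i.
  have := lx i; rewrite /x natrM ler_norml => /andP[h _].
  by have : 0 <= l%:R :> R := ler0n _ _; lra.
have xl i : x i <= 9 * l%:R.
  by have := lx i; rewrite /x natrM ler_norml => /andP[_ h]; lra.
have ki i : (Num.trunc (x i) < (10 * l).+1)%N.
  rewrite ltnS -(ler_nat R) (le_trans (_ : _ <= x i))//.
    by have /andP[] := truncn_itv (x0 i).
  by apply: le_trans (xl i) _; rewrite -natrM ler_nat leq_mul2r orbT.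
pose m : net_index := [ffun i => Ordinal (ki i)].
pose w := net_point m - v.
have wi i : w 0 i ^+ 2 <= net_mesh ^+ 2.
  have vE : v 0 i = (v 0 i * (4 * Num.sqrt l%:R)) * net_mesh.
    by rewrite -mulrA mulfV ?mulr1// mulf_neq0// gt_eqF.
  have /andP[h1 h2] := truncn_itv (x0 i).
  rewrite -subr_ge0 subr_sqr !mxE /net_coord ffunE /=.
  rewrite {1 2}vE -mulrBl -[X in X - _]mul1r -mulrBl -[X in X + _ * _]mul1r -mulrDl.
  apply: mulr_ge0; apply: mulr_ge0; rewrite ?(ltW mesh_gt0)//.
    by move: h1; rewrite /x; lra.
  by move: h2; rewrite /x -natr1; lra.
have w1 : (w *m w^T) 0 0 <= 1 / 16.
  rewrite dotmx_rowE; apply: (@le_trans _ _ (\sum_(i < l) net_mesh ^+ 2)).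
    by apply: ler_sum => i _; rewrite -expr2.
  by rewrite sumr_const card_ord -mulr_natl; have := mesh_sq; nra.
exists m; split => //=.
have : (net_point m *m (net_point m)^T) 0 0 <= 25 / 16.
  have -> : net_point m = w + v by rewrite subrK.
  apply: (@le_trans _ _ (5 * (w *m w^T) 0 0 + 5 / 4 * (v *m v^T) 0 0)); last first.
    by rewrite v1; lra.
  rewrite !dotmx_rowE !mulr_sumr -big_split; apply: ler_sum => i _ /=.
  by rewrite mxE; have := sqr_ge0 (2 * w 0 i - v 0 i / 2); nra.
rewrite net_point_sq -(ler_pM2l (_ : 0 < 16 * l%:R)) ?mulr_gt0 ?ltr0n//.
rewrite mulrA mesh_sq mul1r => h; rewrite /net /=; apply: (le_trans h); lra.
Qed.

Lemma gaussian_tail_le_geometric (k : nat) :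
  expR (- (k.+1%:R) ^+ 2) <= (2 ^+ k.+1)^-1 :> R.
Proof.
have e2 : 2 <= expR 1 :> R by apply: le_trans (expR_ge1Dx 1); lra.
rewrite expRN lef_pV2 ?posrE ?exprn_gt0 ?expR_gt0//.
apply: (@le_trans _ _ (expR k.+1%:R)).
  by rewrite -[k.+1%:R]mulr1 expRM_natl lerXn2r ?nnegrE ?expR_ge0.
by rewrite ler_expR expr2 ler_peMl ?ler0n// ler1n.
Qed.

(** The subtracted term is the geometric tail still to come; it makes the
    induction on the half-length [M] go through. *)
Lemma lattice_gaussian_sum M :
  \sum_(k < (2 * M).+1) expR (- (k%:R - M%:R) ^+ 2) <= 3 - 2 / 2 ^+ M :> R.
Proof.
elim: M => [|M IH].
  by rewrite muln0 big_ord1 subrr expr0n oppr0 expR0; lra.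
rewrite mulnS addSn addSn add0n big_ord_recl big_ord_recr /=.
have -> : 0 - M.+1%:R = - M.+1%:R :> R by rewrite sub0r.
have -> : (bump 0 (2 * M).+1)%:R - M.+1%:R = M.+1%:R :> R.
  by rewrite /bump /= -natrB; [congr _%:R; lia|lia].
rewrite sqrrN; have b := gaussian_tail_le_geometric M.
have -> : \sum_(i < (2 * M).+1) expR (- ((bump 0 i)%:R - M.+1%:R) ^+ 2) =
    \sum_(k < (2 * M).+1) expR (- (k%:R - M%:R) ^+ 2) :> R.
  apply: eq_bigr => i _; rewrite /bump /= add1n -!natr1; congr (expR (- _ ^+ 2)); ring.
have h : 2 / 2 ^+ M = 2 * (2 / 2 ^+ M.+1) :> R.
  by rewrite exprS; field; rewrite expf_neq0.
by rewrite h in IH; lra.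
Qed.

(** A net point contributes at least 1 to the sum of [exp (25 l - |m|^2)] over
    all lattice points, and that sum is a product of one-dimensional ones. *)
Lemma card_net : #|net|%:R <= (3 * expR 25) ^+ l :> R.
Proof.
have -> : #|net|%:R = \sum_(m : net_index | net m) 1 :> R by rewrite sumr_const.
apply: (@le_trans _ _ (\sum_(m : net_index) expR (25 * l%:R - \sum_i net_coord m i ^+ 2))).
  rewrite [leLHS]big_mkcond; apply: ler_sum => m _; case: ifP => [h|_]; last exact: expR_ge0.
  by apply: le_trans (expR_ge1Dx _); rewrite lerDl subr_ge0.
under eq_bigr do rewrite expRD -sumrN expR_sum.
rewrite -mulr_sumr exprMn mulrC; apply: ler_pM.
- by apply: sumr_ge0 => m _; apply: prodr_ge0 => i _; exact: expR_ge0.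
- exact: expR_ge0.
- have -> : \sum_(m : net_index) \prod_i expR (- net_coord m i ^+ 2) =
     \prod_(i < l) \sum_(k < (10 * l).+1) expR (- (k%:R - (5 * l)%:R) ^+ 2).
    by rewrite bigA_distr_bigA.
  rewrite prodr_const card_ord lerXn2r ?nnegrE//.
    by apply: sumr_ge0 => i _; exact: expR_ge0.
  have -> : (10 * l = 2 * (5 * l))%N by rewrite mulnA.
  apply: le_trans (lattice_gaussian_sum _) _.
  by rewrite gerBl divr_ge0// exprn_ge0.
- by rewrite expRM_natr.
Qed.

End net.

(** * Control of the noise by the net *)

Section net_control.
Context {R : realType} (l : nat) (l_gt0 : (0 < l)%N).
Implicit Types (N : 'M[R]_l).

Lemma extreme_eigenvector N : symmetric_mx N ->
  exists (v : 'rV[R]_l) (z : R), [/\ (v *m v^T) 0 0 = 1, v *m N = z *: v,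
    forall x : 'rV[R]_l, `|(x *m N *m x^T) 0 0| <= `|z| * (x *m x^T) 0 0
    & hs_sq N <= l%:R * z ^+ 2].
Proof.
move=> Ns; have [U [d [UU NE]]] := spectral_decomposition Ns.
have UtU := mulmx1C UU.
pose i0 := Ordinal l_gt0.
pose i := [arg max_(i > i0) `|d 0 i|]%O.
have im j : `|d 0 j| <= `|d 0 i|.
  by rewrite /i; case: arg_maxP => //= k _; apply.
exists (row i U), (d 0 i); split.
- by rewrite rowE dot_rot// dot_delta.
- rewrite rowE NE -!mulmxA (mulmxA U) UU mul1mx mulmxA -rowE row_diag_mx.
  by rewrite -scalemxAl.
- move=> x; have -> : (x *m N *m x^T) 0 0 =
      ((x *m U^T) *m diag_mx d *m (x *m U^T)^T) 0 0.
    by rewrite -quad_rot trmxK -NE.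
  rewrite -(dot_rot x (U := U^T)) ?trmxK// quad_diag dotmx_rowE mulr_sumr.
  apply: le_trans (ler_norm_sum _ _ _) _; apply: ler_sum => j _.
  by rewrite -expr2 normrM (ger0_norm (sqr_ge0 _)) ler_wpM2r ?sqr_ge0.
rewrite -(hs_sq_rot N UU) (spectral_diagE UU NE) mulr_natl -[X in _ *+ X]card_ord -sumr_const.
apply: ler_sum => j _; rewrite (bigD1 j)//= big1 ?addr0.
  by rewrite mxE eqxx mulr1n -real_normK ?num_real// -[leRHS]real_normK ?num_real// ler_sqr ?nnegrE.
by move=> k kj; rewrite mxE eq_sym (negbTE kj) mulr0n expr0n.
Qed.

(** A net point [u] within distance 1/4 of an extreme unit eigenvector [v], of
    eigenvalue [z], satisfies
    [|u N u| >= |z| (1 - 2/4 - 1/16)], which is more than [|z| / 3]. *)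
Lemma net_control N : symmetric_mx N -> exists m : net_index l,
  let q := (net_point m *m N *m (net_point m)^T) 0 0 : R in
  [/\ @net R l m, (forall x : 'rV[R]_l, `|(x *m N *m x^T) 0 0| <= 3 * `|q| * (x *m x^T) 0 0)
    & hs_sq N <= 9 * l%:R * q ^+ 2].
Proof.
move=> Ns; have [v [z [v1 vN Nz Nhs]]] := extreme_eigenvector Ns.
have [m [mN mv]] := net_cover l_gt0 v1.
move Ew : (net_point m - v) mv => w mv; exists m => q.
have z3 : `|z| <= 3 * `|q|.
  have NvE : N *m v^T = z *: v^T.
    by rewrite -[N]Ns -trmx_mul vN linearZ.
  have qE : q = z + 2 * z * (w *m v^T) 0 0 + (w *m N *m w^T) 0 0.
    rewrite /q; have -> : net_point m = w + v by rewrite -Ew subrK.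
    rewrite linearD/= mulmxDr !mulmxDl -[w *m N *m v^T]mulmxA NvE vN -scalemxAr -!scalemxAl !mxE.
    have -> : \sum_j v 0 j * v^T j 0 = 1 by rewrite -v1 mxE.
    have -> : \sum_j v 0 j * w^T j 0 = \sum_j w 0 j * v^T j 0.
      by apply: eq_bigr => j _; rewrite !mxE mulrC.
    ring.
  have ws : `|(w *m N *m w^T) 0 0| <= `|z| * (1 / 16).
    by apply: le_trans (Nz w) _; rewrite ler_wpM2l.
  have wv : `|2 * (w *m v^T) 0 0| <= 1 / 2.
    have h (s : R) : s ^+ 2 = 1 -> s * (2 * (w *m v^T) 0 0) <= 1 / 2.
      move=> s1; apply: (@le_trans _ _ (4 * (w *m w^T) 0 0 + 1 / 4 * (v *m v^T) 0 0)); last first.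
        by rewrite v1; move: mv; lra.
      rewrite !dotmx_rowE !mulr_sumr -big_split; apply: ler_sum => i _ /=.
      have := sqr_ge0 (2 * w 0 i - s * v 0 i / 2).
      rewrite sqrrB !exprMn s1 !mul1r; lra.
    have h1 := h 1 (expr1n _ _); have h2 : -1 * (2 * (w *m v^T) 0 0) <= 1 / 2.
      by apply: h; rewrite sqrrN expr1n.
    by rewrite ler_norml; apply/andP; lra.
  have zw : `|2 * z * (w *m v^T) 0 0| <= `|z| * (1 / 2).
    by rewrite mulrAC mulrC normrM ler_wpM2l.
  have : `|z| <= `|q| + `|2 * z * (w *m v^T) 0 0| + `|(w *m N *m w^T) 0 0|.
    have zE : z = q - 2 * z * (w *m v^T) 0 0 - (w *m N *m w^T) 0 0 by rewrite qE; ring.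
    rewrite [X in `|X| <= _]zE.
    by apply: le_trans (ler_normB _ _) _; rewrite lerD2r; exact: ler_normB.
  by have := normr_ge0 z; lra.
split => //.
  by move=> x; apply: le_trans (Nz x) _; rewrite ler_wpM2r ?dot_ge0.
apply: le_trans Nhs _; rewrite [9 * _]mulrC -mulrA ler_wpM2l//.
have : `|z| ^+ 2 <= (3 * `|q|) ^+ 2 by rewrite ler_sqr ?nnegrE ?mulr_ge0.
by rewrite exprMn !real_normK ?num_real//; lra.
Qed.

(** The deterministic part of the argument: outside the event that some
    net direction sees noise above the level [mu / 6] the oracle inequality
    applies, and on it the noise is paid for by the sum over the net. *)
Lemma oracle_net (A K N : 'M[R]_l) (mu lmax : R) (rho := (\rank K)%:R : R)
    (q := fun m => (net_point m *m N *m (net_point m)^T) 0 0) :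
  symmetric_mx A -> nonneg_definite A -> symmetric_mx K -> nonneg_definite K ->
  symmetric_mx N -> 0 <= mu -> spectral_norm K <= lmax ->
  (forall B, symmetric_mx B -> nonneg_definite B ->
     hs_sq (K + N - A) + mu * \tr A <= hs_sq (K + N - B) + mu * \tr B) ->
  hs_sq (A - K) <= 2 * rho * mu * Num.min mu lmax +
    18 * l%:R * \sum_(m : net_index l | @net R l m) q m ^+ 2 * (mu / 6 < `|q m|)%R%:R.
Proof.
move=> As A0 Ks K0 Ns mu0 Kl Amin.
have [h1 h2 h3] := oracle_inequality As A0 Ks K0 Ns mu0 Kl Amin.
have l0 : 0 <= lmax by apply: le_trans Kl; apply: bigmax_ge_id.
have r0 : 0 <= (\rank K)%:R :> R by rewrite ler0n.
have [m [mn mq mhs]] := net_control Ns; rewrite -/(q m) in mq mhs.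
set V := \sum_(m | _) _.
have V0 : 0 <= V by apply: sumr_ge0 => k _; rewrite mulr_ge0 ?sqr_ge0.
have lV : 0 <= 18 * l%:R * V by rewrite !mulr_ge0.
have rmm := mulr_ge0 (mulr_ge0 r0 mu0) mu0.
have rml := mulr_ge0 (mulr_ge0 r0 mu0) l0.
have [big_q|small_q] := ltP (mu / 6) `|q m|; last first.
  have [x|h4 h5] := h3.
    apply: le_trans (mq x) _; rewrite ler_wpM2r ?dot_ge0//; move: small_q; lra.
  apply: ler_wpDr => //; rewrite /Num.min; case: ifP => _.
    by move: h4; rewrite expr2 !mulrA.
  by apply: le_trans h5 _; rewrite /rho -!mulrA ler_peMl ?mulrA// ler1n.
have Vq : q m ^+ 2 <= V.
  by rewrite /V (bigD1 m)//= big_q mulr1 lerDl sumr_ge0// => k _; rewrite mulr_ge0 ?sqr_ge0.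
have hN : 2 * hs_sq N <= 18 * l%:R * V.
  apply: (@le_trans _ _ (2 * (9 * l%:R * q m ^+ 2))); first by rewrite ler_wpM2l.
  rewrite (_ : 2 * _ = 18 * l%:R * q m ^+ 2); last by ring.
  by rewrite ler_wpM2l// mulr_ge0.
have N0 := hs_sq_ge0 N.
rewrite /Num.min; case: ifP => _; rewrite /rho.
  by apply: le_trans h1 _; rewrite -/rho; move: rmm; rewrite expr2 -/rho; lra.
by apply: le_trans h2 _; move: rml; rewrite -/rho; lra.
Qed.

End net_control.

(** * Square integrable functions *)

Section square_integrable.
Context d (T : measurableType d) (R : realType) (mu : {measure set T -> \bar R})
  (D : set T) (mD : measurable D).
Implicit Types f g h : T -> R.

(** The same notion is used on the interval, where it unfolds to [in_L2], on the
    square and on the probability space. *)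
Definition square_integrable f : Prop :=
  measurable_fun D f /\ (L2sq mu D f < +oo)%E.

Definition dotL2 f g : R := \int[mu]_(x in D) (f x * g x).

Lemma integrable_sq f : square_integrable f ->
  mu.-integrable D (EFin \o (fun x => f x ^+ 2)).
Proof.
move=> [mf fo]; apply/integrableP; split.
  by apply/measurable_EFinP; apply: measurable_funX.
by under eq_integral do rewrite /= ger0_norm ?sqr_ge0//; exact: fo.
Qed.

Lemma integrable_mul f g : square_integrable f -> square_integrable g ->
  mu.-integrable D (EFin \o (fun x => f x * g x)).
Proof.
move=> sf sg; have := integrableD mD (integrable_sq sf) (integrable_sq sg).
apply: le_integrable => //.
  by apply/measurable_EFinP; apply: measurable_funM; [case: sf|case: sg].
move=> x _ /=; rewrite lee_fin.
rewrite [leRHS]ger0_norm ?addr_ge0 ?sqr_ge0// ler_norml.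
by have := sqr_ge0 (f x + g x); have := sqr_ge0 (f x - g x);
  have := sqr_ge0 (f x); have := sqr_ge0 (g x); nra.
Qed.

Lemma L2sqE f : square_integrable f -> L2sq mu D f = (dotL2 f f)%:E.
Proof.
move=> sf; rewrite /dotL2 /Rintegral fineK; last first.
  exact: integrable_fin_num (integrable_mul sf sf).
by apply: eq_integral => x _; rewrite expr2.
Qed.

Lemma dotL2C f g : dotL2 f g = dotL2 g f.
Proof. by apply: eq_Rintegral => x _; rewrite mulrC. Qed.

Lemma square_integrableP f : measurable_fun D f ->
  mu.-integrable D (EFin \o (fun x => f x ^+ 2)) -> square_integrable f.
Proof.
move=> mf /integrableP[_]; under eq_integral do rewrite /= ger0_norm ?sqr_ge0//.
by split.
Qed.

Lemma square_integrableZ a f : square_integrable f ->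
  square_integrable (fun x => a * f x).
Proof.
move=> sf; apply: square_integrableP; first by apply: measurable_funM => //; case: sf.
have := integrableZl mD (a ^+ 2) (integrable_sq sf).
by apply: eq_integrable => // x _ /=; rewrite exprMn.
Qed.

Lemma square_integrableD f g : square_integrable f -> square_integrable g ->
  square_integrable (fun x => f x + g x).
Proof.
move=> sf sg; apply: square_integrableP.
  by apply: measurable_funD; [case: sf|case: sg].
have := integrableD mD (integrable_sq sf) (integrable_sq sg).
move=> /(integrableD mD (integrableZl mD 2 (integrable_mul sf sg))).
apply: eq_integrable => // x _ /=; rewrite -!EFinM -!EFinD; congr EFin; ring.
Qed.

Lemma square_integrableB f g : square_integrable f -> square_integrable g ->
  square_integrable (fun x => f x - g x).
Proof.
move=> sf /(square_integrableZ (-1)) /(square_integrableD sf).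
by under eq_fun do rewrite mulN1r.
Qed.

Lemma square_integrable0 : square_integrable (fun=> 0).
Proof.
split; first exact: measurable_cst.
by rewrite /L2sq; under eq_integral do rewrite expr0n; rewrite integral0.
Qed.

Lemma square_integrable_sum (I : Type) (s : seq I) (P : pred I) (F : I -> T -> R) :
  (forall i, P i -> square_integrable (F i)) ->
  square_integrable (fun x => \sum_(i <- s | P i) F i x).
Proof.
move=> sF; elim: s => [|i s IH].
  by under eq_fun do rewrite big_nil; exact: square_integrable0.
under eq_fun do rewrite big_cons; have [Pi|//] := boolP (P i).
by apply: square_integrableD => //; exact: sF.
Qed.

Lemma dotL2Dl f g h : square_integrable f -> square_integrable g ->
  square_integrable h ->
  dotL2 (fun x => f x + g x) h = dotL2 f h + dotL2 g h.
Proof.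
move=> sf sg sh; rewrite -RintegralD//; [|exact: integrable_mul..].
by apply: eq_Rintegral => x _; rewrite mulrDl.
Qed.

Lemma dotL2Zl a f h : square_integrable f -> square_integrable h ->
  dotL2 (fun x => a * f x) h = a * dotL2 f h.
Proof.
move=> sf sh; rewrite -RintegralZl//; last exact: integrable_mul.
by apply: eq_Rintegral => x _; rewrite mulrA.
Qed.

Lemma dotL2Bl f g h : square_integrable f -> square_integrable g ->
  square_integrable h ->
  dotL2 (fun x => f x - g x) h = dotL2 f h - dotL2 g h.
Proof.
move=> sf sg sh; rewrite -mulN1r -dotL2Zl// -dotL2Dl//; last exact: square_integrableZ.
by apply: eq_Rintegral => x _; rewrite mulN1r.
Qed.

Lemma dotL2_suml (I : Type) (s : seq I) (P : pred I) (F : I -> T -> R) h :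
  (forall i, P i -> square_integrable (F i)) -> square_integrable h ->
  dotL2 (fun x => \sum_(i <- s | P i) F i x) h = \sum_(i <- s | P i) dotL2 (F i) h.
Proof.
move=> sF sh; elim: s => [|i s IH].
  rewrite big_nil /dotL2; under eq_Rintegral do rewrite big_nil mul0r.
  by rewrite /Rintegral integral0.
rewrite big_cons -IH; have [Pi|Pi] := boolP (P i); last first.
  by apply: eq_Rintegral => x _; rewrite big_cons (negbTE Pi).
rewrite -dotL2Dl//; [|exact: sF|exact: square_integrable_sum].
by apply: eq_Rintegral => x _; rewrite big_cons Pi.
Qed.

Lemma dotL2_ge0 f : 0 <= dotL2 f f.
Proof. by apply: Rintegral_ge0 => x _; rewrite -expr2 sqr_ge0. Qed.

Lemma dotL2_sqD a f g : square_integrable f -> square_integrable g ->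
  dotL2 (fun x => f x + a * g x) (fun x => f x + a * g x) =
  dotL2 f f + 2 * a * dotL2 f g + a ^+ 2 * dotL2 g g.
Proof.
move=> sf sg; have sag := square_integrableZ a sg.
have sfag := square_integrableD sf sag.
rewrite dotL2Dl// ![dotL2 _ (fun x => _ + _)]dotL2C !dotL2Dl//.
rewrite !(dotL2Zl a)// ![dotL2 _ (fun x => a * _)]dotL2C !(dotL2Zl a)// (dotL2C g f).
ring.
Qed.

Lemma cauchy_schwarz_L2 f g : square_integrable f -> square_integrable g ->
  dotL2 f g ^+ 2 <= dotL2 f f * dotL2 g g.
Proof.
move=> sf sg; have q a := dotL2_sqD a sf sg.
have q0 a : 0 <= dotL2 f f + 2 * a * dotL2 f g + a ^+ 2 * dotL2 g g.
  by rewrite -q dotL2_ge0.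
have := dotL2_ge0 g; rewrite le_eqVlt => /orP[/eqP g0|g0].
  rewrite -g0 mulr0 in q0 *; have [->|b0] := eqVneq (dotL2 f g) 0.
    by rewrite expr0n.
  have := q0 (- (dotL2 f f + 1) / (2 * dotL2 f g)).
  rewrite mulr0 addr0.
  have -> : 2 * (- (dotL2 f f + 1) / (2 * dotL2 f g)) * dotL2 f g = - (dotL2 f f + 1).
    by field.
  by lra.
have := q0 (- dotL2 f g / dotL2 g g).
have -> : dotL2 f f + 2 * (- dotL2 f g / dotL2 g g) * dotL2 f g +
    (- dotL2 f g / dotL2 g g) ^+ 2 * dotL2 g g =
    (dotL2 f f * dotL2 g g - dotL2 f g ^+ 2) / dotL2 g g by field; rewrite gt_eqF.
by rewrite pmulr_lge0 ?invr_gt0// subr_ge0.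
Qed.

Lemma dotL2_sqD_le f g : square_integrable f -> square_integrable g ->
  dotL2 (fun x => f x + g x) (fun x => f x + g x) <= 2 * dotL2 f f + 2 * dotL2 g g.
Proof.
move=> sf sg; have := dotL2_sqD 1 sf sg; have := dotL2_sqD (-1) sf sg.
have := dotL2_ge0 (fun x => f x + -1 * g x) => h1 h2 h3.
have -> : (fun x => f x + g x) = (fun x => f x + 1 * g x).
  by apply/funext => x; rewrite mul1r.
rewrite h3; move: h1; rewrite h2; lra.
Qed.

Lemma L2sq_cvg0P (h : nat -> T -> R) : (forall m, square_integrable (h m)) ->
  (fun m => L2sq mu D (h m)) @ \oo --> 0%E <->
  (fun m => dotL2 (h m) (h m)) @ \oo --> (0 : R).
Proof.
move=> sh; have -> : (fun m => L2sq mu D (h m)) = (fun m => (dotL2 (h m) (h m))%:E).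
  by apply/funext => m; rewrite L2sqE.
split => [/fine_cvg//|h0]; apply/fine_cvgP; split => //; exact: nearW.
Qed.

Definition L2_cvg (f_ : nat -> T -> R) f : Prop :=
  (fun m => L2sq mu D (fun x => f_ m x - f x)) @ \oo --> 0%E.

Lemma L2_cvg_square_integrable (f_ : nat -> T -> R) f : (forall m, square_integrable (f_ m)) ->
  measurable_fun D f -> L2_cvg f_ f -> square_integrable f.
Proof.
move=> sf_ mf cf.
have [m fm] : exists m, (L2sq mu D (fun x => (f_ m x - f x)%R) < +oo)%E.
  have /fine_cvgP[[m _ h] _] := cf.
  by exists m; rewrite ltey_eq (h m (leqnn m)).
have : square_integrable (fun x => f_ m x - f x).
  by split => //; apply: measurable_funB => //; case: (sf_ m).
move=> /(square_integrableB (sf_ m)); congr square_integrable.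
by apply/funext => x; rewrite opprB addrC subrK.
Qed.

Section cvg.
Variables (f_ : nat -> T -> R) (f : T -> R).
Hypotheses (sf_ : forall m, square_integrable (f_ m)) (sf : square_integrable f)
  (cf : L2_cvg f_ f).

Let dist0 : (fun m => dotL2 (fun x => f_ m x - f x) (fun x => f_ m x - f x)) @ \oo --> (0 : R).
Proof. by apply/L2sq_cvg0P => // m; exact: square_integrableB. Qed.

Lemma L2_cvg_dotL2 g : square_integrable g ->
  (fun m => dotL2 (f_ m) g) @ \oo --> dotL2 f g.
Proof.
move=> sg; have sB m := square_integrableB (sf_ m) sf.
apply/subr_cvg0; apply/norm_cvg0P.
apply: (@squeeze_cvgr _ _ _ _ (cst 0) (fun m => Num.sqrt
   (dotL2 (fun x => f_ m x - f x) (fun x => f_ m x - f x)) * Num.sqrt (dotL2 g g))).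
- near=> m; rewrite normr_ge0/= -dotL2Bl// -sqrtrM ?dotL2_ge0// -sqrtr_sqr ler_wsqrtr//.
  exact: cauchy_schwarz_L2.
- exact: cvg_cst.
- rewrite -[X in _ --> X](mul0r (Num.sqrt (dotL2 g g))); apply: cvgMl.
  rewrite -[X in _ --> X](@sqrtr0 R); apply: continuous_cvg dist0.
  exact: sqrt_continuous.
Unshelve. all: by end_near. Qed.

Lemma L2_cvg_dotL2_sq : (fun m => dotL2 (f_ m) (f_ m)) @ \oo --> dotL2 f f.
Proof.
have sB m := square_integrableB (sf_ m) sf.
have E m : dotL2 (f_ m) (f_ m) =
  dotL2 (fun x => f_ m x - f x) (fun x => f_ m x - f x) +
  2 * dotL2 (f_ m) f - dotL2 f f.
  rewrite [dotL2 (f_ m) f]dotL2C.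
  have := dotL2_sqD (-1) (sf_ m) sf.
  under [fun x => _ + -1 * _]eq_fun do rewrite mulN1r.
  by move=> ->; rewrite (dotL2C f); ring.
rewrite (funext E).
rewrite -[X in _ --> X](addrK (dotL2 f f)); apply: cvgB; last exact: cvg_cst.
rewrite -[X in _ --> X]add0r; apply: cvgD => //.
have -> : dotL2 f f + dotL2 f f = 2 * dotL2 f f by ring.
by apply: cvgMr; apply: L2_cvg_dotL2.
Qed.

End cvg.

Lemma L2_cvgD (f_ g_ : nat -> T -> R) f g : (forall m, square_integrable (f_ m)) ->
  square_integrable f -> (forall m, square_integrable (g_ m)) -> square_integrable g ->
  L2_cvg f_ f -> L2_cvg g_ g -> L2_cvg (fun m x => f_ m x + g_ m x) (fun x => f x + g x).
Proof.
move=> sf_ sf sg_ sg cf cg.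
have sBf m := square_integrableB (sf_ m) sf.
have sBg m := square_integrableB (sg_ m) sg.
have {}cf := (L2sq_cvg0P sBf).1 cf; have {}cg := (L2sq_cvg0P sBg).1 cg.
rewrite /L2_cvg.
have -> : (fun m => L2sq mu D (fun x => f_ m x + g_ m x - (f x + g x))) =
  (fun m => L2sq mu D (fun x => (f_ m x - f x) + (g_ m x - g x))).
  by apply/funext => m; congr L2sq; apply/funext => x; ring.
apply/L2sq_cvg0P; first by move=> m; exact: square_integrableD.
apply: (@squeeze_cvgr _ _ _ _ (cst 0) (fun m =>
   2 * dotL2 (fun x => f_ m x - f x) (fun x => f_ m x - f x) +
   2 * dotL2 (fun x => g_ m x - g x) (fun x => g_ m x - g x))).
- by near=> m; rewrite dotL2_ge0/= dotL2_sqD_le.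
- exact: cvg_cst.
- rewrite [X in _ --> X](_ : 0 = 2 * 0 + 2 * 0); last by ring.
  by apply: cvgD; apply: cvgMr; [apply: cf|apply: cg].
Unshelve. all: by end_near. Qed.

Lemma L2_cvgZ a (f_ : nat -> T -> R) f : (forall m, square_integrable (f_ m)) ->
  square_integrable f -> L2_cvg f_ f -> L2_cvg (fun m x => a * f_ m x) (fun x => a * f x).
Proof.
move=> sf_ sf cf; have sBf m := square_integrableB (sf_ m) sf.
have {}cf := (L2sq_cvg0P sBf).1 cf.
rewrite /L2_cvg.
have -> : (fun m => L2sq mu D (fun x => a * f_ m x - a * f x)) =
  (fun m => L2sq mu D (fun x => a * (f_ m x - f x))).
  by apply/funext => m; congr L2sq; apply/funext => x; ring.
apply/L2sq_cvg0P => [m|]; first exact: square_integrableZ.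
have E m : dotL2 (fun x => a * (f_ m x - f x)) (fun x => a * (f_ m x - f x)) =
   a ^+ 2 * dotL2 (fun x => f_ m x - f x) (fun x => f_ m x - f x).
  rewrite dotL2Zl//; last exact: square_integrableZ.
  by rewrite dotL2C dotL2Zl// mulrA expr2.
rewrite (funext E).
by rewrite -[X in _ --> X](mulr0 (a ^+ 2)); apply: cvgMr; apply: cf.
Qed.

Lemma L2_cvg_sum (I : Type) (s : seq I) (F_ : I -> nat -> T -> R) (F : I -> T -> R) :
  (forall i m, square_integrable (F_ i m)) -> (forall i, square_integrable (F i)) ->
  (forall i, L2_cvg (F_ i) (F i)) ->
  L2_cvg (fun m x => \sum_(i <- s) F_ i m x) (fun x => \sum_(i <- s) F i x).
Proof.
move=> sF_ sF cF; elim: s => [|i s IH].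
  rewrite /L2_cvg; under eq_fun => m.
    under [X in L2sq _ _ X]eq_fun do rewrite !big_nil subrr.
    rewrite /L2sq; under eq_integral do rewrite expr0n; rewrite integral0; over.
  exact: cvg_cst.
have -> : (fun m x => \sum_(j <- i :: s) F_ j m x) =
          (fun m x => F_ i m x + \sum_(j <- s) F_ j m x).
  by apply/funext => m; apply/funext => x; rewrite big_cons.
have -> : (fun x => \sum_(j <- i :: s) F j x) =
          (fun x => F i x + \sum_(j <- s) F j x).
  by apply/funext => x; rewrite big_cons.
apply: L2_cvgD => //; first by move=> m; exact: square_integrable_sum.
exact: square_integrable_sum.
Qed.

End square_integrable.

(** * Kernels on the square *)

Section tensor.
Context {R : realType}.
Implicit Types (f g a b : R -> R).

Lemma measurable_unit_itv : measurable (@unit_itv R).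
Proof. exact: measurable_itv. Qed.

Lemma measurable_unit_sq : measurable (@unit_sq R).
Proof. by apply: measurableX; exact: measurable_unit_itv. Qed.
Local Hint Resolve measurable_unit_itv measurable_unit_sq : core.

(** Fubini's theorem for the extensions by zero to the plane. *)
Lemma tensor_integral f g :
  leb.-integrable unit_itv (EFin \o f) -> leb.-integrable unit_itv (EFin \o g) ->
  leb2.-integrable unit_sq (EFin \o (fun z : R * R => f z.1 * g z.2)) /\
  \int[leb2]_(z in unit_sq) (f z.1 * g z.2) =
  (\int[leb]_(t in unit_itv) f t) * (\int[leb]_(t in unit_itv) g t).
Proof.
move=> If Ig.
pose F := f \_ unit_itv; pose G := g \_ unit_itv.
have resE (h : R -> R) : EFin \o (h \_ unit_itv) = (EFin \o h) \_ unit_itv.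
  by apply/funext => x; rewrite /= /patch; case: ifP.
have IF : (@lebesgue_measure R).-integrable setT (EFin \o F).
  by rewrite resE -integrable_mkcond.
have IG : (@lebesgue_measure R).-integrable setT (EFin \o G).
  by rewrite resE -integrable_mkcond.
have mF : measurable_fun setT F by apply/measurable_EFinP; exact: measurable_int IF.
have mG : measurable_fun setT G by apply/measurable_EFinP; exact: measurable_int IG.
pose h (z : R * R) := (F z.1 * G z.2)%:E.
have mh : measurable_fun setT h.
  apply/measurable_EFinP; apply: measurable_funM.
    exact: measurableT_comp measurable_fst.
  exact: measurableT_comp measurable_snd.
have resh : h = (EFin \o (fun z : R * R => f z.1 * g z.2)) \_ unit_sq.
  apply/funext => -[x y]; rewrite /h /F /G /patch /= in_setX /=.
  by case: (x \in _); case: (y \in _); rewrite ?mulr0 ?mul0r.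
have Ih : (@lebesgue_measure R \x @lebesgue_measure R)%E.-integrable setT h.
  apply/integrable12ltyP => //.
  have E x : (\int[@lebesgue_measure R]_y `|h (x, y)| = `|F x|%:E * \int[@lebesgue_measure R]_y `|G y|%:E)%E.
    rewrite -ge0_integralZl//.
    - by apply: eq_integral => y _; rewrite /h /= normrM EFinM.
    - by apply/measurable_EFinP; apply: measurableT_comp.
  under eq_integral do rewrite E.
  have /integrableP[_ oF] := IF; have /integrableP[_ oG] := IG.
  rewrite ge0_integralZr//.
  - by rewrite lte_mul_pinfty ?integral_ge0// ge0_fin_numE ?integral_ge0.
  - by apply/measurable_EFinP; apply: measurableT_comp.
  - by rewrite integral_ge0.
split.
  by apply/integrable_mkcond => //; rewrite -resh.
have RE (k : R -> R) : \int[leb]_(t in unit_itv) k t = fine (\int[@lebesgue_measure R]_x ((k \_ unit_itv) x)%:E).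
  by rewrite /Rintegral integral_mkcond -resE.
rewrite !RE -fineM; last 2 first.
- exact: integrable_fin_num IF.
- exact: integrable_fin_num IG.
congr fine; rewrite integral_mkcond -resh.
have fG : (\int[@lebesgue_measure R]_x (EFin \o G) x \is a fin_num)%E.
  exact: integrable_fin_num IG.
rewrite -(integral12_prod_meas1 Ih) -(fineK fG) -integralZr//.
apply: eq_integral => x _; rewrite fineK// /fubini_F -integralZl//.
Qed.

Lemma square_integrable_tensor f g : in_L2 f -> in_L2 g ->
  square_integrable leb2 unit_sq (fun z => f z.1 * g z.2).
Proof.
move=> sf sg.
have sf' : square_integrable leb unit_itv f by [].
have sg' : square_integrable leb unit_itv g by [].
have [I _] := tensor_integral (integrable_sq sf')
  (integrable_sq sg').
apply: square_integrableP => //; last first.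
  by apply: eq_integrable I => // x _ /=; rewrite exprMn.
apply: measurable_funM.
  apply: (@measurable_comp _ _ _ _ _ _ unit_itv f unit_sq fst) => //.
  - by move=> _ [[x y] [/= ? ?] <-].
  - by case: sf.
  - exact: measurable_funTS measurable_fst.
apply: (@measurable_comp _ _ _ _ _ _ unit_itv g unit_sq snd) => //.
- by move=> _ [[x y] [/= ? ?] <-].
- by case: sg.
- exact: measurable_funTS measurable_snd.
Qed.

Lemma dotL2_tensor f g a b : in_L2 f -> in_L2 g -> in_L2 a -> in_L2 b ->
  dotL2 leb2 unit_sq (fun z => f z.1 * g z.2) (fun z => a z.1 * b z.2) =
  inner f a * inner g b.
Proof.
move=> sf sg sa sb.
have [_ E] := tensor_integral
  (integrable_mul (mu := leb) measurable_unit_itv sf sa)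
  (integrable_mul (mu := leb) measurable_unit_itv sg sb).
by rewrite /inner -E; apply: eq_Rintegral => z _; rewrite mulrACA.
Qed.

End tensor.

Section kernels.
Context {R : realType} (e : nat -> R -> R).
Hypothesis eON : orthonormal_sys xpredT e.
Let eL2 k : in_L2 (e k). Proof. by case: eON => + _; apply. Qed.
Let edot j k : inner (e j) (e k) = (j == k)%:R.
Proof. by case: eON => _; apply. Qed.
Let mI := @measurable_unit_itv R.
Let mS := @measurable_unit_sq R.

Let sq_sum (I : finType) (F : I -> R * R -> R) :
  (forall i, square_integrable leb2 unit_sq (F i)) ->
  square_integrable leb2 unit_sq (fun z : R * R => \sum_i F i z).
Proof. by move=> sF; exact: (@square_integrable_sum _ _ R leb2 unit_sq mS I). Qed.

Let sqZ a (f : R * R -> R) : square_integrable leb2 unit_sq f ->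
  square_integrable leb2 unit_sq (fun z : R * R => a * f z).
Proof. exact: (@square_integrableZ _ _ R leb2 unit_sq mS). Qed.

Let dot_sum (I : finType) (F : I -> R * R -> R) h :
  (forall i, square_integrable leb2 unit_sq (F i)) ->
  square_integrable leb2 unit_sq h ->
  dotL2 leb2 unit_sq (fun z : R * R => \sum_i F i z) h =
  \sum_i dotL2 leb2 unit_sq (F i) h.
Proof. by move=> sF sh; exact: (@dotL2_suml _ _ R leb2 unit_sq mS I). Qed.

Let dotZ a (f h : R * R -> R) : square_integrable leb2 unit_sq f ->
  square_integrable leb2 unit_sq h ->
  dotL2 leb2 unit_sq (fun z : R * R => a * f z) h = a * dotL2 leb2 unit_sq f h.
Proof. exact: (@dotL2Zl _ _ R leb2 unit_sq mS). Qed.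

Let sq_entry l (A : 'M[R]_l) (j k : 'I_l) :
  square_integrable leb2 unit_sq (fun z : R * R => A j k * (e j z.1 * e k z.2)).
Proof. by apply: sqZ; exact: square_integrable_tensor. Qed.

Let sq_row l (A : 'M[R]_l) (j : 'I_l) : square_integrable leb2 unit_sq
  (fun z : R * R => \sum_(k < l) A j k * (e j z.1 * e k z.2)).
Proof. by apply: sq_sum => k; exact: sq_entry. Qed.

Lemma kernelB l (A B : 'M[R]_l) z :
  kernel_of e (A - B) z = kernel_of e A z - kernel_of e B z.
Proof.
rewrite /kernel_of -sumrB; apply: eq_bigr => j _; rewrite -sumrB.
by apply: eq_bigr => k _; rewrite !mxE mulrBl.
Qed.

Lemma square_integrable_kernel l (A : 'M[R]_l) :
  square_integrable leb2 unit_sq (kernel_of e A).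
Proof. by rewrite /kernel_of; apply: sq_sum => j; exact: sq_row. Qed.

Let dotL2_kernel l (A : 'M[R]_l) h : square_integrable leb2 unit_sq h ->
  dotL2 leb2 unit_sq (kernel_of e A) h =
  \sum_(j < l) \sum_(k < l) A j k *
     dotL2 leb2 unit_sq (fun z : R * R => e j z.1 * e k z.2) h.
Proof.
move=> sh; rewrite /kernel_of dot_sum//.
apply: eq_bigr => j _; rewrite dot_sum//.
by apply: eq_bigr => k _; rewrite dotZ//; exact: square_integrable_tensor.
Qed.

Lemma dotL2_kernel_tensor l (A : 'M[R]_l) f g : in_L2 f -> in_L2 g ->
  dotL2 leb2 unit_sq (kernel_of e A) (fun z => f z.1 * g z.2) =
  \sum_(j < l) \sum_(k < l) A j k * (inner (e j) f * inner (e k) g).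
Proof.
move=> sf sg; rewrite dotL2_kernel; last exact: square_integrable_tensor.
by apply: eq_bigr => j _; apply: eq_bigr => k _; rewrite dotL2_tensor.
Qed.

Lemma dotL2_kernel_basis l (A : 'M[R]_l) (j k : 'I_l) :
  dotL2 leb2 unit_sq (kernel_of e A) (fun z => e j z.1 * e k z.2) = A j k.
Proof.
rewrite dotL2_kernel_tensor// (bigD1 j)//= [X in _ + X]big1 ?addr0.
  rewrite (bigD1 k)//= big1 ?addr0; first by rewrite !edot !eqxx !mulr1.
  by move=> i ik; rewrite !edot -val_eqE in ik *; rewrite (negbTE ik) !mulr0.
move=> i ij; rewrite big1// => i' _.
by rewrite !edot -val_eqE in ij *; rewrite (negbTE ij) mul0r mulr0.
Qed.

(** Parseval on the square, for kernels with finitely many coefficients. *)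
Lemma L2sq_kernel l (A : 'M[R]_l) : L2sq leb2 unit_sq (kernel_of e A) = (hs_sq A)%:E.
Proof.
transitivity (dotL2 leb2 unit_sq (kernel_of e A) (kernel_of e A))%:E.
  exact: (@L2sqE _ _ R leb2 unit_sq mS _ (square_integrable_kernel A)).
congr EFin; rewrite dotL2_kernel; last exact: square_integrable_kernel.
apply: eq_bigr => j _; apply: eq_bigr => k _.
by rewrite dotL2C dotL2_kernel_basis expr2.
Qed.

End kernels.

(** * The covariance in the observation basis *)

Section covariance_kernel.
Context {R : realType} (e : nat -> R -> R).
Hypothesis eON : orthonormal_sys xpredT e.
Context (r : option nat) (lam : nat -> R) (phi : nat -> R -> R)
  (K : R * R -> R) (l : nat) (A : 'M[R]_l).
Hypotheses (KE : cov_expansion r lam phi K)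
  (KA : L2sq leb2 unit_sq (fun z => K z - kernel_of e A z) = 0%E).
Let eL2 k : in_L2 (e k). Proof. by case: eON => + _; apply. Qed.
Let edot j k : inner (e j) (e k) = (j == k)%:R.
Proof. by case: eON => _; apply. Qed.
Let mS := @measurable_unit_sq R.
Let sq (f : R * R -> R) := square_integrable leb2 unit_sq f.
Let dot (f g : R * R -> R) := dotL2 leb2 unit_sq f g.

Let sq_diff : sq (fun z => K z - kernel_of e A z).
Proof.
case: KE => _ _ _ mK _; split; last by rewrite KA.
by apply: measurable_funB => //; case: (square_integrable_kernel eON A).
Qed.

Let sqK : sq K.
Proof.
have := @square_integrableD _ _ R leb2 unit_sq mS _ _ sq_diff (square_integrable_kernel eON A).
by under eq_fun do rewrite subrK.
Qed.

Let dot_diff h : sq h -> dot (fun z => K z - kernel_of e A z) h = 0.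
Proof.
move=> sh; apply/eqP; rewrite -sqrf_eq0 eq_le sqr_ge0 andbT.
apply: le_trans (@cauchy_schwarz_L2 _ _ R leb2 unit_sq mS _ _ sq_diff sh) _.
have := @L2sqE _ _ R leb2 unit_sq mS _ sq_diff; rewrite KA => -[<-].
by rewrite mul0r.
Qed.

Let partial N (z : R * R) :=
  \sum_(0 <= k < N | idx r k) lam k * (phi k z.1 * phi k z.2).

Let phiL2 k : idx r k -> in_L2 (phi k).
Proof. by case: KE => -[h _] _ _ _ _; exact: h. Qed.

Let sq_partial N : sq (partial N).
Proof.
apply: (@square_integrable_sum _ _ R leb2 unit_sq mS) => k rk.
apply: (@square_integrableZ _ _ R leb2 unit_sq mS).
by apply: square_integrable_tensor; exact: phiL2.
Qed.

Let dot_partial N f g : in_L2 f -> in_L2 g ->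
  dot (partial N) (fun z => f z.1 * g z.2) =
  \sum_(0 <= k < N | idx r k) lam k * (inner (phi k) f * inner (phi k) g).
Proof.
move=> sf sg; have sfg := square_integrable_tensor sf sg.
rewrite /dot /partial; etransitivity.
  apply: (@dotL2_suml _ _ R leb2 unit_sq mS) => // k rk.
  apply: (@square_integrableZ _ _ R leb2 unit_sq mS).
  by apply: square_integrable_tensor; exact: phiL2.
apply: eq_bigr => k rk; etransitivity.
  apply: (@dotL2Zl _ _ R leb2 unit_sq mS) => //.
  by apply: square_integrable_tensor; exact: phiL2.
by rewrite dotL2_tensor//; exact: phiL2.
Qed.

(** The partial sums of the expansion and the kernel of [A] have the same limit
    [K] in [L2], and pairing with a product of two functions is continuous. *)
Lemma cov_expansion_pairing f g : in_L2 f -> in_L2 g ->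
  (fun N => \sum_(0 <= k < N | idx r k) lam k * (inner (phi k) f * inner (phi k) g))
    @ \oo --> \sum_(j < l) \sum_(k < l) A j k * (inner (e j) f * inner (e k) g).
Proof.
move=> sf sg; have sfg := square_integrable_tensor sf sg.
have cK : L2_cvg leb2 unit_sq partial K.
  case: KE => _ _ _ _; rewrite /L2_cvg.
  have -> : (fun N => L2sq leb2 unit_sq (fun z => K z - partial N z)) =
    (fun N => L2sq leb2 unit_sq (fun z => partial N z - K z)) => //.
  by apply/funext => N; apply: eq_integral => z _; rewrite -sqrrN opprB.
have := @L2_cvg_dotL2 _ _ R leb2 unit_sq mS _ _ sq_partial sqK cK _ sfg.
have -> : dotL2 leb2 unit_sq K (fun z => f z.1 * g z.2) =
    \sum_(j < l) \sum_(k < l) A j k * (inner (e j) f * inner (e k) g).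
  rewrite -dotL2_kernel_tensor//; apply/eqP; rewrite -subr_eq0; apply/eqP.
  rewrite -[RHS](dot_diff sfg); symmetry.
  exact: (@dotL2Bl _ _ R leb2 unit_sq mS _ _ _ sqK (square_integrable_kernel eON A)).
have -> // : (fun N => dotL2 leb2 unit_sq (partial N) (fun z => f z.1 * g z.2)) =
  (fun N => \sum_(0 <= k < N | idx r k) lam k * (inner (phi k) f * inner (phi k) g)).
by apply/funext => N; exact: dot_partial.
Qed.

(** [K] differs from the kernel of [A] by a null function, which is orthogonal
    to every kernel, so the loss is a matrix loss. *)
Lemma L2sq_loss (B : 'M[R]_l) :
  L2sq leb2 unit_sq (fun z => kernel_of e B z - K z) = (hs_sq (B - A))%:E.
Proof.
have sBA := square_integrable_kernel eON (B - A).
rewrite -(L2sq_kernel eON).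
have -> : (fun z => kernel_of e B z - K z) =
    (fun z => kernel_of e (B - A) z + (-1) * (K z - kernel_of e A z)).
  by apply/funext => z; rewrite kernelB; ring.
have sT := @square_integrableD _ _ R leb2 unit_sq mS _ _ sBA
   (@square_integrableZ _ _ R leb2 unit_sq mS (-1) _ sq_diff).
rewrite (@L2sqE _ _ R leb2 unit_sq mS _ sT) (@L2sqE _ _ R leb2 unit_sq mS _ sBA).
congr EFin; rewrite (@dotL2_sqD _ _ R leb2 unit_sq mS (-1) _ _ sBA sq_diff).
have h1 := dot_diff sBA; have h2 := dot_diff sq_diff.
by rewrite [X in 2 * -1 * X]dotL2C [X in 2 * -1 * X]h1 [X in (-1) ^+ 2 * X]h2 !mulr0 !addr0.
Qed.

Lemma basis_comb_in_L2 (x : 'rV[R]_l) : in_L2 (fun t => \sum_(k < l) x 0 k * e k t).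
Proof.
apply: (@square_integrable_sum _ _ R leb unit_itv (@measurable_unit_itv R)) => k _.
by apply: (@square_integrableZ _ _ R leb unit_itv (@measurable_unit_itv R)); exact: eL2.
Qed.

Lemma inner_basis_comb (x : 'rV[R]_l) (j : 'I_l) :
  inner (e j) (fun t => \sum_(k < l) x 0 k * e k t) = x 0 j.
Proof.
have mI := @measurable_unit_itv R.
have se k : square_integrable leb unit_itv (e k) := eL2 k.
have -> : inner (e j) (fun t => \sum_(k < l) x 0 k * e k t) =
  dotL2 leb unit_itv (fun t => \sum_(k < l) x 0 k * e k t) (e j).
  by rewrite dotL2C.
etransitivity.
  apply: (@dotL2_suml _ _ R leb unit_itv mI) => // k _.
  exact: (@square_integrableZ _ _ R leb unit_itv mI).
have E k : dotL2 leb unit_itv (fun t => x 0 k * e k t) (e j) = x 0 k * (k == j :> nat)%:R.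
  by rewrite (@dotL2Zl _ _ R leb unit_itv mI)// -edot.
rewrite (bigD1 j)//= big1 ?addr0 => [|k kj]; first by rewrite E eqxx mulr1.
by rewrite E val_eqE (negbTE kj) mulr0.
Qed.

Lemma quad_inner_basis_comb (x : 'rV[R]_l) :
  \sum_(j < l) \sum_(k < l) A j k *
     (inner (e j) (fun t => \sum_(k < l) x 0 k * e k t) *
      inner (e k) (fun t => \sum_(k < l) x 0 k * e k t)) = (x *m A *m x^T) 0 0.
Proof.
rewrite mxE exchange_big/=; apply: eq_bigr => k _.
rewrite mxE mulr_suml; apply: eq_bigr => j _.
by rewrite !inner_basis_comb mxE; ring.
Qed.

Lemma cov_nonneg_definite : nonneg_definite A.
Proof.
move=> x; rewrite -quad_inner_basis_comb.
pose g := fun t : R => \sum_(k < l) x 0 k * e k t.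
have sg : in_L2 g := basis_comb_in_L2 x.
have cg := cov_expansion_pairing sg sg.
rewrite -(cvg_lim _ cg)//; apply: limr_ge; first exact: cvgP cg.
apply: nearW => N; apply: sumr_ge0 => k rk.
case: KE => _ /(_ k rk) lk _ _ _.
by apply: mulr_ge0; [exact: ltW|rewrite -expr2 sqr_ge0].
Qed.

(** When [r] is finite the pairings of the expansion with the basis functions
    do not change after [r] terms, and they factor through dimension [r]. *)
Lemma cov_rank : (\rank A <= rank_min r l)%N.
Proof.
case Er : r => [m|] /=; last exact: rank_leq_row.
rewrite leq_min rank_leq_row andbT.
pose W := \matrix_(k < m, j < l) inner (phi k) (e j).
pose L := \row_(k < m) lam k.
suff -> : A = W^T *m diag_mx L *m W.
  exact: leq_trans (mxrankM_maxr _ _) (rank_leq_row _).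
apply/matrixP => i j.
have := cov_expansion_pairing (eL2 i) (eL2 j).
rewrite -dotL2_kernel_tensor// dotL2_kernel_basis// => cA.
rewrite -(cvg_lim _ cA)//; apply: cvg_lim => //.
have -> : (W^T *m diag_mx L *m W) i j =
    \sum_(0 <= k < m) lam k * (inner (phi k) (e i) * inner (phi k) (e j)).
  rewrite mxE big_mkord; apply: eq_bigr => k _.
  by rewrite mul_mx_diag !mxE; ring.
apply: cvg_near_cst; near=> N.
rewrite [RHS](big_nat_widen _ _ N); last by near: N; exists m.
by apply: eq_bigl => k; rewrite Er /=.
Unshelve. all: by end_near. Qed.

End covariance_kernel.

Import HBNNSimple.
Local Open Scope ereal_scope.

(** * Weighted images, Gaussian moments and independence *)

Section weighted_image.
Context d0 (T0 : measurableType d0) (R : realType).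

Section integral_against_weight.
Context d (T : measurableType d) (mu : {measure set T -> \bar R}) (phi : T -> T0)
  (W : T -> R).
Hypotheses (mphi : measurable_fun setT phi) (mW : measurable_fun setT W)
  (W0 : forall x, (0 <= W x)%R).

Lemma integral_weight_nnsfun (h : {nnsfun T0 >-> R}) :
  \int[mu]_x ((h (phi x))%:E * (W x)%:E) =
  \sum_(k \in range h) k%:E * \int[mu]_(x in phi @^-1` (h @^-1` [set k])) (W x)%:E.
Proof.
have mA k : measurable (phi @^-1` (h @^-1` [set k])).
  by rewrite -[X in measurable X]setTI; exact: mphi.
have E x : (h (phi x))%:E * (W x)%:E =
    \sum_(k \in range h) k%:E * (\1_(h @^-1` [set k]) (phi x))%:E * (W x)%:E.
  rewrite fimfunE -fsumEFin// ge0_mule_fsuml//.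
  by move=> k; exact: nnfun_muleindic_ge0.
under eq_integral do rewrite E.
rewrite ge0_integral_fsum//; last 2 first.
- move=> k; apply: emeasurable_funM; last exact/measurable_EFinP.
  apply: emeasurable_funM => //.
  by apply/measurable_EFinP; exact: measurableT_comp.
- by move=> k x _; rewrite mule_ge0 ?lee_fin//; exact: nnfun_muleindic_ge0.
apply: eq_fsbigr => k; rewrite inE => -[z _ <-{k}].
rewrite [in RHS]integral_mkcond -ge0_integralZl//.
- apply: eq_integral => x _; rewrite -muleA; congr (_ * _).
  rewrite patchE indicE; have -> : (x \in phi @^-1` (h @^-1` [set h z])) = (phi x \in h @^-1` [set h z]).
    by apply/idP/idP; rewrite !inE.
  by case: (_ \in _); rewrite ?mul1e ?mul0e.
- apply/(measurable_restrictT _ _).1 => //.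
  by apply: measurable_funTS; exact/measurable_EFinP.
- by move=> x _; rewrite patchE; case: ifP => // _; rewrite lee_fin.
- by rewrite lee_fin.
Qed.

Lemma integral_weight_approx (f : T0 -> \bar R) (mf : measurable_fun setT f) :
  (forall y, 0 <= f y) ->
  (fun n => \int[mu]_x ((nnsfun_approx measurableT mf n (phi x))%:E * (W x)%:E)) @ \oo -->
  \int[mu]_x (f (phi x) * (W x)%:E).
Proof.
move=> f0.
pose g n x := ((nnsfun_approx measurableT mf n (phi x))%:E * (W x)%:E).
have -> : (fun x => f (phi x) * (W x)%:E) = (fun x => limn (g ^~ x)).
  apply/funext => x; apply/esym/cvg_lim => //; apply: cvgeZr => //.
  exact: cvg_nnsfun_approx.
apply: cvg_monotone_convergence => //.
- move=> n; apply: emeasurable_funM; last exact/measurable_EFinP.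
  by apply/measurable_EFinP; exact: measurableT_comp.
- by move=> n x _; rewrite mule_ge0// lee_fin.
- move=> x _ m n mn; rewrite lee_wpmul2r ?lee_fin//.
  exact/lefP/nd_nnsfun_approx.
Qed.

End integral_against_weight.

(** Two weighted image measures that agree on measurable sets integrate every
    nonnegative function alike. Densities and independence are both expressed
    in this way: by a weight on the line for the former, by a constant weight,
    a product of expectations and probabilities, for the latter. *)
Lemma eq_integral_weight d1 d2 (T1 : measurableType d1) (T2 : measurableType d2)
    (mu1 : {measure set T1 -> \bar R}) (mu2 : {measure set T2 -> \bar R})
    (phi1 : T1 -> T0) (phi2 : T2 -> T0) (W1 : T1 -> R) (W2 : T2 -> R)
    (f : T0 -> \bar R) :
  measurable_fun setT phi1 -> measurable_fun setT phi2 ->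
  measurable_fun setT W1 -> measurable_fun setT W2 ->
  (forall x, (0 <= W1 x)%R) -> (forall x, (0 <= W2 x)%R) ->
  (forall B, measurable B -> \int[mu1]_(x in phi1 @^-1` B) (W1 x)%:E =
     \int[mu2]_(x in phi2 @^-1` B) (W2 x)%:E) ->
  measurable_fun setT f -> (forall y, 0 <= f y) ->
  \int[mu1]_x (f (phi1 x) * (W1 x)%:E) = \int[mu2]_x (f (phi2 x) * (W2 x)%:E).
Proof.
move=> m1 m2 mW1 mW2 W10 W20 eqB mf f0.
have c1 := @integral_weight_approx _ _ mu1 _ _ m1 mW1 W10 _ mf f0.
have c2 := @integral_weight_approx _ _ mu2 _ _ m2 mW2 W20 _ mf f0.
rewrite -(cvg_lim _ c1)// -(cvg_lim _ c2)//; congr (limn _); apply/funext => n.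
by rewrite !integral_weight_nnsfun//; apply: eq_fsbigr => k _; rewrite eqB.
Qed.

End weighted_image.

Section gaussian_mgf.
Context d (T : measurableType d) (R : realType) (P : probability T R).

(** Completing the square. *)
Lemma normal_pdf_tilt (s a x : R) : (s != 0 ->
  expR (a * x) * normal_pdf 0 s x =
  expR (a ^+ 2 * s ^+ 2 / 2) * normal_pdf (a * s ^+ 2) s x)%R.
Proof.
move=> s0; rewrite !normal_pdfE// !(mulrCA _ (normal_peak s)); congr (_ * _)%R.
rewrite /normal_fun -!expRD; congr expR; rewrite -mulr_natr; by field.
Qed.

Lemma gaussian_mgf (X : T -> R) (s a : R) : (s != 0)%R -> measurable_fun setT X ->
  has_law P X (normal_prob 0 s) ->
  \int[P]_w (expR (a * X w))%:E = (expR (a ^+ 2 * s ^+ 2 / 2))%:E.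
Proof.
move=> s0 mX lX.
have mexp : measurable_fun setT (fun x : R => (expR (a * x))%:E).
  by apply/measurable_EFinP; apply: measurableT_comp => //; apply: measurable_funM.
transitivity (\int[@lebesgue_measure R]_x ((expR (a * x))%:E * (normal_pdf 0 s x)%:E)).
  transitivity (\int[P]_w ((expR (a * X w))%:E * (cst 1%R w)%:E)).
    by apply: eq_integral => w _; rewrite mule1.
  apply: (@eq_integral_weight _ _ R _ _ _ _ P (@lebesgue_measure R) X id (cst 1%R)
    (normal_pdf 0 s) (fun x => (expR (a * x))%:E)) => //.
  - exact: measurable_normal_pdf.
  - exact: normal_pdf_ge0.
  - move=> B mB; rewrite [LHS](_ : _ = \int[P]_(x in X @^-1` B) cst 1 x)//.
    rewrite integral_cst ?mul1e; last first.
      by rewrite -[X in measurable X]setTI; exact: mX.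
    exact: lX.
under eq_integral do rewrite -EFinM /= normal_pdf_tilt// EFinM.
rewrite ge0_integralZl//=.
- by rewrite integral_normal_pdf mule1.
- by apply/measurable_EFinP; exact: measurable_normal_pdf.
- by move=> x _; rewrite lee_fin normal_pdf_ge0.
Qed.

End gaussian_mgf.

Section independence.
Context d (T : measurableType d) (R : realType) (P : probability T R)
  (I : eqType) (D : set I) (F : I -> set (set T)).
Hypothesis indepF : mutually_indep P D F.
Variable Z : I -> T -> R.
Hypotheses (mZ : forall i, D i -> measurable_fun setT (Z i))
  (FZ : forall i B, D i -> measurable B -> F i (Z i @^-1` B))
  (Z0 : forall i x, (0 <= Z i x)%R)
  (Zoo : forall i, D i -> \int[P]_x (Z i x)%:E < +oo).

(** In the induction on [J1] the head variable is first replaced by an event of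
    its family, which moves its index to [J2]; weighted images then lead from
    events back to the variable. *)
Lemma indep_partial_product (J1 J2 : seq I) (A : I -> set T) :
  uniq (J1 ++ J2) -> (forall i, i \in J1 ++ J2 -> D i) ->
  (forall i, i \in J2 -> F i (A i) /\ measurable (A i)) ->
  \int[P]_(x in \big[setI/setT]_(i <- J2) A i) (\prod_(i <- J1) Z i x)%:E =
  (\prod_(i <- J1) \int[P]_x (Z i x)%:E) * \prod_(i <- J2) P (A i).
Proof.
elim: J1 J2 A => [|i J1 IH] J2 A /= uJ DJ FA.
  have mA : measurable (\big[setI/setT]_(i <- J2) A i).
    by rewrite big_seq; apply: bigsetI_measurable => // j /FA[].
  rewrite big_nil mul1e; under eq_integral do rewrite big_nil.
  rewrite integral_cst// mul1e; apply: indepF => // j jJ.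
  by split; [exact: DJ|case: (FA _ jJ)].
have /andP[iJ uJ'] := uJ.
have mZJ : measurable_fun setT (fun x => \prod_(j <- J1) Z j x)%R.
  by apply: measurable_prod => j jJ; apply/mZ/DJ; rewrite inE mem_cat jJ orbT.
have ZJ0 x : (0 <= \prod_(j <- J1) Z j x)%R by apply: prodr_ge0.
pose C := \big[setI/setT]_(j <- J2) A j.
have mC : measurable C.
  by rewrite /C big_seq; apply: bigsetI_measurable => // j /FA[].
pose c := fine ((\prod_(j <- J1) \int[P]_x (Z j x)%:E) * \prod_(j <- J2) P (A j)).
have Di : D i by apply: DJ; rewrite mem_head.
have cE : (\prod_(j <- J1) \int[P]_x (Z j x)%:E) * \prod_(j <- J2) P (A j) = c%:E.
  rewrite fineK// fin_numM//.
    rewrite big_seq; apply: prode_fin_num => j jJ; rewrite ge0_fin_numE ?Zoo//.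
      by apply: DJ; rewrite inE mem_cat jJ orbT.
    by apply: integral_ge0 => x _; rewrite lee_fin.
  rewrite big_seq; apply: prode_fin_num => j jJ; rewrite fin_num_measure//.
  by case: (FA _ jJ).
have c0 : (0 <= c)%R.
  apply: fine_ge0; apply: mule_ge0; apply: prode_ge0 => j _ //.
  by apply: integral_ge0 => x _; rewrite lee_fin.
pose W x := (\1_C x * \prod_(j <- J1) Z j x)%R.
have mW : measurable_fun setT W by apply: measurable_funM.
have W0 x : (0 <= W x)%R by rewrite mulr_ge0// indicE.
have normZ x : `|Z i x|%R = Z i x by rewrite ger0_norm.
transitivity (\int[P]_x (`|Z i x|%:E * (W x)%:E)).
  rewrite integral_mkcond; apply: eq_integral => x _.
  rewrite patchE -/C /W indicE big_cons -EFinM normZ.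
  by case: (x \in C); rewrite ?mul1r ?mul0r ?mulr0.
transitivity (\int[P]_x (`|Z i x|%:E * (cst c x)%:E)).
  apply: (@eq_integral_weight _ _ R _ _ _ _ P P (Z i) (Z i) W (cst c)
    (fun y => `|y|%:E)) => //.
  - exact: mZ.
  - exact: mZ.
  - move=> B mB; have mZB : measurable (Z i @^-1` B).
      by rewrite -[X in measurable X]setTI; exact: mZ.
    pose A' j := if j == i then Z i @^-1` B else A j.
    have A'J j : j \in J2 -> A' j = A j.
      rewrite /A'; case: eqP => // -> iJ2.
      by move: iJ; rewrite mem_cat iJ2 orbT.
    have A'i : A' i = Z i @^-1` B by rewrite /A' eqxx.
    have := IH (i :: J2) A'; rewrite !big_cons A'i.
    have PA' : \prod_(j <- J2) P (A' j) = \prod_(j <- J2) P (A j).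
      by apply: eq_big_seq => j jJ; rewrite A'J.
    rewrite (eq_big_seq _ A'J) -/C PA'.
    move=> h; transitivity (\int[P]_(x in Z i @^-1` B `&` C) (\prod_(j <- J1) Z j x)%:E).
      rewrite integral_mkcond [RHS]integral_mkcond; apply: eq_integral => x _.
      rewrite !patchE in_setI /W indicE.
      by case: (x \in _); case: (x \in C); rewrite ?mul1r ?mul0r.
    rewrite h.
    - rewrite muleCA cE muleC [RHS](_ : _ = \int[P]_(x in Z i @^-1` B) cst c%:E x)//.
      by rewrite integral_cst.
    - by rewrite -(cat1s i J2) uniq_catCA.
    - by move=> j; rewrite mem_cat inE orbCA -mem_cat => /orP[/eqP->//|jJ]; apply: DJ; rewrite inE jJ orbT.
    - move=> j; rewrite inE => /orP[/eqP->|jJ].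
        by rewrite A'i; split => //; exact: FZ.
      by rewrite A'J//; exact: FA.
  - by apply/measurable_EFinP; exact: normr_measurable.
rewrite big_cons -muleA cE muleC -ge0_integralZl//.
- by apply: eq_integral => x _; rewrite normZ muleC.
- by apply/measurable_EFinP; exact: mZ.
- by move=> x _; rewrite lee_fin.
Qed.

Lemma indep_product (J : seq I) : uniq J -> (forall i, i \in J -> D i) ->
  \int[P]_x (\prod_(i <- J) Z i x)%:E = \prod_(i <- J) \int[P]_x (Z i x)%:E.
Proof.
move=> uJ DJ; have := @indep_partial_product J [::] (fun=> setT).
by rewrite cats0 !big_nil mule1; apply.
Qed.

End independence.

Local Close Scope ereal_scope.

Local Open Scope ereal_scope.

(** * Limits of integrals *)

Section limits_of_integrals.
Context d (T : measurableType d) (R : realType) (P : {measure set T -> \bar R}).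

(** Along indices with integrals below [2 ^- k] the sum of the functions has a
    finite integral, so it is finite almost everywhere. *)
Lemma ae_cvg_subsequence (h : nat -> T -> R) :
  (forall m, measurable_fun setT (h m)) -> (forall m x, (0 <= h m x)%R) ->
  (fun m => \int[P]_x (h m x)%:E) @ \oo --> 0 ->
  exists phi : nat -> nat, (forall k, (k <= phi k)%N) /\
    {ae P, forall x, (fun k => h (phi k) x) @ \oo --> (0 : R)%R}.
Proof.
move=> mh h0 ch.
have /choice[phi phiP] k : exists m, (k <= m)%N /\
    \int[P]_x (h m x)%:E <= (geometric 1 2^-1 k : R)%:E.
  have e0 : (0 < geometric 1 2^-1 k :> R)%R by rewrite /= mul1r exprn_gt0.
  have /fine_cvgP[ffin /cvgrPdist_le/(_ _ e0) fle] := ch.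
  have [m [km fm lm]] : exists m, [/\ (k <= m)%N,
      \int[P]_x (h m x)%:E \is a fin_num &
      (`|0 - fine (\int[P]_x (h m x)%:E)| <= geometric 1 2^-1 k :> R)%R].
    near \oo => m; exists m; split; first by near: m; exists k.
      by near: m.
    by near: m; move: fle; apply: filterS.
  exists m; split => //; rewrite -(fineK fm) lee_fin; move: lm.
  by rewrite sub0r normrN ger0_norm// fine_ge0// integral_ge0// => x _; rewrite lee_fin.
exists phi; split; first by move=> k; have [] := phiP k.
have mhE k : measurable_fun setT (fun x => (h (phi k) x)%:E) by exact/measurable_EFinP.
pose S x := \sum_(k <oo) (h (phi k) x)%:E.
have S0 x : 0 <= S x by apply: nneseries_ge0 => k _ _; rewrite lee_fin.
have mS : measurable_fun setT S.
  by apply: ge0_emeasurable_sum => // k x _ _; rewrite lee_fin.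
have IS : P.-integrable setT S.
  apply/integrableP; split => //.
  under eq_integral do rewrite gee0_abs//.
  rewrite integral_nneseries//; last by move=> k x _; rewrite lee_fin.
  apply: (@le_lt_trans _ _ (\sum_(k <oo) (geometric 1 2^-1 k : R)%:E)).
    apply: lee_nneseries => k *; last by have [] := phiP k.
    by apply: integral_ge0 => x _; rewrite lee_fin.
  have := @cvg_geometric_series R 1 2^-1; rewrite ger0_norm// => /(_ _) cg.
  rewrite (_ : \sum_(k <oo) _ = (1 / (1 - 2^-1))%:E) ?ltry//.
  apply/cvg_lim => //; apply: cvg_EFin; last first.
    have -> : fine \o (fun n => \sum_(0 <= k < n) (geometric 1 2^-1 k : R)%:E) =
      series (geometric (1 : R)%R 2^-1%R).
      by apply/funext => n; rewrite /= sumEFin.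
    apply: cg; lra.
  by apply: nearW => n; rewrite sumEFin.
have := integrable_ae measurableT IS.
apply: filterS => x /(_ I) Sx.
have Sfin : S x < +oo by rewrite ltey_eq Sx.
have tail := nneseries_tail_cvg Sfin (fun k _ => _ : 0 <= (h (phi k) x)%:E).
have {}tail : \sum_(N <= k <oo) (h (phi k) x)%:E @[N --> \oo] --> 0.
  by apply: tail => k; rewrite lee_fin.
suff : (h (phi k) x)%:E @[k --> \oo] --> 0 by move/fine_cvg.
apply: (@squeeze_cvge _ _ _ _ (cst 0) _ (fun N => \sum_(N <= k <oo) (h (phi k) x)%:E)) => //.
  apply: nearW => N; rewrite lee_fin h0/=.
  have := @nneseries_lim_ge R (fun k => (h (phi k) x)%:E) xpredT N N.+1.
  by rewrite big_nat1; apply => k _ _; rewrite lee_fin.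
exact: cvg_cst.
Unshelve. all: by end_near. Qed.

(** This is how bounds on exponential moments pass to [L2] limits, whose
    convergence is almost everywhere only along a subsequence. *)
Lemma fatou_subsequence (G_ : nat -> T -> R) (G : T -> R) (c_ : nat -> R) (c : R)
    (phi : nat -> nat) :
  (forall k, (k <= phi k)%N) ->
  (forall m, measurable_fun setT (G_ m)) -> measurable_fun setT G ->
  (forall m x, (0 <= G_ m x)%R) -> (forall x, (0 <= G x)%R) ->
  {ae P, forall x, (fun k => G_ (phi k) x) @ \oo --> G x} ->
  (forall m, \int[P]_x (G_ m x)%:E <= (c_ m)%:E) ->
  c_ @ \oo --> c -> \int[P]_x (G x)%:E <= c%:E.
Proof.
move=> kphi mG_ mG G_0 G0 cG le_c cc.
have phioo : phi @ \oo --> \oo.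
  move=> A [N _ NA]; exists N => // k /= Nk; apply: NA => /=.
  exact: leq_trans (kphi k).
have mGE k : measurable_fun setT (fun x => (G_ (phi k) x)%:E) by exact/measurable_EFinP.
have mL : measurable_fun setT (fun x => limn_einf (fun k => (G_ (phi k) x)%:E)).
  apply: (emeasurable_fun_cvg (fun n x => einfs (fun k => (G_ (phi k) x)%:E) n)).
    by move=> n; exact: measurable_fun_einfs.
  by move=> x _; rewrite limn_einf_lim; exact: is_cvg_einfs.
apply: (@le_trans _ _ (\int[P]_x limn_einf (fun k => (G_ (phi k) x)%:E))).
  apply: ae_ge0_le_integral => //.
  - by move=> x _; rewrite lee_fin.
  - exact/measurable_EFinP.
  - move=> x _; rewrite limn_einf_lim; apply: lime_ge; first exact: is_cvg_einfs.
    by apply: nearW => n; apply/ereal_infP => _ [k _ <-]; rewrite lee_fin.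
  - apply: filterS cG => x cx _.
    have cE : (fun k => (G_ (phi k) x)%:E) @ \oo --> (G x)%:E.
      by apply: cvg_EFin; [exact: nearW|exact: cx].
    by have [->] := cvg_limn_einf_sup cE.
apply: le_trans (fatou _ _ _ _) _ => //.
  by move=> k x _; rewrite lee_fin.
have cc' : (fun k => (c_ (phi k))%:E) @ \oo --> c%:E.
  by apply: cvg_EFin; [exact: nearW|exact: (cvg_comp phi c_ phioo cc)].
rewrite limn_einf_lim -(cvg_lim _ cc')//; apply: lee_lim.
- exact: is_cvg_einfs.
- exact: cvgP cc'.
- apply: nearW => n; apply: le_trans (le_c _).
  by apply: ereal_inf_lbound; exists n => /=.
Qed.

End limits_of_integrals.

Local Close Scope ereal_scope.

(** * Exponential inequalities *)

Section exponential_inequalities.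
Context {R : realType}.
Implicit Types x u : R.

Lemma expR_le_inv x : x < 1 -> expR x <= (1 - x)^-1.
Proof.
move=> x1; rewrite -[x]opprK expRN lef_pV2 ?posrE ?expR_gt0 ?opprK ?subr_gt0//.
exact: expR_ge1Dx.
Qed.

Lemma expR_sub1_le u : expR u - 1 <= u * expR u.
Proof.
have := ler_wpM2r (expR_ge0 u) (expR_ge1Dx (- u)).
by rewrite -expRD addNr expR0; lra.
Qed.

Lemma sqr_half_le_expR u : 0 <= u -> u ^+ 2 / 2 <= expR u.
Proof. by move=> u0; have := expR_ge1Dxn 1 u0; rewrite (_ : 2`!%:R = 2)//; lra. Qed.

Lemma cube_le_expR u : 0 <= u -> u ^+ 3 / 6 <= expR u.
Proof. by move=> u0; have := expR_ge1Dxn 2 u0; rewrite (_ : 3`!%:R = 6)//; lra. Qed.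

Lemma expR_le_quadratic u : expR u <= 1 + u + u ^+ 2 * expR `|u|.
Proof.
have h := expR_sub1_le u; have [u0|u0] := leP 0 u.
  rewrite ger0_norm//; have := ler_wpM2l u0 h; rewrite expr2; nra.
have e1 : 1 <= expR `|u| by rewrite -[leLHS]expR0 ler_expR normr_ge0.
have := expR_ge1Dx u => h2; have := sqr_ge0 u => u2.
have : u * (expR u - 1) <= u * u by rewrite ler_nM2l//; lra.
have := ler_wpM2l u2 e1; rewrite mulr1 expr2; nra.
Qed.

Lemma expR_norm_le u : expR `|u| <= expR u + expR (- u).
Proof.
by have [u0|u0] := leP 0 u; [rewrite ger0_norm// lerDl|rewrite ltr0_norm// lerDr]; exact: expR_ge0.
Qed.

(** Both bounds come from [e^x + e^-x - 2 = (e^(x/2) - e^(-x/2))^2] and the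
    mean value bounds of the difference. *)
Lemma cosh_bounds x :
  x ^+ 2 * expR (- `|x|) <= expR x + expR (- x) - 2 <= x ^+ 2 * expR `|x|.
Proof.
wlog x0 : x / 0 <= x => [h|].
  have [/h//|x0] := leP 0 x; have nx : 0 <= - x by lra.
  by have := h _ nx; rewrite sqrrN normrN opprK [expR (- x) + _]addrC.
rewrite ger0_norm//; pose y := x / 2.
have xE : x = y + y by rewrite /y; lra.
have y0 : 0 <= y by rewrite /y; lra.
have ex : expR x = expR y ^+ 2 by rewrite expr2 -expRD -xE.
have enx : expR (- x) = expR (- y) ^+ 2 by rewrite expr2 -expRD xE; congr expR; lra.
have -> : expR x + expR (- x) - 2 = (expR y - expR (- y)) ^+ 2.
  by rewrite ex enx sqrrB expRxMexpNx_1; lra.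
have E1 : expR y - expR (- y) = expR (- y) * (expR x - 1).
  by rewrite mulrBr mulr1 -expRD xE; congr (expR _ - _); lra.
have E2 : expR y - expR (- y) = expR y * (1 - expR (- x)).
  by rewrite mulrBr mulr1 -expRD xE; congr (_ - expR _); lra.
rewrite ex enx -!exprMn.
have h1 : x * expR (- y) <= expR y - expR (- y).
  rewrite E1 mulrC ler_wpM2l ?expR_ge0//; have := expR_ge1Dx x; lra.
have h2 : expR y - expR (- y) <= x * expR y.
  rewrite E2 mulrC ler_wpM2r ?expR_ge0//; have := expR_ge1Dx (- x); lra.
have h0 : 0 <= x * expR (- y) by rewrite mulr_ge0 ?expR_ge0.
rewrite !ler_sqr ?nnegrE//; first by rewrite h1.
- exact: le_trans h0 h1.
- by rewrite mulr_ge0 ?expR_ge0.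
- exact: le_trans h0 h1.
Qed.

(** The integer nearest to [x / 2] almost maximises [m x - m^2], whose maximum
    over real [m] is [x^2 / 4]. Exponentials of squares are thus controlled by
    countably many exponentials of linear functions. *)
Lemma expR_sqr_le_lattice x : exists m : nat,
  expR (x ^+ 2 / 4) <= 4 / 3 *
    (expR (m%:R * x - m%:R ^+ 2) + expR (- (m%:R * x) - m%:R ^+ 2)).
Proof.
wlog x0 : x / 0 <= x => [h|].
  have [/h//|x0] := leP 0 x; have nx : 0 <= - x by lra.
  by have [m hm] := h _ nx; exists m; move: hm; rewrite sqrrN mulrN opprK (addrC (expR (- (m%:R * x) - m%:R ^+ 2))).
pose m := Num.trunc (x / 2 + 1 / 2); exists m.
have /andP[m1 m2] : m%:R <= x / 2 + 1 / 2 < m.+1%:R by apply: truncn_itv; lra.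
have e4 : expR (1 / 4) <= 4 / 3 :> R.
  have := expR_le_inv (x := 1 / 4); rewrite (_ : (1 - 1 / 4)^-1 = 4 / 3); last by field.
  by apply; lra.
apply: (@le_trans _ _ (expR (1 / 4) * expR (m%:R * x - m%:R ^+ 2))).
  rewrite -[m.+1%:R]natr1 in m2.
  rewrite -expRD ler_expR; move: m1 m2; set M := m%:R => m1 m2.
  have h1 : 0 <= 1 / 2 - (x / 2 - M) by lra.
  have h2 : 0 <= 1 / 2 + (x / 2 - M) by lra.
  have := mulr_ge0 h1 h2; lra.
rewrite ler_pM ?expR_ge0// lerDl expR_ge0//.
Qed.

End exponential_inequalities.

(** * Gaussian moment bounds *)

Section nonneg_expectation.
Context d (T : measurableType d) (R : realType) (P : probability T R).
Implicit Types f g : T -> R.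

Lemma expect_le f g : measurable_fun setT f -> measurable_fun setT g ->
  (forall x, 0 <= f x) -> (forall x, f x <= g x) ->
  (\int[P]_x (f x)%:E <= \int[P]_x (g x)%:E)%E.
Proof.
move=> mf mg f0 fg; apply: ge0_le_integral => //.
- by move=> x _; rewrite lee_fin.
- exact/measurable_EFinP.
- exact/measurable_EFinP.
- by move=> x _; rewrite lee_fin.
Qed.

Lemma expectD f g : measurable_fun setT f -> measurable_fun setT g ->
  (forall x, 0 <= f x) -> (forall x, 0 <= g x) ->
  (\int[P]_x (f x + g x)%:E = \int[P]_x (f x)%:E + \int[P]_x (g x)%:E)%E.
Proof.
move=> mf mg f0 g0; under eq_integral do rewrite EFinD.
by rewrite ge0_integralD//; [move=> x _; rewrite lee_fin|exact/measurable_EFinP|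
  move=> x _; rewrite lee_fin|exact/measurable_EFinP].
Qed.

Lemma expectZ c f : 0 <= c -> measurable_fun setT f -> (forall x, 0 <= f x) ->
  (\int[P]_x (c * f x)%:E = c%:E * \int[P]_x (f x)%:E)%E.
Proof.
move=> c0 mf f0; under eq_integral do rewrite EFinM.
by rewrite ge0_integralZl//; [exact/measurable_EFinP|move=> x _; rewrite lee_fin].
Qed.

Lemma expect_cst c : (\int[P]_x c%:E = c%:E)%E.
Proof.
rewrite [LHS](_ : _ = \int[P]_x cst c%:E x)%E// integral_cst//= probability_setT.
by rewrite mule1.
Qed.

Lemma measurable_expR_comp f : measurable_fun setT f ->
  measurable_fun setT (fun x => expR (f x)).
Proof. exact: measurableT_comp. Qed.

End nonneg_expectation.

Lemma le_addr_small (R : realType) (x y c : R) :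
  (forall a, 0 < a -> a <= 1 -> x <= y + a * c) -> x <= y.
Proof.
move=> h; rewrite leNgt; apply/negP => yx.
have c0 : 0 < c by have := h 1 ltr01 (lexx _); rewrite mul1r; lra.
pose a := Num.min 1 ((x - y) / (2 * c)).
have q0 : 0 < (x - y) / (2 * c) by rewrite divr_gt0 ?subr_gt0 ?mulr_gt0.
have a0 : 0 < a by rewrite lt_min ltr01.
have a1 : a <= 1 by rewrite ge_min lexx.
have : a * c <= (x - y) / (2 * c) * c by rewrite ler_pM2r// ge_min lexx orbT.
have -> : (x - y) / (2 * c) * c = (x - y) / 2 by field; rewrite gt_eqF.
by have := h a a0 a1; lra.
Qed.

Lemma cvg_of_sqr_cvg0 (R : realType) (u : nat -> R) (l : R) :
  (fun k => (u k - l) ^+ 2) @ \oo --> (0 : R) -> u @ \oo --> l.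
Proof.
move=> h; apply/subr_cvg0; apply/norm_cvg0P.
have -> : (fun k => `|u k - l|) = Num.sqrt \o (fun k => (u k - l) ^+ 2).
  by apply/funext => k; rewrite /= sqrtr_sqr.
rewrite -[X in _ --> X](@sqrtr0 R); apply: continuous_cvg h.
exact: sqrt_continuous.
Qed.

Section gaussian_like.
Context d (T : measurableType d) (R : realType) (P : probability T R).
Implicit Types Y : T -> R.

(** The two features of a centred Gaussian variable that the noise bound uses.
    Both pass to [L2] limits, the second one by Fatou's lemma. *)
Definition gaussian_like Y (s : R) : Prop :=
  [/\ measurable_fun setT Y, L2sq P setT Y = s%:E
    & forall a : R, (\int[P]_x (expR (a * Y x))%:E <= (expR (a ^+ 2 * s / 2))%:E)%E].

Lemma measurable_expRZ a Y : measurable_fun setT Y ->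
  measurable_fun setT (fun x => expR (a * Y x)).
Proof. by move=> mY; apply: measurable_expR_comp; apply: measurable_funM. Qed.

(** The variance is the second derivative at 0 of the moment generating
    function: [(a Y)^2] equals [exp (a Y) + exp (- a Y) - 2] up to an error of
    order [a^3], which is integrable, and [a] tends to 0. *)
Lemma second_moment_of_mgf Y (s : R) : measurable_fun setT Y -> 0 <= s ->
  (forall a : R, (\int[P]_x (expR (a * Y x))%:E = (expR (a ^+ 2 * s / 2))%:E)%E) ->
  L2sq P setT Y = s%:E.
Proof.
move=> mY s0 mgf.
have me a := measurable_expRZ a mY.
have e0 a x : 0 <= expR (a * Y x) := expR_ge0 _.
have mc a : measurable_fun setT (fun x => expR (a * Y x) + expR (- a * Y x)).
  by apply: measurable_funD.
have c0 a x : 0 <= expR (a * Y x) + expR (- a * Y x) by rewrite addr_ge0.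
have cosh a : (\int[P]_x (expR (a * Y x) + expR (- a * Y x))%:E =
    (2 * expR (a ^+ 2 * s / 2))%:E)%E.
  by rewrite expectD// !mgf sqrrN -EFinD; congr EFin; lra.
have mY2 : measurable_fun setT (fun x => Y x ^+ 2) by apply: measurable_funX.
have normle x : expR `|Y x| <= expR (1 * Y x) + expR (- 1 * Y x).
  by rewrite mul1r mulN1r expR_norm_le.
have norm2le x : expR (2 * `|Y x|) <= expR (2 * Y x) + expR (- 2 * Y x).
  by rewrite -[2 * `|_|]ger0_norm ?mulr_ge0// normrM normr_id -normrM mulNr expR_norm_le.
have fin : (L2sq P setT Y < +oo)%E.
  apply: (@le_lt_trans _ _ (\int[P]_x (2 * (expR (1 * Y x) + expR (- 1 * Y x)))%:E)%E).
    apply: expect_le => //.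
    - by apply: measurable_funM.
    - by move=> x; exact: sqr_ge0.
    - move=> x; apply: le_trans (ler_wpM2l _ (normle x)) => //.
      by have := sqr_half_le_expR (normr_ge0 (Y x)); rewrite real_normK ?num_real//; lra.
  by rewrite expectZ// cosh -EFinM ltry.
have L0 : (0 <= L2sq P setT Y)%E.
  by apply: integral_ge0 => x _; rewrite lee_fin sqr_ge0.
have mE : L2sq P setT Y = (fine (L2sq P setT Y))%:E by rewrite fineK ?ge0_fin_numE.
set m := fine _ in mE.
have cube x : `|Y x| ^+ 3 <= 6 * expR `|Y x|.
  by have := cube_le_expR (normr_ge0 (Y x)); lra.
have sqn x : Y x ^+ 2 = `|Y x| ^+ 2 by rewrite real_normK ?num_real.
suff : m <= s /\ s <= m by move=> [h1 h2]; rewrite mE; congr EFin; apply/eqP; rewrite eq_le h1.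
have maY2 a : measurable_fun setT (fun x => a ^+ 2 * Y x ^+ 2) by apply: measurable_funM.
have aY20 a x : 0 <= a ^+ 2 * Y x ^+ 2 by rewrite mulr_ge0 ?sqr_ge0.
have aY2E a : (\int[P]_x (a ^+ 2 * Y x ^+ 2)%:E = (a ^+ 2 * m)%:E)%E.
  rewrite expectZ ?sqr_ge0//; last by move=> x; rewrite sqr_ge0.
  by rewrite -[X in (_ * X)%E]/(L2sq P setT Y) mE.
have mcz k a : measurable_fun setT (fun x => k * (expR (a * Y x) + expR (- a * Y x))).
  by apply: measurable_funM.
have cz0 a k x : 0 < a -> 0 <= 6 * a ^+ 3 * (expR (k * Y x) + expR (- k * Y x)).
  by move=> a0; rewrite mulr_ge0// mulr_ge0// exprn_ge0// ltW.
split.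
- apply: (@le_addr_small _ _ _ (s ^+ 2 / 2 * expR (s / 2) + 12 * expR (s / 2))) => a a0 a1.
  have pw x : a ^+ 2 * Y x ^+ 2 + 2 <= (expR (a * Y x) + expR (- a * Y x)) +
     6 * a ^+ 3 * (expR (1 * Y x) + expR (- 1 * Y x)).
    have /andP[h _] := cosh_bounds (a * Y x).
    rewrite normrM (gtr0_norm a0) in h; rewrite (mulNr a).
    have h1 : a ^+ 2 * Y x ^+ 2 * (1 - a * `|Y x|) <= (a * Y x) ^+ 2 * expR (- (a * `|Y x|)).
      rewrite exprMn; apply: ler_wpM2l; last exact: expR_ge1Dx.
      by rewrite mulr_ge0 ?sqr_ge0.
    have h2 : a ^+ 3 * `|Y x| ^+ 3 <= a ^+ 3 * (6 * (expR (1 * Y x) + expR (- 1 * Y x))).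
      rewrite ler_wpM2l ?exprn_ge0 ?(ltW a0)//.
      by have := cube x; have := normle x; lra.
    have h3 : a ^+ 2 * Y x ^+ 2 * (1 - a * `|Y x|) = a ^+ 2 * Y x ^+ 2 - a ^+ 3 * `|Y x| ^+ 3.
      by rewrite sqn; ring.
    move: h h1 h2; rewrite h3; lra.
  have a3 : 0 <= 6 * a ^+ 3 by rewrite mulr_ge0// exprn_ge0// ltW.
  have : (\int[P]_x (a ^+ 2 * Y x ^+ 2 + 2)%:E <= \int[P]_x ((expR (a * Y x) + expR (- a * Y x)) +
     6 * a ^+ 3 * (expR (1 * Y x) + expR (- 1 * Y x)))%:E)%E.
    apply: expect_le => //.
    - by apply: measurable_funD => //; apply: measurable_funM.
    - by apply: measurable_funD => //; apply: measurable_funM.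
    - by move=> x; rewrite addr_ge0// mulr_ge0// sqr_ge0.
  rewrite (@expectD _ _ _ P (fun x => a ^+ 2 * Y x ^+ 2) (fun=> 2))// aY2E expect_cst.
  rewrite expectD//; last by move=> x; exact: cz0.
  rewrite expectZ// !cosh expr1n mul1r -!EFinM -!EFinD lee_fin => h.
  have e1 := expR_le_quadratic (a ^+ 2 * s / 2).
  have as0 : 0 <= a ^+ 2 * s / 2 by rewrite divr_ge0// mulr_ge0// sqr_ge0.
  have e2 : expR `|a ^+ 2 * s / 2| <= expR (s / 2).
    rewrite ger0_norm// ler_expR ler_pM2r ?invr_gt0// ler_piMl//.
    by rewrite expr_le1// ltW.
  have e3 := ler_wpM2l (sqr_ge0 (a ^+ 2 * s / 2)) e2.
  have E0 := expR_ge0 (s / 2).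
  have k1 : 2 * (a ^+ 2 * s / 2) ^+ 2 * expR (s / 2) <= a ^+ 3 * (s ^+ 2 / 2 * expR (s / 2)).
    have -> : 2 * (a ^+ 2 * s / 2) ^+ 2 * expR (s / 2) = a * (a ^+ 3 * (s ^+ 2 / 2 * expR (s / 2))) by field.
    by rewrite ler_piMl// mulr_ge0 ?exprn_ge0 ?(ltW a0)// mulr_ge0// divr_ge0// sqr_ge0.
  have a2 : 0 < a ^+ 2 by rewrite exprn_gt0.
  rewrite -(ler_pM2l a2).
  have -> : a ^+ 2 * (s + a * (s ^+ 2 / 2 * expR (s / 2) + 12 * expR (s / 2))) =
    a ^+ 2 * s + a ^+ 3 * (s ^+ 2 / 2 * expR (s / 2)) + 6 * a ^+ 3 * (2 * expR (s / 2)) by ring.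
  lra.
apply: (@le_addr_small _ _ _ (12 * expR (2 * s))) => a a0 a1.
have pw x : expR (a * Y x) + expR (- a * Y x) <= 2 + (a ^+ 2 * Y x ^+ 2 +
   6 * a ^+ 3 * (expR (2 * Y x) + expR (- 2 * Y x))).
  have /andP[_ h] := cosh_bounds (a * Y x).
  rewrite normrM (gtr0_norm a0) in h; rewrite (mulNr a).
  have aY : a * `|Y x| <= `|Y x| by rewrite ler_piMl.
  have aY0 : 0 <= a * `|Y x| by rewrite mulr_ge0// ltW.
  have h1 : expR (a * `|Y x|) <= 1 + a * `|Y x| * expR `|Y x|.
    have := expR_sub1_le (a * `|Y x|).
    have := ler_wpM2l aY0 (_ : expR (a * `|Y x|) <= expR `|Y x|); rewrite ler_expR => /(_ aY).
    lra.
  have h2 := ler_wpM2l (sqr_ge0 (a * Y x)) h1.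
  have h3 : (a * Y x) ^+ 2 * (1 + a * `|Y x| * expR `|Y x|) =
     a ^+ 2 * Y x ^+ 2 + a ^+ 3 * (`|Y x| ^+ 3 * expR `|Y x|) by rewrite !exprMn sqn; ring.
  have h4 : `|Y x| ^+ 3 * expR `|Y x| <= 6 * (expR (2 * Y x) + expR (- 2 * Y x)).
    apply: le_trans (ler_wpM2r (expR_ge0 _) (cube x)) _.
    rewrite -mulrA ler_wpM2l// -expRD (_ : `|Y x| + `|Y x| = 2 * `|Y x|)//; lra.
  have h5 := ler_wpM2l (exprn_ge0 3 (ltW a0)) h4.
  move: h h2; rewrite h3; lra.
have a3 : 0 <= 6 * a ^+ 3 by rewrite mulr_ge0// exprn_ge0// ltW.
have : (\int[P]_x (expR (a * Y x) + expR (- a * Y x))%:E <= \int[P]_x (2 + (a ^+ 2 * Y x ^+ 2 +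
   6 * a ^+ 3 * (expR (2 * Y x) + expR (- 2 * Y x))))%:E)%E.
  apply: expect_le => //.
  apply: measurable_funD => //.
  by apply: measurable_funD => //; apply: measurable_funM.
rewrite (@expectD _ _ _ P (fun=> 2))//; last 2 first.
- by apply: measurable_funD.
- by move=> x; rewrite addr_ge0// cz0.
rewrite (@expectD _ _ _ P (fun x => a ^+ 2 * Y x ^+ 2))//; last by move=> x; exact: cz0.
rewrite aY2E expect_cst expectZ// !cosh -!EFinM -!EFinD lee_fin => h.
rewrite (_ : 2 ^+ 2 * s / 2 = 2 * s) in h; last by field.
have e1 := expR_ge1Dx (a ^+ 2 * s / 2).
have a2 : 0 < a ^+ 2 by rewrite exprn_gt0.
rewrite -(ler_pM2l a2).
have -> : a ^+ 2 * (m + a * (12 * expR (2 * s))) =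
    a ^+ 2 * m + 6 * a ^+ 3 * (2 * expR (2 * s)) by ring.
lra.
Qed.

End gaussian_like.

Section gaussian_like_limits.
Context d (T : measurableType d) (R : realType) (P : probability T R).
Implicit Types Y : T -> R.

Lemma gaussian_like_square_integrable Y s :
  gaussian_like P Y s -> square_integrable P setT Y.
Proof. by move=> [mY Ys _]; split => //; rewrite Ys ltry. Qed.

Lemma gaussian_like_dotL2 Y s : gaussian_like P Y s -> dotL2 P setT Y Y = s.
Proof.
move=> gY; have sY := gaussian_like_square_integrable gY.
by have [_ Ys _] := gY; have := L2sqE measurableT sY; rewrite Ys => -[].
Qed.

Lemma gaussian_like_ge0 Y s : gaussian_like P Y s -> 0 <= s.
Proof. by move=> /gaussian_like_dotL2 <-; exact: dotL2_ge0. Qed.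

Lemma gaussian_like_closed (Y_ : nat -> T -> R) Y (s_ : nat -> R) s :
  (forall m, gaussian_like P (Y_ m) (s_ m)) -> measurable_fun setT Y ->
  L2_cvg P setT Y_ Y -> s_ @ \oo --> s -> gaussian_like P Y s.
Proof.
move=> gY mY cY cs.
have sY_ m := gaussian_like_square_integrable (gY m).
have sY := L2_cvg_square_integrable measurableT sY_ mY cY.
have sE : dotL2 P setT Y Y = s.
  have := L2_cvg_dotL2_sq measurableT sY_ sY cY.
  rewrite (funext (fun m => gaussian_like_dotL2 (gY m))) => cs'.
  exact: cvg_unique cs' cs.
split => //; first by rewrite (L2sqE measurableT sY) sE.
move=> a.
have mYm m : measurable_fun setT (Y_ m) by case: (gY m).
have [phi [kphi cphi]] := @ae_cvg_subsequence _ _ R P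
  (fun m x => (Y_ m x - Y x) ^+ 2)
  (fun m => measurable_funX 2 (measurable_funB (mYm m) mY))
  (fun m x => sqr_ge0 _) cY.
apply: (@fatou_subsequence _ _ R P (fun m x => expR (a * Y_ m x)) _
  (fun m => expR (a ^+ 2 * s_ m / 2)) _ phi) => //.
- by move=> m; exact: measurable_expRZ.
- exact: measurable_expRZ.
- apply: filterS cphi => x /cvg_of_sqr_cvg0 cx.
  apply: (cvg_comp (fun k => a * Y_ (phi k) x) expR); last exact: continuous_expR.
  exact: cvgMr.
- by move=> m; case: (gY m).
- apply: (cvg_comp (fun m => a ^+ 2 * s_ m / 2) expR); last exact: continuous_expR.
  by apply: cvgMl; exact: cvgMr.
Qed.

Lemma geometric_bound (m : nat) : expR (- (m%:R ^+ 2) / 2) <= (2 / 3) ^+ m :> R.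
Proof.
have -> : (2 / 3 : R) = (3 / 2)^-1 by field.
rewrite mulNr expRN exprVn lef_pV2 ?posrE ?exprn_gt0 ?expR_gt0//.
apply: (@le_trans _ _ (expR (m%:R * (1 / 2)))).
  rewrite expRM_natl lerXn2r ?nnegrE ?expR_ge0//.
  by apply: le_trans (expR_ge1Dx _); lra.
rewrite ler_expR mul1r ler_pM2r ?invr_gt0// -natrX ler_nat.
by case: m => // m; rewrite leq_pmulr.
Qed.

(** By the lattice bound the left-hand side is at most a sum of values of the
    moment generating function, which decay geometrically with ratio 2/3. *)
Lemma gaussian_like_exp_sqr Y s (B : R) : gaussian_like P Y s -> s <= B -> 0 < B ->
  (\int[P]_x (expR (Y x ^+ 2 / (4 * B)))%:E <= 8%:E)%E.
Proof.
move=> [mY _ mgf] sB B0.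
pose b := Num.sqrt B; have b0 : 0 < b by rewrite sqrtr_gt0.
have bB : b ^+ 2 = B by rewrite sqr_sqrtr// ltW.
pose g (m : nat) x := expR (m%:R * (Y x / b) - m%:R ^+ 2) + expR (- (m%:R * (Y x / b)) - m%:R ^+ 2).
have gE m x : g m x = expR (- m%:R ^+ 2) * (expR (m%:R / b * Y x) + expR (- (m%:R / b) * Y x)).
  rewrite /g mulrDr -!expRD; congr (expR _ + expR _); field; exact: lt0r_neq0.
have mg m : measurable_fun setT (g m).
  have -> : g m = (fun x => expR (- m%:R ^+ 2) * (expR (m%:R / b * Y x) + expR (- (m%:R / b) * Y x))).
    by apply/funext => x; exact: gE.
  by apply: measurable_funM => //; apply: measurable_funD; exact: measurable_expRZ.
have g0 m x : 0 <= 4 / 3 * g m x by rewrite mulr_ge0// addr_ge0 ?expR_ge0.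
have mE a : measurable_fun setT (fun x => expR (a * Y x)) by exact: measurable_expRZ.
have e0 a x : 0 <= expR (a * Y x) := expR_ge0 _.
have mD a : measurable_fun setT (fun x => expR (a * Y x) + expR (- a * Y x)).
  exact: measurable_funD.
have d0 a x : 0 <= expR (a * Y x) + expR (- a * Y x) by rewrite addr_ge0.
have Eg m : (\int[P]_x (4 / 3 * g m x)%:E <= (geometric (8 / 3) (2 / 3) m : R)%:E)%E.
  rewrite expectZ//; last by move=> x; rewrite addr_ge0 ?expR_ge0.
  under eq_integral do rewrite gE.
  rewrite expectZ ?expR_ge0// expectD//.
  have le_mgf a : a ^+ 2 = m%:R ^+ 2 / B -> (\int[P]_x (expR (a * Y x))%:E <= (expR (m%:R ^+ 2 / 2))%:E)%E.
    move=> aE; apply: le_trans (mgf a) _; rewrite lee_fin ler_expR ler_pM2r ?invr_gt0// aE.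
    by rewrite -mulrA ler_piMr ?sqr_ge0// mulrC ler_pdivrMr// mul1r.
  have := leeD (le_mgf (m%:R / b) _) (le_mgf (- (m%:R / b)) _).
  rewrite sqrrN expr_div_n bB => /(_ erefl erefl) h.
  apply: le_trans (lee_wpmul2l _ (lee_wpmul2l _ h)) _; rewrite ?lee_fin ?expR_ge0//.
  rewrite /=.
  have -> : 4 / 3 * (expR (- m%:R ^+ 2) * (expR (m%:R ^+ 2 / 2) + expR (m%:R ^+ 2 / 2))) =
     8 / 3 * (expR (- m%:R ^+ 2) * expR (m%:R ^+ 2 / 2)) :> R by field.
  rewrite -expRD ler_wpM2l//; apply: le_trans (geometric_bound m).
  by rewrite ler_expR; lra.
apply: (@le_trans _ _ (\int[P]_x (\sum_(m <oo) (4 / 3 * g m x)%:E))%E).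
  apply: ge0_le_integral => //.
  - by apply/measurable_EFinP; apply: measurable_expR_comp; apply: measurable_funM => //; apply: measurable_funX.
  - apply: ge0_emeasurable_sum => [m x _ _|m _]; first by rewrite lee_fin.
    by apply/measurable_EFinP; exact: measurable_funM.
  - move=> x _; have [m hm] := expR_sqr_le_lattice (Y x / b).
    have -> : Y x ^+ 2 / (4 * B) = (Y x / b) ^+ 2 / 4.
      by rewrite expr_div_n bB; field; rewrite gt_eqF.
    apply: (@le_trans _ _ (4 / 3 * g m x)%:E); first by rewrite lee_fin.
    have := @nneseries_lim_ge R (fun k => (4 / 3 * g k x)%:E) xpredT 0 m.+1.
    rewrite big_nat_recr//= => h; apply: le_trans (h _); last by move=> k _ _; rewrite lee_fin.
    by rewrite leeDr// sume_ge0// => k _; rewrite lee_fin.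
rewrite integral_nneseries//; last 2 first.
- by move=> m; apply/measurable_EFinP; exact: measurable_funM.
- by move=> m x _; rewrite lee_fin.
apply: (@le_trans _ _ (\sum_(m <oo) (geometric (8 / 3) (2 / 3) m : R)%:E)%E).
  apply: lee_nneseries => m *; last exact: Eg.
  by apply: integral_ge0 => x _; rewrite lee_fin.
have cg := @cvg_geometric_series R (8 / 3) (2 / 3).
rewrite (_ : (\sum_(k <oo) _)%E = (8 / 3 / (1 - 2 / 3))%:E); first by rewrite lee_fin (_ : 8 / 3 / (1 - 2 / 3) = 8)//; field.
apply/cvg_lim => //; apply: cvg_EFin; last first.
  have -> : fine \o (fun n => (\sum_(0 <= k < n) (geometric (8 / 3) (2 / 3) k : R)%:E)%E) =
    series (geometric (8 / 3 : R)%R (2 / 3)%R).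
    by apply/funext => n; rewrite /= sumEFin.
  by apply: cg; rewrite ger0_norm; lra.
by apply: nearW => n; rewrite sumEFin.
Qed.

(** One-variable Bernstein bound for the centred square, by a second-order
    expansion of the exponential whose remainder is dominated by
    [exp (Y^2 / 4B)]. Here 172 is a bound for [128 exp (1/4)], and 1400 one for
    [8 * 172]. *)
Lemma gaussian_like_bernstein Y s (B b : R) :
  gaussian_like P Y s -> s <= B -> 0 < B -> `|b| * B <= 1 / 8 ->
  (\int[P]_x (expR (b * (Y x ^+ 2 - s)))%:E <= (expR (1400 * b ^+ 2 * B ^+ 2))%:E)%E.
Proof.
move=> gY sB B0 bB; have s0 := gaussian_like_ge0 gY.
have eY := gaussian_like_exp_sqr gY sB B0; have [mY Ys _] := gY.
pose r x := 172 * b ^+ 2 * B ^+ 2 * expR (Y x ^+ 2 / (4 * B)).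
have mY2 : measurable_fun setT (fun x => Y x ^+ 2) by exact: measurable_funX.
have me : measurable_fun setT (fun x => expR (Y x ^+ 2 / (4 * B))).
  by apply: measurable_expR_comp; apply: measurable_funM.
have mr : measurable_fun setT r by exact: measurable_funM.
have b2 : 0 <= 172 * b ^+ 2 * B ^+ 2.
  by apply: mulr_ge0 (sqr_ge0 _); apply: mulr_ge0 (sqr_ge0 _); rewrite ler0n.
have r0 x : 0 <= r x by rewrite mulr_ge0 ?expR_ge0.
have Er : (\int[P]_x (r x)%:E <= (172 * b ^+ 2 * B ^+ 2 * 8)%:E)%E.
  rewrite expectZ// [leRHS]EFinM; apply: lee_wpmul2l eY.
  by rewrite lee_fin.
have bb : - `|b| <= b <= `|b| by rewrite -ler_norml.
have pw x : expR (b * (Y x ^+ 2 - s)) + (`|b| * Y x ^+ 2 + `|b| * s) <=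
   1 + ((b + `|b|) * Y x ^+ 2 + ((`|b| - b) * s + r x)).
  pose v := Y x ^+ 2 / B + 1.
  have v0 : 0 <= v by rewrite addr_ge0// divr_ge0 ?sqr_ge0// ltW.
  have vE : Y x ^+ 2 + B = B * v by rewrite /v; field; rewrite gt_eqF.
  pose u := b * (Y x ^+ 2 - s).
  have hu : `|u| <= `|b| * B * v.
    rewrite /u normrM -mulrA ler_wpM2l// -vE ler_norml; have := sqr_ge0 (Y x); lra.
  have hu8 : `|u| <= v / 8 by apply: le_trans hu _; have := ler_wpM2r v0 bB; lra.
  have h1 := expR_le_quadratic u.
  have h2 : u ^+ 2 <= b ^+ 2 * B ^+ 2 * v ^+ 2.
    rewrite -real_normK ?num_real// -[b ^+ 2]real_normK ?num_real// -!exprMn.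
    by rewrite ler_sqr ?nnegrE// !mulr_ge0// ltW.
  have h3 : v ^+ 2 <= 128 * expR (v / 8).
    have v8 : 0 <= v / 8 by rewrite divr_ge0.
    have := sqr_half_le_expR v8; rewrite expr_div_n (_ : 8 ^+ 2 = 64); lra.
  have h4 : expR `|u| <= expR (v / 8) by rewrite ler_expR.
  have h5 : u ^+ 2 * expR `|u| <= r x.
    apply: (@le_trans _ _ (b ^+ 2 * B ^+ 2 * v ^+ 2 * expR (v / 8))).
      by rewrite ler_pM ?sqr_ge0 ?expR_ge0.
    apply: (@le_trans _ _ (b ^+ 2 * B ^+ 2 * (128 * expR (v / 8)) * expR (v / 8))).
      by rewrite ler_wpM2r ?expR_ge0// ler_wpM2l// mulr_ge0 ?sqr_ge0.
    have -> : b ^+ 2 * B ^+ 2 * (128 * expR (v / 8)) * expR (v / 8) =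
       b ^+ 2 * B ^+ 2 * 128 * (expR (v / 8) * expR (v / 8)) by ring.
    rewrite -expRD (_ : v / 8 + v / 8 = 1 / 4 + Y x ^+ 2 / (4 * B)); last first.
      by rewrite /v; field; rewrite gt_eqF.
    have e4 : expR (1 / 4) <= 4 / 3 :> R.
      have := expR_le_inv (x := 1 / 4 : R); rewrite (_ : (1 - 1 / 4)^-1 = 4 / 3); last by field.
      by apply; lra.
    rewrite expRD mulrA /r ler_wpM2r ?expR_ge0//.
    by have := ler_wpM2l (mulr_ge0 (sqr_ge0 b) (sqr_ge0 B)) e4; have := mulr_ge0 (sqr_ge0 b) (sqr_ge0 B); lra.
  have h6 : expR u <= 1 + u + r x by lra.
  by move: h6; rewrite /u; lra.
have c1 : 0 <= b + `|b| by lra.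
have c2 : 0 <= (`|b| - b) * s by rewrite mulr_ge0//; lra.
have c3 : 0 <= `|b| * s by rewrite mulr_ge0.
have EY k : 0 <= k -> (\int[P]_x (k * Y x ^+ 2)%:E = (k * s)%:E)%E.
  move=> k0; rewrite expectZ//; last by move=> x; rewrite sqr_ge0.
  by rewrite -[X in (_ * X)%E]/(L2sq P setT Y) Ys.
have mk k : measurable_fun setT (fun x => k * Y x ^+ 2) by exact: measurable_funM.
have mu : measurable_fun setT (fun x => expR (b * (Y x ^+ 2 - s))).
  by apply: measurable_expR_comp; apply: measurable_funM => //; apply: measurable_funB.
have u0 x : 0 <= expR (b * (Y x ^+ 2 - s)) := expR_ge0 _.
have kY0 k x : 0 <= k -> 0 <= k * Y x ^+ 2 by move=> k0; rewrite mulr_ge0 ?sqr_ge0.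
have mF : measurable_fun setT (fun x => `|b| * Y x ^+ 2 + `|b| * s) by exact: measurable_funD.
have F0 x : 0 <= `|b| * Y x ^+ 2 + `|b| * s by rewrite addr_ge0// kY0.
have mG : measurable_fun setT (fun x => (`|b| - b) * s + r x) by exact: measurable_funD.
have G0 x : 0 <= (`|b| - b) * s + r x by rewrite addr_ge0.
have mH : measurable_fun setT (fun x => (b + `|b|) * Y x ^+ 2 + ((`|b| - b) * s + r x)).
  exact: measurable_funD.
have H0 x : 0 <= (b + `|b|) * Y x ^+ 2 + ((`|b| - b) * s + r x) by rewrite addr_ge0// kY0.
have m_cst (k : R) : measurable_fun setT (fun _ : T => k) by exact: measurable_cst.
have := expect_le P (measurable_funD mu mF) (measurable_funD (m_cst 1) mH)
  (fun x => addr_ge0 (u0 x) (F0 x)) pw.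
rewrite (expectD P mu mF u0 F0).
rewrite (expectD P (mk `|b|) (m_cst _) (fun x => kY0 _ x (normr_ge0 b)) (fun=> c3)).
rewrite (expectD P (m_cst 1) mH (fun=> ler01) H0).
rewrite (expectD P (mk _) mG (fun x => kY0 _ x c1) G0).
rewrite (expectD P (m_cst _) mr (fun=> c2) r0) !expect_cst !EY// => h.
have hle : (\int[P]_x (expR (b * (Y x ^+ 2 - s)))%:E + (`|b| * s + `|b| * s)%:E <=
   (1 + ((b + `|b|) * s + ((`|b| - b) * s + 172 * b ^+ 2 * B ^+ 2 * 8)))%:E)%E.
  apply: le_trans h _; rewrite !EFinD; do 3 rewrite leeD2l//.
move: hle; rewrite -leeBrDr// => /le_trans; apply; rewrite -EFinB lee_fin.
apply: le_trans (expR_ge1Dx _).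
have := mulr_ge0 (sqr_ge0 b) (sqr_ge0 B); lra.
Qed.

End gaussian_like_limits.

(** * Integrals of step functions *)

Section step_partition.
Context {R : realType}.
Variable q : step_list (R := R).
Hypothesis q01 : step_in_unit q.

(** The endpoints of all intervals, in increasing order, cut the unit interval
    into cells on which the step function is constant. Beyond the end of the
    list the cut is 1, so that the last cell ends there. *)
Definition endpoints : seq R :=
  sort <=%R (flatten [seq [:: x.2.1; x.2.2] | x <- q]).
Definition cut (j : nat) : R := nth 1 endpoints j.
Definition cuts : nat := size endpoints.
Definition step_value (j : nat) : R :=
  \sum_(x <- q) x.1 * ((x.2.1 <= cut j) && (cut j.+1 <= x.2.2))%:R.

Let mem_endpoints x : x \in q -> x.2.1 \in endpoints /\ x.2.2 \in endpoints.
Proof.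
move=> xq; rewrite /endpoints !mem_sort; split; apply/flattenP.
  by exists [:: x.2.1; x.2.2]; rewrite ?mem_head//; apply/mapP; exists x.
by exists [:: x.2.1; x.2.2]; rewrite ?inE ?eqxx ?orbT//; apply/mapP; exists x.
Qed.

Let endpoints01 p : p \in endpoints -> 0 <= p <= 1.
Proof.
rewrite /endpoints mem_sort => /flattenP[_ /mapP[x xq ->]]; have [h1 h2 h3] := q01 xq.
rewrite !inE => /orP[] /eqP ->.
  by rewrite h1 (le_trans h2).
by rewrite h3 andbT (le_trans h1).
Qed.

Lemma cut_mono j k : (j <= k)%N -> cut j <= cut k.
Proof.
move=> jk; rewrite /cut; have [kL|kL] := ltnP k cuts; last first.
  rewrite [X in _ <= X]nth_default//; have [jL|jL] := ltnP j cuts.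
    by have /endpoints01/andP[] := mem_nth 1 jL.
  by rewrite nth_default.
apply: (@sorted_leq_nth _ _ le_trans lexx 1 endpoints) => //.
- exact: sort_le_sorted.
- by rewrite inE (leq_ltn_trans jk).
Qed.

Lemma cut0 : 0 <= cut 0.
Proof.
rewrite /cut; have [L0|L0] := ltnP 0 cuts; last by rewrite nth_default.
by have /endpoints01/andP[] := mem_nth 1 L0.
Qed.

Lemma cut_last : cut cuts = 1.
Proof. by rewrite /cut nth_default. Qed.

Let cut_gap p j : p \in endpoints -> p <= cut j \/ cut j.+1 <= p.
Proof.
move=> pL; have pE : cut (index p endpoints) = p by rewrite /cut nth_index.
by have [kj|jk] := leqP (index p endpoints) j; [left|right]; rewrite -pE cut_mono.
Qed.

Let cut0_le p : p \in endpoints -> cut 0 <= p.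
Proof.
by move=> pL; rewrite -[p in leRHS](nth_index 1 pL); exact: cut_mono.
Qed.

(** A function evaluated at the cuts clamped to [[u, v]] has increments that
    vanish outside [[u, v]] and telescope. *)
Let telescope (g : R -> R) x : x \in q ->
  g x.2.2 - g x.2.1 = \sum_(j < cuts)
    ((x.2.1 <= cut j) && (cut j.+1 <= x.2.2))%:R * (g (cut j.+1) - g (cut j)).
Proof.
move=> xq; have [uL vL] := mem_endpoints xq; have [_ uv _] := q01 xq.
set u := x.2.1 in uL uv *; set v := x.2.2 in vL uv *.
pose c y := Num.max u (Num.min y v).
have clow y : y <= u -> c y = u.
  by move=> yu; rewrite /c min_l ?(le_trans yu)// max_l.
have chigh y : v <= y -> c y = v by move=> vy; rewrite /c min_r// max_r.
have cmid y : u <= y -> y <= v -> c y = y by move=> uy yv; rewrite /c min_l// max_r.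
have -> : g v - g u = g (c (cut cuts)) - g (c (cut 0)).
  rewrite cut_last (clow (cut 0)) ?cut0_le// (chigh 1)//.
  by have /endpoints01/andP[] := vL.
rewrite -(telescope_sumr (fun j => g (c (cut j))) (leq0n cuts)) big_mkord.
apply: eq_bigr => j _; have jj := cut_mono (leqnSn j).
have [uj|ju] := leP u (cut j); last first.
  have [/(lt_le_trans ju)|h] := cut_gap j uL; first by rewrite ltxx.
  by rewrite mul0r !clow ?subrr// ltW.
have [jv|vj] := leP (cut j.+1) v; last first.
  have [h|/(lt_le_trans vj)] := cut_gap j vL; last by rewrite ltxx.
  by rewrite mul0r !chigh ?subrr// (le_trans h).
by rewrite mul1r !cmid// ?(le_trans jj)// (le_trans uj).
Qed.

Let regroup (g : R -> R) : \sum_(x <- q) x.1 * (g x.2.2 - g x.2.1) =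
  \sum_(j < cuts) step_value j * (g (cut j.+1) - g (cut j)).
Proof.
under [RHS]eq_bigr do rewrite /step_value mulr_suml.
rewrite exchange_big /=; apply: eq_big_seq => x xq.
by rewrite (telescope g xq) mulr_sumr; apply: eq_bigr => j _; rewrite mulrA.
Qed.

Lemma step_int_partition d (T : measurableType d) (P : probability T R)
  (W : R -> {RV P >-> R}) w :
  step_int q W w = \sum_(j < cuts) step_value j * (W (cut j.+1) w - W (cut j) w).
Proof. exact: (regroup (fun t => W t w)). Qed.

Definition cell (j : nat) : set R := `]cut j, cut j.+1]%classic.

Lemma step_fun_partition t :
  step_fun q t = \sum_(j < cuts) step_value j * \1_(cell j) t.
Proof.
have E (u v : R) : u <= v -> (u < t <= v)%R%:R = (t <= v)%R%:R - (t <= u)%R%:R :> R.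
  move=> uv; have [tu|ut] /= := leP t u; last by rewrite subr0.
  by rewrite (le_trans tu uv) subrr.
transitivity (\sum_(x <- q) x.1 * ((t <= x.2.2)%R%:R - (t <= x.2.1)%R%:R)).
  by apply: eq_big_seq => x xq; rewrite E//; have [] := q01 xq.
rewrite (regroup (fun y => (t <= y)%R%:R)); apply: eq_bigr => j _; congr (_ * _).
rewrite -E ?cut_mono// indicE; congr (_%:R).
by rewrite /cell mem_setE in_itv.
Qed.

Let mI := @measurable_unit_itv R.

Lemma measurable_cell j : measurable (cell j).
Proof. exact: measurable_itv. Qed.

Lemma in_L2_indic (A : set R) : measurable A -> in_L2 (\1_A : R -> R).
Proof.
move=> mA; split; first exact: measurable_indic.
apply: (@le_lt_trans _ _ (\int[leb]_(t in unit_itv) (cst 1%E) t)%E).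
  apply: ge0_le_integral => //.
  - apply/measurable_EFinP; apply: measurable_funX.
    exact: measurable_indic.
  - by move=> t _; rewrite lee_fin indicE; case: (_ \in _); rewrite ?expr1n ?expr0n.
rewrite integral_cst// mul1e /unit_itv.
have -> : leb `[0%R, 1%R]%classic = (1%:E : \bar R).
  rewrite -[LHS]/(lebesgue_measure `[0%R, 1%R]%classic).
  by rewrite lebesgue_measure_itv/= lte01 oppr0 adde0.
exact: ltry.
Qed.

Lemma in_L2_step_fun : in_L2 (step_fun q).
Proof.
have -> : step_fun q = (fun t => \sum_(j < cuts) step_value j * \1_(cell j) t).
  by apply/funext => t; exact: step_fun_partition.
apply: (@square_integrable_sum _ _ R leb unit_itv mI) => j _.
apply: (@square_integrableZ _ _ R leb unit_itv mI).
exact: in_L2_indic (measurable_cell j).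
Qed.

Lemma inner_cell j k : (j < cuts)%N ->
  inner (\1_(cell j)) (\1_(cell k)) = (j == k)%:R * (cut j.+1 - cut j).
Proof.
move=> jc.
have -> : inner (\1_(cell j)) (\1_(cell k)) = fine (leb (cell j `&` cell k `&` unit_itv)).
  rewrite /inner /Rintegral -integral_indic//; last first.
    by apply: measurableI; exact: measurable_cell.
  congr fine; apply: eq_integral => t _; congr EFin.
  by rewrite indicI.
have dis (i i' : nat) : (i < i')%N -> cell i `&` cell i' = set0.
  move=> ii; rewrite -subset0 => t []; rewrite /cell /= !in_itv/= => /andP[_ h1] /andP[h2 _].
  by have := lt_le_trans h2 (le_trans h1 (cut_mono ii)); rewrite ltxx.
have [jk|jk|<-] := ltngtP j k.
- by rewrite dis// set0I measure0 mul0r.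
- have -> : cell j `&` cell k = set0 by rewrite setIC dis.
  by rewrite set0I measure0 mul0r.
have -> : cell j `&` cell j `&` unit_itv = cell j.
  rewrite setIid; apply: setIidl => t; rewrite /cell /unit_itv /= !in_itv/= => /andP[h1 h2].
  rewrite (le_trans cut0 (le_trans (cut_mono (leq0n j)) (ltW h1)))/=.
  by rewrite (le_trans h2)// -cut_last cut_mono.
rewrite mul1r /cell -[leb _]/(lebesgue_measure _) lebesgue_measure_itv/= lte_fin.
have := cut_mono (leqnSn j); rewrite le_eqVlt => /orP[/eqP->|h]; first by rewrite ltxx subrr.
by rewrite h.
Qed.

Lemma inner_step_fun : inner (step_fun q) (step_fun q) =
  \sum_(j < cuts) step_value j ^+ 2 * (cut j.+1 - cut j).
Proof.
have sc j : square_integrable leb unit_itv (\1_(cell j) : R -> R).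
  exact: in_L2_indic (measurable_cell j).
have svc j : square_integrable leb unit_itv (fun t => step_value j * \1_(cell j) t).
  exact: (@square_integrableZ _ _ R leb unit_itv mI).
have sf : square_integrable leb unit_itv (fun t => \sum_(j < cuts) step_value j * \1_(cell j) t).
  by apply: (@square_integrable_sum _ _ R leb unit_itv mI) => j _.
have fE : step_fun q = (fun t => \sum_(j < cuts) step_value j * \1_(cell j) t).
  by apply/funext => t; exact: step_fun_partition.
transitivity (dotL2 leb unit_itv (fun t => \sum_(j < cuts) step_value j * \1_(cell j) t)
   (fun t => \sum_(j < cuts) step_value j * \1_(cell j) t)); first by rewrite fE.
rewrite (@dotL2_suml _ _ R leb unit_itv mI)//; apply: eq_bigr => j _.
rewrite (@dotL2Zl _ _ R leb unit_itv mI)// dotL2C (@dotL2_suml _ _ R leb unit_itv mI)//.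
rewrite (bigD1 j)//= big1 ?addr0 => [|k kj]; rewrite (@dotL2Zl _ _ R leb unit_itv mI)//.
  by rewrite -[dotL2 _ _ _ _]/(inner _ _) inner_cell// eqxx mul1r mulrA -expr2.
by rewrite -[dotL2 _ _ _ _]/(inner _ _) inner_cell// val_eqE (negbTE kj) mul0r mulr0.
Qed.

End step_partition.

Section brownian_step_integral.
Context {R : realType} d (T : measurableType d) (P : probability T R).
Variable W : R -> {RV P >-> R}.
Hypothesis BW : brownian_motion W.

Lemma mgf_increment (u v a : R) : 0 <= u -> u <= v -> v <= 1 ->
  (\int[P]_w (expR (a * (W v w - W u w)))%:E = (expR (a ^+ 2 * (v - u) / 2))%:E)%E.
Proof.
move=> u0; rewrite le_eqVlt => /orP[/eqP<-|uv] v1.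
  under eq_integral do rewrite subrr mulr0 expR0.
  by rewrite subrr mulr0 mul0r expR0 expect_cst.
case: BW => _ lawW _ _; have := lawW u v u0 uv v1.
have sp : Num.sqrt (v - u) != 0 by rewrite gt_eqF// sqrtr_gt0 subr_gt0.
have mX : measurable_fun setT (fun w => W v w - W u w) by exact: measurable_funB.
move=> lX; rewrite (gaussian_mgf _ sp mX lX).
by rewrite sqr_sqrtr// subr_ge0 ltW.
Qed.

Variable q : step_list (R := R).
Hypothesis q01 : step_in_unit q.

(** Over the cells the integral is a sum of independent Gaussian increments. *)
Lemma mgf_step_int a : (\int[P]_w (expR (a * step_int q W w))%:E =
  (expR (a ^+ 2 * inner (step_fun q) (step_fun q) / 2))%:E)%E.
Proof.
pose D (j : 'I_(cuts q)) w := W (cut q j.+1) w - W (cut q j) w.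
have mD j : measurable_fun setT (D j) by exact: measurable_funB.
pose Z (j : 'I_(cuts q)) w := expR (a * step_value q j * D j w).
have mZ j : measurable_fun setT (Z j) by exact: measurable_expRZ.
have EZ j : (\int[P]_w (Z j w)%:E =
    (expR (a ^+ 2 * (step_value q j ^+ 2 * (cut q j.+1 - cut q j)) / 2))%:E)%E.
  rewrite mgf_increment ?exprMn ?mulrA//.
  - exact: le_trans (cut0 q01) (cut_mono q01 (leq0n _)).
  - exact: cut_mono.
  - by rewrite -(cut_last q) cut_mono.
have indep : mutually_indep P [set: 'I_(cuts q)] (fun j => sigma_of1 (D j)).
  case: BW => _ _ h _; apply: (h _ (cut q)).
  - exact: cut0.
  - by move=> j; exact: cut_mono.
  - by rewrite cut_last.
have := @indep_product _ _ _ P _ _ _ indep Z (fun j _ => mZ j) _ _ _ (index_enum 'I_(cuts q)).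
move=> /(_ _ _ _ (index_enum_uniq _) (fun _ _ => I)) h.
transitivity (\int[P]_w (\prod_(j < cuts q) Z j w)%:E)%E.
  apply: eq_integral => w _; congr EFin; rewrite step_int_partition// mulr_sumr expR_sum.
  by apply: eq_bigr => j _; rewrite /Z /D mulrA.
rewrite h.
- under eq_bigr do rewrite EZ.
  rewrite prodEFin -expR_sum; congr (expR _)%:E.
  by rewrite inner_step_fun// mulr_sumr mulr_suml.
- move=> j B _ mB; exists ((fun x => expR (a * step_value q j * x)) @^-1` B) => //.
    rewrite -[X in measurable X]setTI; apply: measurable_expRZ => //.
  by rewrite setTI.
- by move=> j w; exact: expR_ge0.
- by move=> j _; rewrite EZ ltry.
Qed.

End brownian_step_integral.

Section generated_sigma_algebra.
Context {R : realType} d (T : measurableType d) (P : probability T R)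
  (I : Type) (D : set I) (X : I -> T -> R).

Let G := \bigcup_(i in D) preimage_set_system setT (X i) measurable.
Let TG := g_sigma_algebraType G.

(** Measurability for the sigma-algebra generated by the family, phrased on the
    type that carries this sigma-algebra, so that the closure properties of
    measurable functions apply. *)
Definition adapted (f : T -> R) : Prop := measurable_fun (setT : set TG) (f : TG -> R).

Lemma adapted_sigma_of f B : adapted f -> measurable B -> sigma_of D X (f @^-1` B).
Proof. by move=> af mB; have := af measurableT B mB; rewrite setTI. Qed.

Lemma adapted_member i : D i -> adapted (X i).
Proof.
move=> Di _ B mB; apply: sub_sigma_algebra; exists i => //; exists B => //.
Qed.

Lemma adaptedZ a f : adapted f -> adapted (fun x => a * f x).
Proof. by move=> af; apply: measurable_funM. Qed.

Lemma adaptedD f g : adapted f -> adapted g -> adapted (fun x => f x + g x).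
Proof. by move=> af ag; apply: measurable_funD. Qed.

Lemma adaptedB f g : adapted f -> adapted g -> adapted (fun x => f x - g x).
Proof. by move=> af ag; apply: measurable_funB. Qed.

Lemma adapted_sum (J : Type) (s : seq J) (Q : pred J) (f : J -> T -> R) :
  (forall j, Q j -> adapted (f j)) -> adapted (fun x => \sum_(j <- s | Q j) f j x).
Proof.
move=> af; elim: s => [|j s IH].
  by under eq_fun do rewrite big_nil; exact: measurable_cst.
under eq_fun do rewrite big_cons; have [Qj|//] := boolP (Q j).
by apply: adaptedD => //; exact: af.
Qed.

Lemma adapted_sum_seq (J : eqType) (s : seq J) (f : J -> T -> R) :
  (forall j, j \in s -> adapted (f j)) -> adapted (fun x => \sum_(j <- s) f j x).
Proof.
move=> af; have := @adapted_sum J s (mem s) f af.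
by under eq_fun do rewrite -big_seq.
Qed.

Lemma adapted_expR f : adapted f -> adapted (fun x => expR (f x)).
Proof. by move=> af; exact: (measurableT_comp (@measurable_expR R) af). Qed.

End generated_sigma_algebra.

Section step_integrals.
Context {R : realType} d (T : measurableType d) (P : probability T R).

Lemma adapted_step_int (X : R -> {RV P >-> R}) (q : step_list (R := R)) :
  step_in_unit q -> adapted unit_itv (fun t => X t : T -> R) (step_int q X).
Proof.
move=> q01; apply: adapted_sum_seq => x xq; have [h1 h2 h3] := q01 x xq.
apply: adaptedZ; apply: adaptedB; apply: adapted_member; rewrite /unit_itv /= in_itv/=.
  by rewrite h3 (le_trans h1).
by rewrite h1 (le_trans h2).
Qed.

Lemma measurable_step_int (X : R -> {RV P >-> R}) (q : step_list (R := R)) :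
  measurable_fun setT (step_int q X).
Proof.
rewrite /step_int; elim: q => [|x q IH].
  by under eq_fun do rewrite big_nil; exact: measurable_cst.
under eq_fun do rewrite big_cons; apply: measurable_funD => //.
by apply: measurable_funM => //; exact: measurable_funB.
Qed.

Let mI := @measurable_unit_itv R.

Lemma Rintegral_initial_segment (h : R -> R) (u : R) : 0 <= u -> u <= 1 ->
  \int[leb]_(t in `[0, u]%classic) h t = inner h (\1_(`[0, u]%classic)).
Proof.
move=> u0 u1.
have -> : `[0, u]%classic = unit_itv `&` `[0, u]%classic :> set R.
  rewrite setIidr// => t; rewrite /unit_itv /= !in_itv/= => /andP[-> /le_trans]; exact.
rewrite Rintegral_mkcondr; apply: eq_Rintegral => t; rewrite inE => tI.
rewrite patchE indicE in_setI (mem_set tI) /=.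
by case: (_ \in _); rewrite ?mulr1 ?mulr0.
Qed.

(** For [h] a path of the signal, the left-hand side is the contribution of the
    drift to the integral of the step function against the observations. *)
Lemma inner_step_fun_primitive (h : R -> R) (q : step_list (R := R)) :
  step_in_unit q -> in_L2 h ->
  \sum_(x <- q) x.1 * (\int[leb]_(t in `[0, x.2.2]%classic) h t -
                       \int[leb]_(t in `[0, x.2.1]%classic) h t) =
  inner h (step_fun q).
Proof.
move=> q01 sh.
have sI u : square_integrable leb unit_itv (\1_(`[0, u]%classic) : R -> R).
  by apply: in_L2_indic; exact: measurable_itv.
pose g (x : R * (R * R)) t := \1_(`[0, x.2.2]%classic) t - \1_(`[0, x.2.1]%classic) t : R.
have sg x : square_integrable leb unit_itv (g x) by exact: (@square_integrableB _ _ R leb unit_itv mI).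
transitivity (dotL2 leb unit_itv (fun t => \sum_(x <- q) x.1 * g x t) h).
  rewrite (@dotL2_suml _ _ R leb unit_itv mI)//; last first.
    by move=> x _; exact: (@square_integrableZ _ _ R leb unit_itv mI).
  apply: eq_big_seq => x xq; have [h1 h2 h3] := q01 x xq.
  rewrite (@dotL2Zl _ _ R leb unit_itv mI)// (@dotL2Bl _ _ R leb unit_itv mI)//.
  rewrite !Rintegral_initial_segment ?(le_trans h1)// ?(le_trans h2)//.
  by congr (_ * (_ - _)); exact: dotL2C.
rewrite dotL2C; apply: eq_Rintegral => t; rewrite inE /unit_itv /= in_itv/= => /andP[t0 _].
congr (_ * _); apply: eq_big_seq => x xq; have [_ h2 _] := q01 x xq; congr (_ * _).
rewrite /g !indicE !mem_setE !in_itv/= t0/=.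
have [tu|ut] /= := leP t x.2.1; last by rewrite subr0.
by rewrite (le_trans tu h2) subrr.
Qed.

End step_integrals.

(** * Integrals of step functions against the observations *)

Section signal_plus_noise.
Context {R : realType} d (T : measurableType d) (P : probability T R).
Context (sigma : R) (r : option nat) (lam : nat -> R) (phi : nat -> R -> R)
  (K : R * R -> R) (xi : nat -> {RV P >-> R}) (W : R -> {RV P >-> R})
  (S : T * R -> R) (X : R -> {RV P >-> R}).
Hypotheses (KE : cov_expansion r lam phi K)
  (xi_law : forall k, idx r k -> has_law P (xi k) (normal_prob 0 1))
  (xi_indep : mutually_indep P [set k | idx r k] (fun k => sigma_of1 (xi k)))
  (BW : brownian_motion W)
  (xiW_indep : mutually_indep P [set: bool]
      (fun b => if b then sigma_of [set k | idx r k] (fun k => xi k : T -> R)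
                else sigma_of unit_itv (fun t => W t : T -> R)))
  (mS : measurable_fun ([set: T] `*` unit_itv) S)
  (SE : (fun N : nat => L2sq (P \x @lebesgue_measure R)%E ([set: T] `*` unit_itv)
       (fun z => S z - \sum_(0 <= k < N | idx r k)
                         Num.sqrt (lam k) * xi k z.1 * phi k z.2))
      @ \oo --> 0%E)
  (XE : {ae P, forall w, forall t, unit_itv t ->
       X t w - X 0 w =
         (\int[leb]_(u in `[0, t]%classic) S (w, u)) + sigma * W t w}).
Variable q : step_list (R := R).
Hypothesis q01 : step_in_unit q.

Let mI := @measurable_unit_itv R.
Let Q := step_fun q.
Let sQ : in_L2 Q := in_L2_step_fun q01.
Let phiL2 k : idx r k -> in_L2 (phi k).
Proof. by case: KE => -[h _] _ _ _ _; exact: h. Qed.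
Let lam0 k : idx r k -> 0 < lam k.
Proof. by case: KE => _ h _ _ _; exact: h. Qed.

(** Keeping [N] terms of the signal leaves a sum of independent Gaussian
    variables, whose variance can be written down. *)
Definition truncated_signal N w :=
  \sum_(0 <= k < N | idx r k) Num.sqrt (lam k) * xi k w * inner (phi k) Q.
Definition truncated_step_int N w := truncated_signal N w + sigma * step_int q W w.
Definition truncated_variance N :=
  \sum_(0 <= k < N | idx r k) lam k * (inner (phi k) Q * inner (phi k) Q) + sigma ^+ 2 * inner Q Q.

Let mgf_xi k c : idx r k -> (\int[P]_w (expR (c * xi k w))%:E = (expR (c ^+ 2 / 2))%:E)%E.
Proof.
move=> rk; rewrite (gaussian_mgf c (oner_neq0 R) _ (xi_law rk))//.
by rewrite expr1n mulr1.
Qed.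

Let adapted_signal N : adapted [set k | idx r k] (fun k => xi k : T -> R) (truncated_signal N).
Proof.
apply: adapted_sum => k rk.
have -> : (fun x => Num.sqrt (lam k) * xi k x * inner (phi k) Q) =
   (fun x => (Num.sqrt (lam k) * inner (phi k) Q) * xi k x).
  by apply/funext => x; ring.
by apply: adaptedZ; exact: adapted_member.
Qed.

Let m_signal N : measurable_fun setT (truncated_signal N).
Proof.
rewrite /truncated_signal; under eq_fun do rewrite -big_filter.
by apply: measurable_sum => k; apply: measurable_funM => //; exact: measurable_funM.
Qed.

Let mgf_signal N a : (\int[P]_w (expR (a * truncated_signal N w))%:E =
  (expR (a ^+ 2 * (\sum_(0 <= k < N | idx r k) lam k * (inner (phi k) Q * inner (phi k) Q)) / 2))%:E)%E.
Proof.
pose c k := a * Num.sqrt (lam k) * inner (phi k) Q.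
pose Z k w := expR (c k * xi k w).
have mZ k : measurable_fun setT (Z k) by exact: measurable_expRZ.
pose J := [seq k <- index_iota 0 N | idx r k].
have EZ k : idx r k -> (\int[P]_w (Z k w)%:E = (expR (c k ^+ 2 / 2))%:E)%E by exact: mgf_xi.
have uJ : uniq J by rewrite filter_uniq// iota_uniq.
have DJ k : k \in J -> [set k | idx r k] k by rewrite mem_filter => /andP[].
transitivity (\int[P]_w (\prod_(k <- J) Z k w)%:E)%E.
  apply: eq_integral => w _; congr EFin; rewrite -expR_sum /truncated_signal mulr_sumr big_filter.
  by congr expR; apply: eq_bigr => k _; rewrite /c; ring.
rewrite (indep_product xi_indep (fun k _ => mZ k) _ _ _ uJ DJ).
- rewrite big_seq (eq_bigr (fun k => (expR (c k ^+ 2 / 2))%:E)); last by move=> k /DJ; exact: EZ.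
  rewrite -big_seq prodEFin -expR_sum big_filter; congr (expR _)%:E.
  rewrite mulr_sumr mulr_suml; apply: eq_bigr => k rk.
  by rewrite /c !exprMn sqr_sqrtr ?ltW ?lam0//; ring.
- move=> k B _ mB; exists ((fun x => expR (c k * x)) @^-1` B); last by rewrite setTI.
  by rewrite -[X in measurable X]setTI; apply: measurable_expRZ.
- by move=> k w; exact: expR_ge0.
- by move=> k rk; rewrite EZ// ltry.
Qed.

Let truncated_gaussian N : gaussian_like P (truncated_step_int N) (truncated_variance N).
Proof.
have mT : measurable_fun setT (truncated_step_int N).
  apply: measurable_funD => //; apply: measurable_funM => //.
  exact: measurable_step_int.
have mgf a : (\int[P]_w (expR (a * truncated_step_int N w))%:E =
    (expR (a ^+ 2 * truncated_variance N / 2))%:E)%E.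
  pose Z (b : bool) w := if b then expR (a * truncated_signal N w)
     else expR (a * sigma * step_int q W w).
  have mZ b : measurable_fun setT (Z b).
    case: b; first exact: measurable_expRZ.
    by apply: measurable_expRZ; exact: measurable_step_int.
  have EZ b : (\int[P]_w (Z b w)%:E < +oo)%E.
    by case: b; rewrite /Z; [rewrite mgf_signal|rewrite (mgf_step_int BW q01)]; exact: ltry.
  transitivity (\int[P]_w (\prod_(b <- [:: true; false]) Z b w)%:E)%E.
    apply: eq_integral => w _; congr EFin; rewrite !big_cons big_nil mulr1 /Z -expRD.
    by congr expR; rewrite /truncated_step_int; ring.
  rewrite (indep_product xiW_indep (fun b _ => mZ b) _ _ _ (isT : uniq [:: true; false]) (fun _ _ => I)).
  - rewrite !big_cons big_nil mule1 /Z mgf_signal mgf_step_int// -EFinM -expRD.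
    by congr (expR _)%:E; rewrite /truncated_variance; field.
  - case=> B _ mB.
      apply: (adapted_sigma_of _ mB); apply: adapted_expR; apply: adaptedZ.
      exact: adapted_signal.
    apply: (adapted_sigma_of _ mB); apply: adapted_expR; apply: adaptedZ.
    exact: adapted_step_int.
  - by case=> w; exact: expR_ge0.
  - by move=> b _; exact: EZ.
have v0 : 0 <= truncated_variance N.
  rewrite addr_ge0//; last by rewrite mulr_ge0 ?sqr_ge0//; exact: dotL2_ge0.
  apply: sumr_ge0 => k rk; rewrite mulr_ge0 ?(ltW (lam0 rk))//.
  by rewrite -expr2 sqr_ge0.
by split => //; [exact: second_moment_of_mgf|move=> a; rewrite mgf].
Qed.

Let S_ N (z : T * R) := \sum_(0 <= k < N | idx r k) Num.sqrt (lam k) * xi k z.1 * phi k z.2.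

Let mD : measurable ([set: T] `*` (@unit_itv R)).
Proof. by apply: measurableX. Qed.

Let mS_ N : measurable_fun ([set: T] `*` unit_itv) (S_ N).
Proof.
rewrite /S_; elim: (index_iota 0 N) => [|k s IH].
  by under eq_fun do rewrite big_nil; exact: measurable_cst.
under eq_fun do rewrite big_cons; case rk: (idx r k) => //.
apply: measurable_funD => //; apply: measurable_funM.
  apply: measurable_funM => //; apply: measurable_funTS.
  exact: measurableT_comp measurable_fst.
apply: (@measurable_comp _ _ _ _ _ _ unit_itv (phi k) ([set: T] `*` unit_itv) snd) => //.
- by move=> _ [[x y] [/= ? ?] <-].
- by case: (phiL2 rk).
- exact: measurable_funTS measurable_snd.
Qed.

(** The energy in time of the part of the signal beyond [N] terms. Its
    expectation tends to 0, and by the Cauchy-Schwarz inequality it bounds the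
    squared error made on the integral of the step function. *)
Let residual N w : \bar R := L2sq leb unit_itv (fun t => S (w, t) - S_ N (w, t)).

Let residual0 N w : (0 <= residual N w)%E.
Proof. by apply: integral_ge0 => t _; rewrite lee_fin sqr_ge0. Qed.

Let tonelli N : measurable_fun setT (residual N) /\
  (\int[P]_w residual N w = L2sq (P \x @lebesgue_measure R)%E ([set: T] `*` unit_itv)
     (fun z => (S z - S_ N z)%R))%E.
Proof.
pose f := ((fun z => ((S z - S_ N z) ^+ 2)%:E) \_ ([set: T] `*` unit_itv)) : T * R -> \bar R.
have mf : measurable_fun setT f.
  have mg : measurable_fun ([set: T] `*` unit_itv) (fun z => ((S z - S_ N z) ^+ 2)%:E).
    by apply/measurable_EFinP; apply: measurable_funX; exact: measurable_funB.
  exact: (measurable_restrictT _ mD).1 mg.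
have f0 z : (0 <= f z)%E.
  by rewrite /f patchE; case: ifP => // _; rewrite lee_fin sqr_ge0.
have rE : residual N = fubini_F (@lebesgue_measure R) f.
  apply/funext => w; rewrite /residual /L2sq integral_mkcond /fubini_F.
  by apply: eq_integral => t _; rewrite /f !patchE in_setX /= in_setT.
split; first by rewrite rE; exact: measurable_fun_fubini_tonelli_F.
by rewrite rE /L2sq [RHS]integral_mkcond fubini_tonelli1.
Qed.

Let signal_error N w : (residual N w < +oo)%E ->
  (\sum_(x <- q) x.1 * (\int[leb]_(t in `[0, x.2.2]%classic) S (w, t) -
                        \int[leb]_(t in `[0, x.2.1]%classic) S (w, t))
    - truncated_signal N w) ^+ 2 <= fine (residual N w) * inner Q Q.
Proof.
move=> rfin.
have mpair : measurable_fun unit_itv (pair w : R -> T * R).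
  exact: measurable_funTS (pair1_measurable w).
have section (g : T * R -> R) : measurable_fun ([set: T] `*` unit_itv) g ->
    measurable_fun unit_itv (fun t => g (w, t)).
  move=> mg; apply: (@measurable_comp _ _ _ _ _ _ ([set: T] `*` unit_itv) g unit_itv (pair w)) => //.
  by move=> _ [t tI <-].
have mSw := section _ mS; have mSNw := section _ (mS_ N).
have sN : square_integrable leb unit_itv (fun t => S_ N (w, t)).
  rewrite /S_ /=; apply: (@square_integrable_sum _ _ R leb unit_itv mI) => k rk.
  by apply: (@square_integrableZ _ _ R leb unit_itv mI); exact: phiL2.
have sB : square_integrable leb unit_itv (fun t => S (w, t) - S_ N (w, t)).
  by split; [exact: (measurable_funB mSw mSNw)|exact: rfin].
have sS : square_integrable leb unit_itv (fun t => S (w, t)).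
  have := @square_integrableD _ _ R leb unit_itv mI _ _ sB sN.
  by under eq_fun do rewrite subrK.
have -> : fine (residual N w) = dotL2 leb unit_itv (fun t => S (w, t) - S_ N (w, t)) (fun t => S (w, t) - S_ N (w, t)).
  by rewrite /residual (@L2sqE _ _ R leb unit_itv mI).
rewrite (inner_step_fun_primitive q01 sS).
have -> : truncated_signal N w = dotL2 leb unit_itv (fun t => S_ N (w, t)) Q.
  rewrite /S_ /= (@dotL2_suml _ _ R leb unit_itv mI)//.
    by apply: eq_bigr => k rk; rewrite (@dotL2Zl _ _ R leb unit_itv mI)//; exact: phiL2.
  by move=> k rk; apply: (@square_integrableZ _ _ R leb unit_itv mI); exact: phiL2.
rewrite -[inner _ _]/(dotL2 leb unit_itv (fun t => S (w, t)) Q).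
rewrite -(@dotL2Bl _ _ R leb unit_itv mI)//.
exact: (@cauchy_schwarz_L2 _ _ R leb unit_itv mI).
Qed.

Let truncated_cvg : L2_cvg P setT truncated_step_int (step_int q X).
Proof.
pose c := inner Q Q + 1.
have Q0 : 0 <= inner Q Q by exact: dotL2_ge0.
apply: (@squeeze_cvge _ _ _ _ (cst 0%E) _ (fun N => (c%:E * L2sq (P \x @lebesgue_measure R)
   ([set: T] `*` unit_itv) (fun z => (S z - S_ N z)%R))%E)).
- apply: nearW => N; apply/andP; split.
    by apply: integral_ge0 => w _; rewrite lee_fin sqr_ge0.
  have [mres <-] := tonelli N.
  rewrite -ge0_integralZl//; last by rewrite lee_fin addr_ge0.
  apply: ae_ge0_le_integral => //.
  + by move=> w _; rewrite lee_fin sqr_ge0.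
  + apply/measurable_EFinP; apply: measurable_funX; apply: measurable_funB.
      by have [] := truncated_gaussian N.
    exact: measurable_step_int.
  + by move=> w _; rewrite mule_ge0// lee_fin addr_ge0.
  + exact: measurable_funeM.
  apply: filterS XE => w Xw _.
  have [rfin|] := ltP (residual N w) +oo%E; last first.
    rewrite leye_eq => /eqP ->; rewrite gt0_muley ?leey// lte_fin; rewrite /c; lra.
  rewrite -(fineK (_ : residual N w \is a fin_num)) ?ge0_fin_numE// -EFinM lee_fin.
  have stepE : step_int q X w = \sum_(x <- q) x.1 * (\int[leb]_(t in `[0, x.2.2]%classic) S (w, t) -
                        \int[leb]_(t in `[0, x.2.1]%classic) S (w, t)) + sigma * step_int q W w.
    rewrite /step_int mulr_sumr -big_split; apply: eq_big_seq => x xq /=.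
    have [h1 h2 h3] := q01 xq.
    have I1 : unit_itv x.2.1 by rewrite /unit_itv /= in_itv/= h1 (le_trans h2).
    have I2 : unit_itv x.2.2 by rewrite /unit_itv /= in_itv/= h3 (le_trans h1).
    have -> : X x.2.2 w - X x.2.1 w = (X x.2.2 w - X 0 w) - (X x.2.1 w - X 0 w) by ring.
    rewrite (Xw _ I1) (Xw _ I2); ring.
  rewrite /truncated_step_int stepE -sqrrN.
  have -> : - (truncated_signal N w + sigma * step_int q W w -
     (\sum_(x <- q) x.1 * (\int[leb]_(t in `[0, x.2.2]%classic) S (w, t) -
                        \int[leb]_(t in `[0, x.2.1]%classic) S (w, t)) + sigma * step_int q W w)) =
    \sum_(x <- q) x.1 * (\int[leb]_(t in `[0, x.2.2]%classic) S (w, t) -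
                        \int[leb]_(t in `[0, x.2.1]%classic) S (w, t)) - truncated_signal N w by ring.
  apply: le_trans (signal_error rfin) _; rewrite mulrC ler_wpM2r ?fine_ge0//.
  by rewrite /c lerDl.
- exact: cvg_cst.
- by rewrite -[X in _ --> X](mule0 c%:E); apply: cvgeZl.
Qed.

Context (e : nat -> R -> R) (l : nat) (A : 'M[R]_l).
Hypotheses (eON : orthonormal_sys xpredT e)
  (KA : L2sq leb2 unit_sq (fun z => K z - kernel_of e A z) = 0%E).

(** The truncated integrals have an exact Gaussian moment generating function by
    independence; their limit inherits the bound, with the limiting variance
    expressed in the observation basis. *)
Lemma step_int_gaussian_like : gaussian_like P (step_int q X)
  (\sum_(j < l) \sum_(k < l) A j k * (inner (e j) Q * inner (e k) Q) + sigma ^+ 2 * inner Q Q).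
Proof.
apply: (gaussian_like_closed truncated_gaussian) => //.
- exact: measurable_step_int.
- apply: cvgD; last exact: cvg_cst.
  exact: (cov_expansion_pairing eON KE KA sQ sQ).
Qed.

End signal_plus_noise.

(** * Linear forms of the observed coordinates *)

Section combined_step_lists.
Context {R : realType} d (T : measurableType d) (P : probability T R).
Implicit Types (q : step_list (R := R)).

Definition scale_steps (a : R) q : step_list := [seq (a * x.1, x.2) | x <- q].

Definition combine_steps l (a : 'I_l -> R) (qs : 'I_l -> step_list (R := R)) : step_list :=
  flatten [seq scale_steps (a k) (qs k) | k <- index_enum 'I_l].

Lemma step_in_unit_combine l (a : 'I_l -> R) qs :
  (forall k, step_in_unit (qs k)) -> step_in_unit (combine_steps a qs).
Proof.
by move=> h x /flattenP[_ /mapP[k _ ->] /mapP[y yq ->]]; exact: h yq.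
Qed.

Lemma step_fun_combine l (a : 'I_l -> R) qs t :
  step_fun (combine_steps a qs) t = \sum_(k < l) a k * step_fun (qs k) t.
Proof.
rewrite /step_fun big_flatten /= big_map; apply: eq_bigr => k _.
by rewrite big_map mulr_sumr; apply: eq_bigr => x _; rewrite mulrA.
Qed.

Lemma step_int_combine l (a : 'I_l -> R) qs (X : R -> {RV P >-> R}) w :
  step_int (combine_steps a qs) X w = \sum_(k < l) a k * step_int (qs k) X w.
Proof.
rewrite /step_int big_flatten /= big_map; apply: eq_bigr => k _.
by rewrite big_map mulr_sumr; apply: eq_bigr => x _; rewrite mulrA.
Qed.

End combined_step_lists.

Lemma cvg_finite_sum (R : realType) (I : Type) (s : seq I) (u : I -> nat -> R) (l : I -> R) :
  (forall i, u i @ \oo --> l i) ->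
  (fun m => \sum_(i <- s) u i m) @ \oo --> \sum_(i <- s) l i.
Proof.
move=> ul; elim: s => [|i s IH].
  by rewrite big_nil; under eq_cvg do rewrite big_nil; exact: cvg_cst.
by rewrite big_cons; under eq_cvg do rewrite big_cons; exact: cvgD.
Qed.

Section observed_coordinates.
Context {R : realType} d (T : measurableType d) (P : probability T R).
Context (sigma : R) (r : option nat) (K : R * R -> R) (e : nat -> R -> R) (l : nat)
  (A : 'M[R]_l).
Hypotheses (eON : orthonormal_sys xpredT e)
  (KA : L2sq leb2 unit_sq (fun z => K z - kernel_of e A z) = 0%E).
Let mI := @measurable_unit_itv R.
Let eL2 k : in_L2 (e k). Proof. by case: eON => + _; apply. Qed.

Definition direction_variance (x : 'rV[R]_l) : R :=
  (x *m A *m x^T) 0 0 + sigma ^+ 2 * (x *m x^T) 0 0.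

Lemma sqnorm_basis_comb (x : 'rV[R]_l) :
  let f := fun t => \sum_(k < l) x 0 k * e k t in inner f f = (x *m x^T) 0 0.
Proof.
move=> f; have sf : square_integrable leb unit_itv f := basis_comb_in_L2 eON x.
rewrite dotmx_rowE {1}/f -[LHS]/(dotL2 leb unit_itv _ f).
have se k : square_integrable leb unit_itv (e k) := eL2 k.
rewrite (@dotL2_suml _ _ R leb unit_itv mI)//; last first.
  by move=> k _; exact: (@square_integrableZ _ _ R leb unit_itv mI).
apply: eq_bigr => k _; rewrite (@dotL2Zl _ _ R leb unit_itv mI)//; congr (_ * _).
exact: inner_basis_comb.
Qed.

(** A linear form of the observed coordinates is again a limit of integrals of
    step functions, whose variances converge to the quadratic form of the
    covariance of the observations. *)
Lemma observed_form_approx (X : R -> {RV P >-> R}) (Y : 'I_l -> {RV P >-> R})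
    (x : 'rV[R]_l) (B : R) :
  signal_noise_process sigma r K X -> (forall k : 'I_l, stoch_integral X (e k) (Y k)) ->
  direction_variance x < B ->
  exists (q : nat -> step_list) (s_ : nat -> R), [/\ forall m, step_in_unit (q m),
    forall m, gaussian_like P (step_int (q m) X) (s_ m), forall m, s_ m <= B,
    s_ @ \oo --> direction_variance x
    & L2_cvg P setT (fun m => step_int (q m) X) (fun w => \sum_(k < l) x 0 k * Y k w)].
Proof.
move=> [lam [phi [xi [W [S [KE [xl [xI [BW [xW [mS [SE XE]]]]]]]]]]]] YX sB.
have /choice[qs qsP] k := YX k.
pose q m := combine_steps (fun k => x 0 k) (fun k => qs k m).
have q01 m : step_in_unit (q m).
  by apply: step_in_unit_combine => k; case: (qsP k).
pose s_ m := \sum_(j < l) \sum_(k < l) A j k *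
   (inner (e j) (step_fun (q m)) * inner (e k) (step_fun (q m)))
   + sigma ^+ 2 * inner (step_fun (q m)) (step_fun (q m)).
have gq m : gaussian_like P (step_int (q m) X) (s_ m).
  exact: (step_int_gaussian_like KE xl xI BW xW mS SE XE (q01 m) eON KA).
pose f t := \sum_(k < l) x 0 k * e k t.
have sf : square_integrable leb unit_itv f := basis_comb_in_L2 eON x.
have sq m : square_integrable leb unit_itv (step_fun (q m)) := in_L2_step_fun (q01 m).
have sqs k m : square_integrable leb unit_itv (step_fun (qs k m)).
  by apply: in_L2_step_fun; case: (qsP k).
have se k : square_integrable leb unit_itv (e k) := eL2 k.
have cq : L2_cvg leb unit_itv (fun m => step_fun (q m)) f.
  have -> : (fun m => step_fun (q m)) = (fun m t => \sum_(k < l) x 0 k * step_fun (qs k m) t).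
    by apply/funext => m; apply/funext => t; exact: step_fun_combine.
  apply: (@L2_cvg_sum _ _ R leb unit_itv mI _ _ (fun k m t => x 0 k * step_fun (qs k m) t)
    (fun k t => x 0 k * e k t)).
  - by move=> k m; exact: (@square_integrableZ _ _ R leb unit_itv mI).
  - by move=> k; exact: (@square_integrableZ _ _ R leb unit_itv mI).
  - move=> k; apply: (@L2_cvgZ _ _ R leb unit_itv mI) => //.
    by case: (qsP k).
have ce j : (fun m => inner (e j) (step_fun (q m))) @ \oo --> inner (e j) f.
  have := @L2_cvg_dotL2 _ _ R leb unit_itv mI _ _ sq sf cq _ (se j).
  rewrite [X in _ --> X -> _]dotL2C.
  by rewrite (funext (fun m => dotL2C leb unit_itv (step_fun (q m)) (e j))).
have cs : s_ @ \oo --> direction_variance x.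
  rewrite /direction_variance -(quad_inner_basis_comb eON) -sqnorm_basis_comb.
  apply: cvgD.
    apply: cvg_finite_sum => j; apply: cvg_finite_sum => k; apply: cvgMr.
    by apply: cvgM; exact: ce.
  by apply: cvgMr; exact: (@L2_cvg_dotL2_sq _ _ R leb unit_itv mI).
have sY k m : square_integrable P setT (step_int (qs k m) X).
  have qk01 : step_in_unit (qs k m) by case: (qsP k).
  apply: gaussian_like_square_integrable.
  exact: (step_int_gaussian_like KE xl xI BW xW mS SE XE qk01 eON KA).
have cY k : L2_cvg P setT (fun m => step_int (qs k m) X) (Y k) by case: (qsP k).
have sYk k : square_integrable P setT (Y k).
  by apply: (L2_cvg_square_integrable measurableT (sY k) _ (cY k)).
have cqY : L2_cvg P setT (fun m => step_int (q m) X) (fun w => \sum_(k < l) x 0 k * Y k w).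
  have -> : (fun m => step_int (q m) X) = (fun m w => \sum_(k < l) x 0 k * step_int (qs k m) X w).
    by apply/funext => m; apply/funext => w; exact: step_int_combine.
  apply: (@L2_cvg_sum _ _ R P setT measurableT _ _ (fun k m w => x 0 k * step_int (qs k m) X w)
    (fun k w => x 0 k * Y k w)).
  - by move=> k m; exact: square_integrableZ.
  - by move=> k; exact: square_integrableZ.
  - by move=> k; exact: L2_cvgZ.
have [N _ NB] : \forall m \near \oo, s_ m <= B.
  by near=> m; apply: ltW; near: m; apply: (cvgr_lt (direction_variance x)).
have shift : (fun m => (m + N)%N) @ \oo --> \oo.
  move=> E [M _ ME]; exists M => // m /= Mm; apply: ME => /=.
  exact: leq_trans Mm (leq_addr _ _).
exists (fun m => q (m + N)%N), (fun m => s_ (m + N)%N); split.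
- by move=> m; exact: q01.
- by move=> m; exact: gq.
- by move=> m; apply: NB => /=; exact: leq_addl.
- exact: (cvg_comp (fun m => (m + N)%N) s_ shift cs).
- exact: (cvg_comp (fun m => (m + N)%N) _ shift cqY).
Unshelve. all: by end_near. Qed.

End observed_coordinates.

(** * Sums over independent observations *)

Section independent_observations.
Context {R : realType} d (T : measurableType d) (P : probability T R) (n : nat).
Context (X : 'I_n -> R -> {RV P >-> R}) (q : 'I_n -> nat -> step_list (R := R))
  (s_ : 'I_n -> nat -> R) (s B b : R) (Y : 'I_n -> T -> R).
Hypotheses (Xindep : indep_processes X) (q01 : forall i m, step_in_unit (q i m))
  (gq : forall i m, gaussian_like P (step_int (q i m) (X i)) (s_ i m))
  (sB : forall i m, s_ i m <= B) (cs : forall i, s_ i @ \oo --> s)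
  (cY : forall i, L2_cvg P setT (fun m => step_int (q i m) (X i)) (Y i))
  (mY : forall i, measurable_fun setT (Y i)) (B0 : 0 < B) (bB : `|b| * B <= 1 / 8).

Let Z i m := step_int (q i m) (X i).
Let mZ i m : measurable_fun setT (Z i m) := measurable_step_int (X i) (q i m).

Let approx_bound m :
  (\int[P]_w (expR (\sum_i b * (Z i m w ^+ 2 - s_ i m)))%:E <=
   (expR (n%:R * (1400 * b ^+ 2 * B ^+ 2)))%:E)%E.
Proof.
pose F (i : 'I_n) w := expR (b * (Z i m w ^+ 2 - s_ i m)).
have mF i : measurable_fun setT (F i).
  apply: measurable_expR_comp; apply: measurable_funM => //; apply: measurable_funB => //.
  by apply: measurable_funX; exact: mZ.
have EF i : (\int[P]_w (F i w)%:E <= (expR (1400 * b ^+ 2 * B ^+ 2))%:E)%E.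
  exact: gaussian_like_bernstein (gq i m) (sB i m) B0 bB.
have -> : (\int[P]_w (expR (\sum_i b * (Z i m w ^+ 2 - s_ i m)))%:E =
    \int[P]_w (\prod_(i < n) F i w)%:E)%E.
  by apply: eq_integral => w _; rewrite expR_sum.
rewrite (indep_product Xindep (fun i _ => mF i) _ _ _ (index_enum_uniq _) (fun _ _ => I)).
- rewrite expRM_natl -[X in (_ ^+ X)%:E]card_ord -prodr_const -prodEFin.
  elim: (index_enum 'I_n) => [|i t IH]; first by rewrite !big_nil.
  rewrite !big_cons; apply: lee_pmul => //.
  - by apply: integral_ge0 => w _; rewrite lee_fin expR_ge0.
  - apply: prode_ge0 => k _; apply: integral_ge0 => w _; rewrite lee_fin expR_ge0//.
- move=> i E _ mE; apply: (adapted_sigma_of _ mE); apply: adapted_expR; apply: adaptedZ.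
  apply: measurable_funB => //; apply: measurable_funX.
  exact: adapted_step_int.
- by move=> i w; exact: expR_ge0.
- by move=> i _; apply: le_lt_trans (EF i) _; rewrite ltry.
Qed.

(** For integrals of step functions the bound is a product of one-observation
    bounds. It passes to the observed variables by Fatou's lemma along a
    subsequence that converges almost everywhere for all observations. *)
Lemma sum_squares_mgf :
  (\int[P]_w (expR (b * \sum_i (Y i w ^+ 2 - s)))%:E <=
   (expR (n%:R * (1400 * b ^+ 2 * B ^+ 2)))%:E)%E.
Proof.
pose h m w := \sum_i (Z i m w - Y i w) ^+ 2.
have mZY i m : measurable_fun setT (fun w => (Z i m w - Y i w) ^+ 2).
  by apply: measurable_funX; apply: measurable_funB => //; exact: mZ.
have mh m : measurable_fun setT (h m) by apply: measurable_sum => i.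
have h0 m w : 0 <= h m w by apply: sumr_ge0 => i _; exact: sqr_ge0.
have ch : (fun m => \int[P]_w (h m w)%:E)%E @ \oo --> 0%E.
  have -> : (fun m => \int[P]_w (h m w)%:E)%E =
      (fun m => \sum_(i < n) L2sq P setT (fun w => (Z i m w - Y i w)%R))%E.
    apply/funext => m; rewrite /h; under eq_integral do rewrite -sumEFin.
    rewrite ge0_integral_sum// => [i|i w _]; first by apply/measurable_EFinP.
    by rewrite lee_fin sqr_ge0.
  rewrite [X in _ --> X](_ : 0%E = (\sum_(i < n) 0)%E); last by rewrite big1.
  apply: (@cvg_nnesum _ _ _ R _ (index_enum 'I_n)
    (fun i m => L2sq P setT (fun w => Z i m w - Y i w)) (fun=> 0%E)) => i _; last exact: cY.
  by apply: nearW => m; apply: integral_ge0 => w _; rewrite lee_fin sqr_ge0.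
have [phi [kphi cphi]] := ae_cvg_subsequence mh h0 ch.
have phioo : phi @ \oo --> \oo.
  move=> E [N _ NE]; exists N => // k /= Nk; apply: NE => /=.
  exact: leq_trans (kphi k).
apply: (@fatou_subsequence _ _ R P (fun m w => expR (\sum_i b * (Z i m w ^+ 2 - s_ i m))) _
  (fun=> expR (n%:R * (1400 * b ^+ 2 * B ^+ 2))) _ phi) => //.
- move=> m; apply: measurable_expR_comp; apply: measurable_sum => i.
  by apply: measurable_funM => //; apply: measurable_funB => //; apply: measurable_funX; exact: mZ.
- apply: measurable_expR_comp; apply: measurable_funM => //; apply: measurable_sum => i.
  by apply: measurable_funB => //; exact: measurable_funX.
- apply: filterS cphi => w cw.
  have cZ i : (fun k => Z i (phi k) w) @ \oo --> Y i w.
    apply: cvg_of_sqr_cvg0.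
    apply: (@squeeze_cvgr _ _ _ _ (cst 0) (fun k => h (phi k) w)) => //; last exact: cvg_cst.
    apply: nearW => k; rewrite sqr_ge0/= /h (bigD1 i)//= lerDl sumr_ge0// => j _.
    exact: sqr_ge0.
  rewrite mulr_sumr.
  apply: (cvg_comp (fun k => \sum_i b * (Z i (phi k) w ^+ 2 - s_ i (phi k))) expR); last first.
    exact: continuous_expR.
  apply: cvg_finite_sum => i; apply: cvgMr; apply: cvgB.
    by rewrite expr2; under eq_cvg do rewrite expr2; exact: cvgM.
  exact: (cvg_comp phi (s_ i) phioo (cs i)).
- exact: cvg_cst.
Qed.

End independent_observations.

(** Monotonicity for functions that may fail to be measurable, such as the loss
    of an arbitrary choice of minimisers: the integral of a nonnegative function
    is a supremum over the simple functions below it. *)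
Lemma le_integral_nonmeasurable d (T : measurableType d) (R : realType)
    (mu : {measure set T -> \bar R}) (f g : T -> \bar R) :
  (forall x, 0 <= f x)%E -> (forall x, f x <= g x)%E ->
  (\int[mu]_x f x <= \int[mu]_x g x)%E.
Proof.
move=> f0 fg; rewrite !ge0_integralTE//; last by move=> x; exact: le_trans (fg x).
apply: le_ereal_sup => _ [h hf <-]; exists h => // x.
exact: le_trans (hf x) (fg x).
Qed.

(** * The penalty level and the penalised objective *)

Section rate.
Context {R : realType} (n l : nat) (t : R).
Hypotheses (n1 : (1 <= n)%N) (l1 : (1 <= l)%N) (t0 : 0 < t).
Let L : R := l%:R + t.
Let n0 : 0 < n%:R :> R. Proof. by rewrite ltr0n. Qed.
Let l0 : 1 <= l%:R :> R. Proof. by rewrite ler1n. Qed.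
Let x0 : 0 < L / n%:R. Proof. by rewrite divr_gt0// addr_gt0// ltr0n. Qed.
Let sqx : Num.sqrt (L / n%:R) ^+ 2 = L / n%:R. Proof. by rewrite sqr_sqrtr// ltW. Qed.

Lemma delta_cases : (delta n l t <= 1 /\ delta n l t ^+ 2 = L / n%:R) \/
  (1 < delta n l t /\ delta n l t = L / n%:R).
Proof.
have s0 : 0 < Num.sqrt (L / n%:R) by rewrite sqrtr_gt0.
rewrite /delta -/L; have [x1|x1] := leP (L / n%:R) 1.
  have s1 : Num.sqrt (L / n%:R) <= 1 by rewrite -[leRHS]sqrtr1 ler_wsqrtr.
  have xs : L / n%:R <= Num.sqrt (L / n%:R).
    by rewrite -[leLHS]sqx expr2 ler_piMl// ltW.
  by left; rewrite max_l// sqx.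
have s1 : 1 <= Num.sqrt (L / n%:R) by rewrite -[leLHS]sqrtr1 ler_wsqrtr// ltW.
have sx : Num.sqrt (L / n%:R) <= L / n%:R.
  by rewrite -[leRHS]sqx expr2 ler_peMl// ltW.
by right; rewrite max_r.
Qed.

Lemma delta_gt0 : 0 < delta n l t.
Proof. by rewrite /delta lt_max -/L x0 orbT. Qed.

Lemma min_delta_gt0 : 0 < Num.min 1 (delta n l t).
Proof. by rewrite lt_min ltr01 delta_gt0. Qed.

Lemma min_delta_mul : n%:R * Num.min 1 (delta n l t) * delta n l t = L.
Proof.
have [[d1 d2]|[d1 d2]] := delta_cases.
  by rewrite min_r// -mulrA -expr2 d2 mulrC divfK// gt_eqF.
by rewrite min_l ?(ltW d1)// mulr1 d2 mulrC divfK// gt_eqF.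
Qed.

Lemma min_delta_sq : 1 <= n%:R * Num.min 1 (delta n l t) ^+ 2 <= L.
Proof.
have [[d1 d2]|[d1 d2]] := delta_cases.
  by rewrite min_r// d2 mulrC divfK ?gt_eqF// lexx andbT ler_wpDr// ltW.
rewrite min_l ?(ltW d1)// expr1n mulr1 ler1n n1/=.
by move: d1; rewrite d2 ltr_pdivlMr// mul1r => /ltW.
Qed.

(** If [delta <= 1] then [mu^2] is of order [(l + t) / n], and otherwise
    [mu lmax] is. *)
Lemma penalty_rate (c tau lmax B : R) : 1 <= c -> 0 < tau -> t <= tau * l%:R ->
  0 < lmax -> lmax <= B ->
  c * B * delta n l t * Num.min (c * B * delta n l t) lmax <=
  c ^+ 2 * (1 + tau) * B ^+ 2 * (l%:R / n%:R).
Proof.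
move=> c1 tau0 tl lm0 lmB; have B0 : 0 < B by lra.
have c0 : 0 < c by lra.
have mu0 : 0 <= c * B * delta n l t by rewrite !mulr_ge0// ltW// delta_gt0.
have xb : L / n%:R <= (1 + tau) * (l%:R / n%:R).
  by rewrite mulrA ler_pM2r ?invr_gt0// /L mulrDl mul1r lerD2l.
have [[d1 d2]|[d1 d2]] := delta_cases.
  apply: (@le_trans _ _ ((c * B * delta n l t) ^+ 2)).
    by rewrite expr2 ler_wpM2l// ge_min lexx.
  rewrite !exprMn d2.
  have -> : c ^+ 2 * (1 + tau) * B ^+ 2 * (l%:R / n%:R) =
     c ^+ 2 * B ^+ 2 * ((1 + tau) * (l%:R / n%:R)) by ring.
  by rewrite ler_wpM2l// mulr_ge0 ?sqr_ge0.
apply: (@le_trans _ _ (c * B * delta n l t * B)).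
  by rewrite ler_wpM2l// ge_min lmB orbT.
rewrite d2; have -> : c * B * (L / n%:R) * B = c * (B ^+ 2 * (L / n%:R)) by ring.
apply: (@le_trans _ _ (c ^+ 2 * (B ^+ 2 * (L / n%:R)))).
  have cc : c <= c ^+ 2 by rewrite expr2 ler_peMl// ltW.
  by apply: ler_wpM2r cc; rewrite mulr_ge0 ?sqr_ge0 ?(ltW x0).
have -> : c ^+ 2 * (1 + tau) * B ^+ 2 * (l%:R / n%:R) =
     c ^+ 2 * (B ^+ 2 * ((1 + tau) * (l%:R / n%:R))) by ring.
by rewrite !ler_wpM2l// sqr_ge0.
Qed.

End rate.

Section empirical_matrix.
Context {R : realType} (e : nat -> R -> R) (n l : nat).

Definition empirical_mx (y : 'I_n -> 'I_l -> R) : 'M[R]_l :=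
  \matrix_(j, k) (n%:R^-1 * \sum_(i < n) y i j * y i k).

Lemma empirical_mx_symmetric y : symmetric_mx (empirical_mx y).
Proof.
apply/matrixP => j k; rewrite !mxE; congr (_ * _).
by apply: eq_bigr => i _; rewrite mulrC.
Qed.

Lemma empirical_mx_quad y (x : 'rV[R]_l) :
  (x *m empirical_mx y *m x^T) 0 0 =
  n%:R^-1 * \sum_(i < n) (\sum_(k < l) x 0 k * y i k) ^+ 2.
Proof.
have sqE i : (\sum_(k < l) x 0 k * y i k) ^+ 2 =
    \sum_(k < l) \sum_(j < l) x 0 j * (y i j * y i k) * x 0 k.
  rewrite expr2 mulr_sumr; apply: eq_bigr => k _.
  by rewrite mulr_suml; apply: eq_bigr => j _; ring.
under eq_bigr do rewrite sqE.
rewrite exchange_big mulr_sumr mxE; apply: eq_bigr => k _ /=.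
rewrite mxE exchange_big mulr_sumr mulr_suml; apply: eq_bigr => j _ /=.
rewrite !mxE mulr_sumr !mulr_sumr !mulr_suml; apply: eq_bigr => i _.
ring.
Qed.

Lemma empirical_kernel y z : Rn e y z = kernel_of e (empirical_mx y) z.
Proof.
rewrite /Rn /kernel_of /Xdot.
under [RHS]eq_bigr => j _ do under eq_bigr => k _ do rewrite mxE -mulrA mulr_suml.
under [RHS]eq_bigr => j _ do rewrite -mulr_sumr exchange_big.
rewrite -mulr_sumr exchange_big; congr (_ * _); apply: eq_bigr => i _ /=.
rewrite mulr_suml; apply: eq_bigr => j _; rewrite mulr_sumr.
by apply: eq_bigr => k _; ring.
Qed.

Lemma identity_kernel z : Iker e l z = kernel_of e (1%:M : 'M[R]_l) z.
Proof.
apply: eq_bigr => j _; rewrite (bigD1 j)//= big1 ?addr0.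
  by rewrite mxE eqxx mul1r.
by move=> k kj; rewrite mxE eq_sym (negbTE kj) mul0r.
Qed.

(** Parseval's identity for the first term, the trace for the penalty. *)
Lemma objectiveE (sigma mu : R) y (B : 'M[R]_l) : orthonormal_sys xpredT e ->
  symmetric_mx B -> nonneg_definite B ->
  objective e sigma mu (Rn e y) B =
  (hs_sq (empirical_mx y - (sigma ^+ 2)%:M - B) + mu * \tr B)%:E.
Proof.
move=> eON Bs B0; rewrite /objective nuclear_norm_psd// EFinD; congr (_ + _)%E.
rewrite -(L2sq_kernel eON); congr L2sq; apply/funext => z.
rewrite empirical_kernel identity_kernel !kernelB.
have -> : kernel_of e ((sigma ^+ 2)%:M : 'M[R]_l) z = sigma ^+ 2 * kernel_of e (1%:M : 'M[R]_l) z.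
  rewrite /kernel_of mulr_sumr; apply: eq_bigr => j _; rewrite mulr_sumr.
  by apply: eq_bigr => k _; rewrite !mxE; case: (j == k); rewrite ?mulr1n ?mulr0n ?mul0r ?mulr0 ?mul1r.
by rewrite addrAC.
Qed.

End empirical_matrix.

(** * The noise and the risk of the estimator *)

Section noise.
Context {R : realType} d (T : measurableType d) (P : probability T R) (n l : nat).
Context (sigma lmax : R) (r : option nat) (K : R * R -> R) (e : nat -> R -> R)
  (A : 'M[R]_l) (X : 'I_n -> R -> {RV P >-> R}) (Y : 'I_n -> 'I_l -> {RV P >-> R}).
Hypotheses (n1 : (1 <= n)%N) (l1 : (1 <= l)%N) (eON : orthonormal_sys xpredT e)
  (As : symmetric_mx A) (Al : spectral_norm A <= lmax)
  (KA : L2sq leb2 unit_sq (fun z => K z - kernel_of e A z) = 0%E)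
  (lmax0 : 0 < lmax) (sigma0 : 0 < sigma)
  (Xmodel : forall i, signal_noise_process sigma r K (X i))
  (Xindep : indep_processes X)
  (XY : forall i (k : 'I_l), stoch_integral (X i) (e k) (Y i k)).

Definition noise_mx w : 'M[R]_l :=
  empirical_mx (fun i k => Y i k w) - (sigma ^+ 2)%:M - A.
Definition noise_form (x : 'rV[R]_l) w : R := (x *m noise_mx w *m x^T) 0 0.

Let n0 : 0 < n%:R :> R. Proof. by rewrite ltr0n. Qed.
Let Bn : R := lmax + sigma ^+ 2.
Let Bn0 : 0 < Bn. Proof. by rewrite addr_gt0// exprn_gt0. Qed.

Lemma noise_form_sum x w : noise_form x w = n%:R^-1 *
  \sum_(i < n) ((\sum_(k < l) x 0 k * Y i k w) ^+ 2 - direction_variance sigma A x).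
Proof.
have -> : noise_form x w = (x *m (empirical_mx (fun i k => Y i k w) +
    (-1) *: (sigma ^+ 2)%:M + (-1) *: A) *m x^T) 0 0.
  by rewrite /noise_form /noise_mx !scaleN1r.
rewrite !quadD !quadZ quad_scalar empirical_mx_quad.
rewrite sumrB sumr_const card_ord -[_ *+ n]mulr_natl /direction_variance.
by field; rewrite gt_eqF.
Qed.

Lemma measurable_noise_form x : measurable_fun setT (noise_form x).
Proof.
rewrite (funext (noise_form_sum x)).
apply: measurable_funM => //; apply: measurable_sum => i; apply: measurable_funB => //.
by apply: measurable_funX; apply: measurable_sum => k; exact: measurable_funM.
Qed.

Lemma noise_form_mgf (x : 'rV[R]_l) (B b : R) : direction_variance sigma A x < B ->
  0 < B -> `|b| / n%:R * B <= 1 / 8 ->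
  (\int[P]_w (expR (b * noise_form x w))%:E <= (expR (1400 * b ^+ 2 * B ^+ 2 / n%:R))%:E)%E.
Proof.
move=> xB B0 bB.
have approx i := observed_form_approx eON KA (Xmodel i) (XY i) xB.
have [q Hq] := choice approx; have {Hq}[s_ Hq] := choice Hq.
have bn : `|b / n%:R| * B <= 1 / 8.
  by rewrite normrM normfV [`|n%:R|]ger0_norm ?(ltW n0).
have mY i : measurable_fun setT (fun w => \sum_(k < l) x 0 k * Y i k w).
  by apply: measurable_sum => k; exact: measurable_funM.
have := @sum_squares_mgf R d T P n X q s_ (direction_variance sigma A x) B (b / n%:R)
  (fun i w => \sum_(k < l) x 0 k * Y i k w) Xindep _ _ _ _ _ mY B0 bn.
have -> : n%:R * (1400 * (b / n%:R) ^+ 2 * B ^+ 2) = 1400 * b ^+ 2 * B ^+ 2 / n%:R.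
  by field; rewrite gt_eqF.
move=> h; under eq_integral do rewrite noise_form_sum mulrA.
by apply: h => i; have [] := Hq i.
Qed.

Lemma direction_variance_bound (x : 'rV[R]_l) : (x *m x^T) 0 0 <= 25 / 16 ->
  direction_variance sigma A x < 2 * Bn.
Proof.
move=> x1; have h := quad_le_spectral_norm x As; have x0 := dot_ge0 x.
have h2 : direction_variance sigma A x <= Bn * (x *m x^T) 0 0.
  rewrite /direction_variance /Bn mulrDl lerD2r (le_trans h)// ler_wpM2r//.
by have := ler_wpM2l (ltW Bn0) x1; have := Bn0; lra.
Qed.

(** For [u] the value of the noise form, [u^2] on the event [|u| > a] is at most
    [2 / theta^2 exp (theta |u|)], hence at most
    [2 / theta^2 exp (- theta a) exp (2 theta |u|)] there. *)
Definition excess (theta a : R) (x : 'rV[R]_l) w : R :=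
  2 / theta ^+ 2 * expR (- (theta * a)) *
  (expR (2 * theta * noise_form x w) + expR (- (2 * theta) * noise_form x w)).

Lemma excess_ge theta a x w : 0 < theta ->
  noise_form x w ^+ 2 * (a < `|noise_form x w|)%R%:R <= excess theta a x w.
Proof.
move=> th0; set u := noise_form x w.
have E0 : 0 <= excess theta a x w.
  by rewrite /excess mulr_ge0 ?addr_ge0 ?expR_ge0// mulr_ge0 ?expR_ge0// divr_ge0// sqr_ge0.
have [au|_] := ltP a `|u|; last by rewrite mulr0.
rewrite mulr1.
have h1 : u ^+ 2 <= 2 / theta ^+ 2 * expR (theta * `|u|).
  have := sqr_half_le_expR (mulr_ge0 (ltW th0) (normr_ge0 u)).
  rewrite exprMn real_normK ?num_real// => h.
  have -> : u ^+ 2 = 2 / theta ^+ 2 * (theta ^+ 2 * u ^+ 2 / 2) by field; rewrite gt_eqF.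
  by rewrite ler_wpM2l// divr_ge0// sqr_ge0.
apply: (le_trans h1); rewrite /excess -/u -[leRHS]mulrA ler_wpM2l ?divr_ge0 ?sqr_ge0//.
apply: (@le_trans _ _ (expR (- (theta * a)) * expR (2 * theta * `|u|))).
  rewrite -expRD ler_expR; have := ler_wpM2l (ltW th0) (ltW au); lra.
rewrite ler_wpM2l ?expR_ge0//.
have -> : 2 * theta * `|u| = `|2 * theta * u|.
  by rewrite normrM gtr0_norm// mulr_gt0.
by rewrite mulNr expR_norm_le.
Qed.

(** Union bound over the net. The value of [theta] makes [2 theta] satisfy the
    smallness condition of [noise_form_mgf] with [B = 2 Bn]. With [L = l + t] the exponent [theta a] is
    [c / 192 L]; the exponential moment of the noise form costs [22 L] and the
    entropy of the net [27 L], whence the condition [c >= 192 * 49]. *)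
Lemma sum_excess (c t : R) (theta := n%:R * Num.min 1 (delta n l t) / (32 * Bn))
    (a := c * Bn * delta n l t / 6) : 0 < t -> 192 * 49 <= c ->
  (\int[P]_w (\sum_(m : net_index l | @net R l m) excess theta a (net_point m) w)%:E
    <= ((64 * Bn) ^+ 2 / n%:R)%:E)%E.
Proof.
move=> t0 cc; have mn0 := min_delta_gt0 n1 l1 t0.
have th0 : 0 < theta by rewrite divr_gt0 ?mulr_gt0.
have mexc m : measurable_fun setT (excess theta a (net_point m)).
  apply: measurable_funM => //; apply: measurable_funD; apply: measurable_expRZ;
  exact: measurable_noise_form.
have exc0 m w : 0 <= excess theta a (net_point m) w.
  by rewrite /excess mulr_ge0 ?addr_ge0 ?expR_ge0// mulr_ge0 ?expR_ge0// divr_ge0// sqr_ge0.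
pose L : R := l%:R + t.
have min1 : Num.min 1 (delta n l t) <= 1 by rewrite ge_min lexx.
have Eexc m : @net R l m -> (\int[P]_w (excess theta a (net_point m) w)%:E <=
   (4 / theta ^+ 2 * expR (- (27 * L)))%:E)%E.
  move=> mn; have xB := direction_variance_bound (net_point_bounded l1 mn).
  have B20 : 0 < 2 * Bn by rewrite mulr_gt0.
  have mgf b : b ^+ 2 = (2 * theta) ^+ 2 -> `|b| = 2 * theta ->
     (\int[P]_w (expR (b * noise_form (net_point m) w))%:E <= (expR (22 * L))%:E)%E.
    move=> b2 bth; apply: le_trans (noise_form_mgf xB B20 _) _.
      rewrite bth /theta.
      have -> : 2 * (n%:R * Num.min 1 (delta n l t) / (32 * Bn)) / n%:R * (2 * Bn) =
         Num.min 1 (delta n l t) / 8 by field; rewrite !gt_eqF.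
      by rewrite ler_pM2r ?invr_gt0.
    rewrite lee_fin ler_expR b2 /theta.
    have -> : 1400 * (2 * (n%:R * Num.min 1 (delta n l t) / (32 * Bn))) ^+ 2 * (2 * Bn) ^+ 2 / n%:R =
       175 / 8 * (n%:R * Num.min 1 (delta n l t) ^+ 2) by field; rewrite !gt_eqF.
    have /andP[h1 h2] := min_delta_sq n1 l1 t0; rewrite -/L in h2; lra.
  have mE b : measurable_fun setT (fun w => expR (b * noise_form (net_point m) w)).
    by apply: measurable_expRZ; exact: measurable_noise_form.
  have E0 b w : 0 <= expR (b * noise_form (net_point m) w) by exact: expR_ge0.
  have k0 : 0 <= 2 / theta ^+ 2 * expR (- (theta * a)).
    by rewrite mulr_ge0 ?expR_ge0// divr_ge0// sqr_ge0.
  rewrite /excess (expectZ P k0 (measurable_funD (mE _) (mE _))); last first.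
    by move=> w; rewrite addr_ge0.
  rewrite (expectD P (mE _) (mE _) (E0 _) (E0 _)).
  have th2 : `|2 * theta| = 2 * theta by rewrite gtr0_norm// mulr_gt0.
  have Nth2 : `|- (2 * theta)| = 2 * theta by rewrite normrN.
  have h := leeD (mgf (2 * theta) erefl th2) (mgf (- (2 * theta)) (sqrrN _) Nth2).
  have k0' : (0 <= (2 / theta ^+ 2 * expR (- (theta * a)))%:E)%E by rewrite lee_fin.
  apply: (le_trans (lee_wpmul2l k0' h)); rewrite -EFinD -EFinM lee_fin.
  have -> : 2 / theta ^+ 2 * expR (- (theta * a)) * (expR (22 * L) + expR (22 * L)) =
     4 / theta ^+ 2 * (expR (- (theta * a)) * expR (22 * L)) by ring.
  rewrite ler_wpM2l ?divr_ge0 ?sqr_ge0// -expRD ler_expR.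
  have -> : theta * a = c / 192 * L.
    rewrite /theta /a /L -(min_delta_mul n1 l1 t0); field; rewrite gt_eqF//.
  have L0 : 0 <= L by rewrite addr_ge0// ltW.
  have := ler_wpM2r L0 cc; lra.
under eq_integral do rewrite -sumEFin -big_filter.
rewrite ge0_integral_sum//; last 2 first.
- by move=> m; apply/measurable_EFinP.
- by move=> m w _; rewrite lee_fin.
rewrite big_filter.
apply: (@le_trans _ _ (\sum_(m : net_index l | @net R l m)
   (4 / theta ^+ 2 * expR (- (27 * L)))%:E)%E).
  by apply: lee_sum => m mn; exact: Eexc.
rewrite sumEFin lee_fin sumr_const -[leLHS]mulr_natl.
have e2 : 2 <= expR 1 :> R by apply: le_trans (expR_ge1Dx 1); lra.
have card : #|@net R l|%:R <= expR (27 * L) :> R.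
  apply: (le_trans (@card_net R l l1)).
  have b3 : 3 * expR 25 <= expR 27 :> R.
    rewrite (_ : 27 = 1 + 1 + 25 :> R); last by ring.
    rewrite !expRD ler_wpM2r ?expR_ge0//.
    have : 2 * 2 <= expR 1 * expR 1 :> R by rewrite ler_pM.
    lra.
  apply: (@le_trans _ _ (expR 27 ^+ l)).
    by rewrite lerXn2r ?nnegrE ?mulr_ge0 ?expR_ge0.
  by rewrite -expRM_natr ler_expR ler_wpM2l// /L lerDl ltW.
have q0 : 0 <= 4 / theta ^+ 2 by rewrite divr_ge0// sqr_ge0.
apply: (@le_trans _ _ (4 / theta ^+ 2)).
  have := ler_wpM2r (expR_ge0 (- (27 * L))) card.
  rewrite expRxMexpNx_1 => h; rewrite mulrCA -[leRHS]mulr1 ler_wpM2l//.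
have /andP[h1 _] := min_delta_sq n1 l1 t0.
have -> : 4 / theta ^+ 2 = (64 * Bn) ^+ 2 / n%:R / (n%:R * Num.min 1 (delta n l t) ^+ 2).
  by rewrite /theta; field; rewrite !gt_eqF.
have: 0 <= (64 * Bn) ^+ 2 / n%:R by rewrite divr_ge0 ?ler0n ?sqr_ge0.
move: h1; move: ((64 * Bn) ^+ 2 / n%:R) (n%:R * _ ^+ 2) => y x x1 y0.
rewrite ler_pdivrMr; last exact: lt_le_trans ltr01 x1.
exact: ler_peMr.
Qed.

End noise.

Theorem corollary4 (R : realType) :
  exists2 c0 : R, 0 < c0 &
  forall c : R, c0 <= c ->
  forall tau : R, 0 < tau ->
  exists2 C : R, 0 < C &
  forall (n l : nat) (t : R) (r : option nat) (sigma lmax : R)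
         (e : nat -> R -> R),
    (1 <= n)%N -> (1 <= l)%N -> 0 < t -> t <= tau * l%:R ->
    r <> Some 0%N -> 0 < sigma -> 0 < lmax -> orthonormal_basis e ->
  forall K : R * R -> R, cov_class e r l lmax K ->
  forall (d : measure_display) (T : measurableType d) (P : probability T R)
         (X : 'I_n -> R -> {RV P >-> R})
         (Y : 'I_n -> 'I_l -> {RV P >-> R})
         (Ahat : T -> 'M[R]_l),
    (forall i, signal_noise_process sigma r K (X i)) ->
    indep_processes X ->
    (forall i (k : 'I_l), stoch_integral (X i) (e k) (Y i k)) ->
    (forall w, is_estimate e sigma (c * (lmax + sigma ^+ 2) * delta n l t)
                 (Rn e (fun i k => Y i k w)) (Ahat w)) ->
    (\int[P]_w L2sq leb2 unit_sq (fun z => kernel_of e (Ahat w) z - K z)%R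
      <= (C * (lmax + sigma ^+ 2) ^+ 2 * ((rank_min r l)%:R * l%:R / n%:R))%:E)%E.
Proof.
exists (192 * 49) => [|c cc tau tau0]; first by rewrite mulr_gt0.
have c1 : 1 <= c by lra.
have c0 : 0 < c by lra.
(* The first summand comes from [penalty_rate], the second one from the factor
   18 in [oracle_net] and the bound in [sum_excess]. *)
exists (2 * c ^+ 2 * (1 + tau) + (18 * 64 ^+ 2)).
  by rewrite ltr_wpDl ?mulr_gt0 ?exprn_gt0// mulr_ge0 ?mulr_ge0 ?sqr_ge0//; lra.
move=> n l t r sigma lmax e n1 l1 t0 tl r0 sigma0 lmax0 [eON _] K.
move=> [[lam [phi KE]] [A [As KA Al]]] d T P X Y Ahat Xmodel Xindep XY est.
have A0 := cov_nonneg_definite eON KE KA; have Ar := cov_rank eON KE KA.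
under eq_integral do rewrite (L2sq_loss eON KE KA).
set B := lmax + sigma ^+ 2; set mu := c * B * delta n l t.
have B0 : 0 < B by rewrite addr_gt0// exprn_gt0.
have mu0 : 0 <= mu by rewrite !mulr_ge0 ?(ltW c0) ?(ltW B0)// ltW// delta_gt0.
pose theta := n%:R * Num.min 1 (delta n l t) / (32 * B).
have th0 : 0 < theta by rewrite divr_gt0 ?mulr_gt0 ?min_delta_gt0 ?ltr0n.
pose V w := \sum_(m : net_index l | @net R l m) excess sigma A Y theta (mu / 6) (net_point m) w.
pose base := 2 * (\rank A)%:R * mu * Num.min mu lmax.
have pw w : hs_sq (Ahat w - A) <= base + 18 * l%:R * V w.
  have [Hs H0 Hmin] := est w.
  have Ns : symmetric_mx (noise_mx sigma A Y w).
    apply: symmetricB => //; apply: symmetricB; first exact: empirical_mx_symmetric.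
    by rewrite /symmetric_mx tr_scalar_mx.
  apply: le_trans (oracle_net l1 Hs H0 As A0 Ns mu0 Al _) _.
    move=> M Ms M0; have := Hmin M Ms M0.
    rewrite !objectiveE// lee_fin -/B -/mu.
    by rewrite /noise_mx [A + _]addrC subrK.
  rewrite lerD2l ler_wpM2l ?mulr_ge0//.
  by apply: ler_sum => m _; exact: excess_ge.
have base0 : 0 <= base.
  rewrite /base mulr_ge0//; last by rewrite le_min mu0 ltW.
  by rewrite mulr_ge0// mulr_ge0.
have mV : measurable_fun setT V.
  rewrite /V; under eq_fun do rewrite -big_filter; apply: measurable_sum => m.
  apply: measurable_funM => //; apply: measurable_funD; apply: measurable_expRZ;
  exact: measurable_noise_form.
have V0 w : 0 <= V w.
  apply: sumr_ge0 => m _; apply: le_trans (excess_ge _ _ _ _ _ _ th0).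
  by rewrite mulr_ge0 ?sqr_ge0.
apply: (@le_trans _ _ (\int[P]_w (base + 18 * l%:R * V w)%:E)%E).
  apply: le_integral_nonmeasurable => w; first by rewrite lee_fin hs_sq_ge0.
  by rewrite lee_fin pw.
have l18 : 0 <= 18 * l%:R :> R by rewrite mulr_ge0.
rewrite expectD//; last 2 first.
- by apply: measurable_funM.
- by move=> w; rewrite mulr_ge0.
rewrite expect_cst expectZ//.
have EV := sum_excess n1 l1 eON As Al KA lmax0 sigma0 Xmodel Xindep XY t0 cc.
apply: le_trans (leeD2l _ (lee_wpmul2l _ EV)) _; first by rewrite lee_fin.
rewrite -EFinM -EFinD lee_fin -/B.
have rk1 : 1 <= (rank_min r l)%:R :> R.
  by rewrite ler1n /rank_min; case: r r0 {KE Ar Xmodel} => [[//|m] _|//]; rewrite leq_min.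
have rkA : (\rank A)%:R <= (rank_min r l)%:R :> R by rewrite ler_nat.
have pr := penalty_rate n1 l1 t0 c1 tau0 tl lmax0 (_ : lmax <= B).
have {}pr : mu * Num.min mu lmax <= c ^+ 2 * (1 + tau) * B ^+ 2 * (l%:R / n%:R).
  by apply: pr; rewrite lerDl sqr_ge0.
have pr0 : 0 <= mu * Num.min mu lmax by rewrite mulr_ge0// le_min mu0 ltW.
have h1 := ler_pM (ler0n _ _) pr0 rkA pr.
have ln0 : 0 <= B ^+ 2 * (l%:R / n%:R) by rewrite mulr_ge0 ?sqr_ge0// divr_ge0.
have h2 := ler_wpM2r ln0 rk1; rewrite mul1r in h2.
have -> : (2 * c ^+ 2 * (1 + tau) + (18 * 64 ^+ 2)) * B ^+ 2 * ((rank_min r l)%:R * l%:R / n%:R) =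
  2 * ((rank_min r l)%:R * (c ^+ 2 * (1 + tau) * B ^+ 2 * (l%:R / n%:R))) +
  (18 * 64 ^+ 2) * ((rank_min r l)%:R * (B ^+ 2 * (l%:R / n%:R))) by ring.
have -> : 18 * l%:R * ((64 * B) ^+ 2 / n%:R) = (18 * 64 ^+ 2) * (B ^+ 2 * (l%:R / n%:R)) by ring.
have -> : base = 2 * ((\rank A)%:R * (mu * Num.min mu lmax)) by rewrite /base; ring.
by apply: lerD; [rewrite ler_pM2l|rewrite ler_wpM2l// mulr_ge0// exprn_ge0].
Qed.
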